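(* Let $\mathfrak p\in[2,3)$, let $\mathbf Z=(Z,\mathbb Z)$ be a $\mathfrak p$-rough path on $[0,\infty)$ with values in $\mathbb R^m\times\mathbb R^{m\times m}$ (not necessarily geometric), let $\xi=(\xi_1,\dots,\xi_m)\in C^3_b(\mathbb R^d;\mathbb R^{d\times m})$, and let $b:\mathbb R_{\ge0}\times\mathbb R^d\to\mathbb R^d$ be measurable such that there exist a locally integrable $g:\mathbb R_{\ge 0}\to\mathbb R_{\ge0}$ and an Osgood modulus of continuity $h$ with $$|b_t(x)|\le g_t,\qquad |b_t(x)-b_t(\tilde x)|\le g_t\,h(|x-\tilde x|)\qquad\forall (t,x,\tilde x)\in\mathbb R_{\ge0}\times\mathbb R^{2d}.$$ Then for every $x\in\mathbb R^d$ there exists a unique global solution to the RDE $\mathrm d y_t=b_t(y_t)\,\mathrm dt+\xi(y_t)\,\mathrm d\mathbf Z_t$, $y_0=x$. Denoting by $\Phi_t(x)$ its value at time $t$, the maps $\Phi_t:\mathbb R^d\to\mathbb R^d$ are homeomorphisms, and for every $T>0$ there is a constant $C$ depending only on $\mathfrak p$, $T$, $\|\xi\|_{C^3_b}$, $\|\mathbf Z\|_{\mathfrak p,T}$ and $\int_0^Tg_s\,\mathrm ds$, such that $$\sup_{t\in[0,T]}|\Phi_t(x)-\Phi_t(\tilde x)|\le M^h\Big(C|x-\tilde x|,\;C\int_0^T g_s\,\mathrm ds\Big)\qquad\forall x,\tilde x\in\mathbb R^d .$$ The same estimate holds with $\Phi_t$ replaced by its inverse $\Phi_t^{-1}$.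
   Context: For $T>0$ let $\Delta_T=\{(s,t):0\le s\le t\le T\}$. For a normed space $E$, $q>0$ and $g:\Delta_T\to E$, the $q$-variation on $[s,t]$ is $V_q(g;[s,t])=\sup(\sum_i\|g_{t_it_{i+1}}\|_E^q)^{1/q}$, the supremum over finite partitions $s=t_0<\dots<t_N=t$; a path $x$ has finite $q$-variation if $\delta x_{st}:=x_t-x_s$ does. A $\mathfrak p$-rough path on $[0,T]$ ($\mathfrak p\in[2,3)$) is a pair $\mathbf Z=(Z,\mathbb Z)$ with $Z:[0,T]\to\mathbb R^m$ continuous of finite $\mathfrak p$-variation and $\mathbb Z:\Delta_T\to\mathbb R^{m\times m}$ continuous of finite $\mathfrak p/2$-variation, satisfying Chen's relation $\mathbb Z_{st}-\mathbb Z_{su}-\mathbb Z_{ut}=\delta Z_{su}\otimes\delta Z_{ut}$ for $s\le u\le t$; $\|\mathbf Z\|_{\mathfrak p,T}:=|Z_0|+V_{\mathfrak p}(\delta Z;[0,T])+V_{\mathfrak p/2}(\mathbb Z;[0,T])$. A rough path on $[0,\infty)$ is one on every $[0,T]$. For $\xi\in C^2_b$ define $\Xi(x)A=\sum_{j,k=1}^m D\xi_k(x)\xi_j(x)A_{jk}$ for $A\in\mathbb R^{m\times m}$. A continuous $y:[0,T]\to\mathbb R^d$ with $y_0=x$ and $\int_0^T|b_s(y_s)|ds<\infty$ solves the RDE on $[0,T]$ if $y^\natural_{st}:=\delta y_{st}-\int_s^tb_r(y_r)\,dr-\sum_k\xi_k(y_s)\delta Z^k_{st}-\Xi(y_s)\mathbb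 Z_{st}$ has finite $\mathfrak p/3$-variation on $\Delta_T$; a global solution is a solution on $[0,T]$ for every $T$. An Osgood modulus of continuity is $h:\mathbb R_{\ge0}\to\mathbb R_{\ge0}$ continuous, strictly increasing, subadditive, with $h(0)=0$ and $\int_{0+}\frac{dr}{h(r)}=+\infty$. Setting $G(r)=\int_{r_0}^r\frac{d\tilde r}{h(\tilde r)}$ (any $r_0>0$), extended by $G(0)=-\infty$, $G(+\infty)=+\infty$, one defines $M^h(\alpha,\beta)=G^{-1}(G(\alpha)+\beta)$ for $\alpha\in[0,\infty]$, $\beta\ge0$; it is independent of $r_0$, continuous, increasing, and $M^h(0,\beta)=0$. *)

(* Defs.v *)
From HB Require Import structures.
From mathcomp Require Import all_boot all_order all_algebra.
From mathcomp Require Import all_classical all_reals all_analysis.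
Set Implicit Arguments. Unset Strict Implicit. Unset Printing Implicit Defensive.
Import Order.TTheory GRing.Theory Num.Theory.
Import numFieldNormedType.Exports.
Local Open Scope classical_set_scope.
Local Open Scope ring_scope.

Section Defs.
Variable R : realType.
Local Notation mu := (@lebesgue_measure R).

Definition enorm (p q : nat) (A : 'M[R]_(p, q)) : R :=
  Num.sqrt (\sum_(i < p) \sum_(j < q) A i j ^+ 2).

(* ts is a partition s = t_0 < t_1 < ... < t_N = t, given as [:: t_1; ...; t_N] *)
Definition is_partition (s t : R) (ts : seq R) : Prop :=
  path (fun a b => a < b) s ts /\ last s ts = t.

Definition qvar_sum (E : Type) (nrm : E -> R) (q : R) (g : R -> R -> E)
  (s : R) (ts : seq R) : R :=
  \sum_(ab <- zip (s :: ts) ts) (nrm (g ab.1 ab.2)) `^ q.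

Definition qvar (E : Type) (nrm : E -> R) (q : R) (g : R -> R -> E) (s t : R) : R :=
  sup [set (qvar_sum nrm q g s ts) `^ q^-1 | ts in is_partition s t].

Definition finite_qvar (E : Type) (nrm : E -> R) (q : R) (g : R -> R -> E)
  (s t : R) : Prop :=
  exists M : R, forall ts, is_partition s t ts -> qvar_sum nrm q g s ts <= M.

Definition delta (E : zmodType) (x : R -> E) : R -> R -> E := fun s t => x t - x s.

Definition simplex (T : R) : set (R * R) := [set st | 0 <= st.1 <= st.2 /\ st.2 <= T].

Definition rough_path (m : nat) (p T : R) (Z : R -> 'rV[R]_m)
  (ZZ : R -> R -> 'M[R]_(m, m)) : Prop :=
  [/\ {within `[0, T]%classic, continuous Z},
      finite_qvar (@enorm 1 m) p (delta Z) 0 T,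
      {within simplex T, continuous (fun st => ZZ st.1 st.2)},
      finite_qvar (@enorm m m) (p / 2) ZZ 0 T &
      forall s u t, 0 <= s -> s <= u -> u <= t -> t <= T ->
        ZZ s t - ZZ s u - ZZ u t = (delta Z s u)^T *m delta Z u t].

Definition rough_path_global (m : nat) (p : R) Z ZZ : Prop :=
  forall T, 0 < T -> @rough_path m p T Z ZZ.

Definition rp_norm (m : nat) (p T : R) (Z : R -> 'rV[R]_m) (ZZ : R -> R -> 'M[R]_(m, m)) : R :=
  enorm (Z 0) + qvar (@enorm 1 m) p (delta Z) 0 T + qvar (@enorm m m) (p / 2) ZZ 0 T.

Definition pd (d : nat) (i : 'I_d) (f : 'rV[R]_d -> 'rV[R]_d) : 'rV[R]_d -> 'rV[R]_d :=
  fun x => 'D_(delta_mx 0 i) f x.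

Definition bounded_cont (d : nat) (f : 'rV[R]_d -> 'rV[R]_d) : Prop :=
  continuous f /\ exists M : R, forall x, enorm (f x) <= M.

Definition has_partials (d : nat) (f : 'rV[R]_d -> 'rV[R]_d) : Prop :=
  forall (i : 'I_d) x, derivable f x (delta_mx 0 i).

Definition C3b (d : nat) (f : 'rV[R]_d -> 'rV[R]_d) : Prop :=
  [/\ bounded_cont f, has_partials f,
      forall i, bounded_cont (pd i f) /\ has_partials (pd i f),
      forall i j, bounded_cont (pd j (pd i f)) /\ has_partials (pd j (pd i f)) &
      forall i j k, bounded_cont (pd k (pd j (pd i f)))].

Definition supnorm (d : nat) (f : 'rV[R]_d -> 'rV[R]_d) : R :=
  sup (range (fun x => enorm (f x))).

Definition C3b_norm (d : nat) (f : 'rV[R]_d -> 'rV[R]_d) : R :=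
  supnorm f + \sum_i supnorm (pd i f) + \sum_i \sum_j supnorm (pd j (pd i f))
  + \sum_i \sum_j \sum_k supnorm (pd k (pd j (pd i f))).

(* xi = (xi_1,...,xi_m), xi_k : R^d -> R^d the k-th column *)
Definition C3b_family (d m : nat) (xi : 'I_m -> 'rV[R]_d -> 'rV[R]_d) : Prop :=
  forall k, C3b (xi k).

Definition C3b_family_norm (d m : nat) (xi : 'I_m -> 'rV[R]_d -> 'rV[R]_d) : R :=
  \sum_k C3b_norm (xi k).

Definition Xi (d m : nat) (xi : 'I_m -> 'rV[R]_d -> 'rV[R]_d) (x : 'rV[R]_d)
  (A : 'M[R]_(m, m)) : 'rV[R]_d :=
  \sum_(j < m) \sum_(k < m) A j k *: 'D_(xi j x) (xi k) x.

Definition vint (d : nat) (f : R -> 'rV[R]_d) (s t : R) : 'rV[R]_d :=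
  \row_i Rintegral mu `[s, t]%classic (fun r => f r 0 i).

Definition rde_remainder (d m : nat) (b : R -> 'rV[R]_d -> 'rV[R]_d)
  (xi : 'I_m -> 'rV[R]_d -> 'rV[R]_d) (Z : R -> 'rV[R]_m)
  (ZZ : R -> R -> 'M[R]_(m, m)) (y : R -> 'rV[R]_d) : R -> R -> 'rV[R]_d :=
  fun s t => delta y s t - vint (fun r => b r (y r)) s t
             - \sum_(k < m) (delta Z s t) 0 k *: xi k (y s)
             - Xi xi (y s) (ZZ s t).

Definition rde_solution (d m : nat) (p T : R) b xi Z ZZ (x : 'rV[R]_d)
  (y : R -> 'rV[R]_d) : Prop :=
  [/\ {within `[0, T]%classic, continuous y}, y 0 = x,
      (\int[mu]_(s in `[0%R, T]%classic) (enorm (b s (y s)))%:E < +oo)%E &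
      finite_qvar (@enorm 1 d) (p / 3) (@rde_remainder d m b xi Z ZZ y) 0 T].

Definition rde_global_solution (d m : nat) (p : R) b xi Z ZZ x y : Prop :=
  forall T, 0 < T -> @rde_solution d m p T b xi Z ZZ x y.

(* Osgood modulus of continuity (a function on R>=0; values on R<0 irrelevant) *)
Definition osgood (h : R -> R) : Prop :=
  [/\ {within `[0, +oo[%classic, continuous h},
      forall x y, 0 <= x -> x < y -> h x < h y,
      forall x y, 0 <= x -> 0 <= y -> h (x + y) <= h x + h y,
      h 0 = 0 &
      (\int[mu]_(r in `]0%R, 1%R]%classic) ((h r)^-1)%:E = +oo)%E].

Definition Gh (h : R -> R) (r : R) : R :=
  if 1 <= r then Rintegral mu `[1, r]%classic (fun u => (h u)^-1)
  else - Rintegral mu `[r, 1]%classic (fun u => (h u)^-1).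

(* M^h(a,b) = G^{-1}(G(a) + b), with M^h(0,b) = 0  (for finite a >= 0, b >= 0) *)
Definition Mh (h : R -> R) (a b : R) : R :=
  if a <= 0 then 0 else get [set r | 0 < r /\ Gh h r = Gh h a + b].

Definition borel_meas_nonneg_time (d : nat) (b : R -> 'rV[R]_d -> 'rV[R]_d) : Prop :=
  forall O : set 'rV[R]_d, open O ->
    <<s (@open (R * 'rV[R]_d)%type) >>
      ([set tx | 0 <= tx.1] `&` [set tx | O (b tx.1 tx.2)]).

Definition locally_integrable_nonneg (g : R -> R) : Prop :=
  (forall t, 0 <= t -> 0 <= g t) /\
  forall T, 0 < T -> mu.-integrable `[0, T]%classic (fun t => (g t)%:E).

End Defs.

(* Main.v *)
(* Let [phi] be the control obtained by adding the [p]-variation of [Z], the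
   [p/2]-variation of the area and the integral of [g].  A sequence obeying the
   second-order Euler recursion along a grid has, by discrete sewing, remainder
   at most [K * (phi t_j - phi t_i)^(3/p)] on windows where [phi] varies little;
   applied to the difference of two such sequences, the same argument bounds
   the distance at either end of a window by twice the distance at the other
   end plus the accumulated difference of the drifts.  Chaining over windows,
   whose number depends on [phi] only, leaves a Gronwall inequality with
   modulus [h], hence, by a discrete Bihari argument, the bound [M^h].  Sampled
   on a fine grid, a solution is an Euler recursion up to one-step errors with
   vanishing sum, since its remainder has finite [p/3]-variation with [p < 3].
   The estimate is symmetric in the two ends of the time interval, so it covers
   both the flow and its inverse.  Solutions through a prescribed value at a
   prescribed time [tau] are limits of Euler schemes, implicit before [tau]
   and explicit after it; a limit along an ultrafilter replaces
   Arzela-Ascoli.  Taking [tau > 0] yields surjectivity of the flow. *)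
Require Import Defs.
From HB Require Import structures.
From mathcomp Require Import all_boot all_order all_algebra.
From mathcomp Require Import all_classical all_reals all_analysis.
From mathcomp Require Import measurable_realfun.
From mathcomp Require Import ring lra zify.
Import Order.TTheory GRing.Theory Num.Theory.
Import numFieldNormedType.Exports.
Local Open Scope classical_set_scope.
Local Open Scope ring_scope.
Set Implicit Arguments.
Unset Strict Implicit.

(** The drift is merely integrable in time and has modulus [h] in space, so it cannot share a
    contraction argument with the rough term. It is kept apart as an abstract additive function [B]:
    its size is bounded by the control [phi], which closes the a priori bounds, while the
    discrepancy of two drifts is only recorded as [D] and estimated through [h] at the end. Being
    additive, [B] drops out of the sewing defect, and one-step errors can be moved into it; sampled
    solutions thus become exact recursions, and one discrete estimate serves uniqueness, the flow
    and its inverse. Comparing two trajectories requires second differences of the fields and of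
    their Taylor remainders; this is where the third derivatives of [xi] are spent. Area and fields
    meet only in Chen's relation and the identity [rf_GX], both valid for non-geometric paths.
    Constants are quantified before paths, fields and drifts, which is why the final one depends on
    norms only. *)

Section MatrixNorms.
Variables (R : realType).

Lemma norm_coord_le p q (A : 'M[R]_(p, q)) i j : `|A i j| <= `|A|.
Proof.
rewrite [leRHS]mx_normrE.
exact: (@le_bigmax _ _ _ 0 (fun ij : 'I_p * 'I_q => `|A ij.1 ij.2|) (i, j)).
Qed.

Lemma norm_mx_le p q (A : 'M[R]_(p, q)) e : 0 <= e ->
  (forall i j, `|A i j| <= e) -> `|A| <= e.
Proof.
move=> e0 Ae; rewrite [leLHS]mx_normrE.
by apply: bigmax_le => //= -[i j] _; exact: Ae.
Qed.

Lemma enorm_ge0 p q (A : 'M[R]_(p, q)) : 0 <= enorm A.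
Proof. exact: sqrtr_ge0. Qed.

(** Estimates are made in the maximum norm; the Euclidean [enorm] occurs only where data are read in
    or results read out. The two comparisons cost dimension factors, which end up in the
    constants. *)
Lemma norm_le_enorm p q (A : 'M[R]_(p, q)) : `|A| <= enorm A.
Proof.
apply: norm_mx_le => [|i j]; first exact: enorm_ge0.
have s0 i' : 0 <= \sum_(j' < q) A i' j' ^+ 2 by apply: sumr_ge0 => ? _; exact: sqr_ge0.
rewrite -sqrtr_sqr ler_wsqrtr//.
rewrite (bigD1 i)//= (bigD1 j)//= -addrA lerDl addr_ge0 ?sumr_ge0// => ? _.
exact: sqr_ge0.
Qed.

Lemma enorm_le_norm p q (A : 'M[R]_(p, q)) : enorm A <= (p * q)%:R * `|A|.
Proof.
have n0 : 0 <= (p * q)%:R * `|A| by rewrite mulr_ge0.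
rewrite -(ger0_norm n0) -sqrtr_sqr ler_wsqrtr// exprMn.
apply: (@le_trans _ _ (\sum_(i < p) \sum_(j < q) `|A| ^+ 2)).
  apply: ler_sum => i _; apply: ler_sum => j _.
  by rewrite -real_normK ?num_real// lerXn2r ?nnegrE// norm_coord_le.
rewrite !sumr_const !card_ord -mulrnA -[leLHS]mulr_natl [(q * p)%N]mulnC.
apply: ler_wpM2r; first exact: sqr_ge0.
by rewrite -natrX ler_nat; case: (p * q)%N => // n; rewrite expnS leq_pmulr// expn_gt0.
Qed.

Lemma enorm_eq0 p q : enorm (0 : 'M[R]_(p, q)) = 0.
Proof.
apply/eqP; rewrite eq_le enorm_ge0 andbT.
by apply: le_trans (enorm_le_norm _) _; rewrite normr0 mulr0.
Qed.

End MatrixNorms.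

(** * Uniform continuity on compact sets *)

Section UniformContinuity.
Variable R : realType.

(** [P del x] holds on a neighbourhood of each point jointly with all small [del]; compactness in
    its near-covering form then gives one [del] for all of [K]. *)
Lemma compact_uniform_continuous (T V : normedModType R) (K : set T) (f : T -> V) :
  compact K -> {within K, continuous f} ->
  forall e, 0 < e -> exists2 del, 0 < del &
  forall x y, K x -> K y -> `|x - y| < del -> `|f x - f y| < e.
Proof.
move=> /compact_near_coveringP cK /subspace_continuousP cf e e0.
pose P (del : R) x := K x -> forall y, K y -> `|x - y| < del -> `|f x - f y| < e.
suff : \forall del \near 0^'+, K `<=` P del.
  case=> /= r r0 hr; exists (r / 2); first by rewrite divr_gt0.
  move=> x y Kx Ky xy; apply: (hr (r / 2) _ _ x Kx Kx y Ky xy).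
    by rewrite /= sub0r normrN gtr0_norm ?divr_gt0// ltr_pdivrMr// ltr_pMr// ltr1n.
  by rewrite divr_gt0.
apply: cK => x Kx.
have e2 : 0 < e / 2 by rewrite divr_gt0.
have /cvgrPdist_lt /(_ _ e2) := cf x Kx.
rewrite near_withinE => /nbhs_ballP[r /= r0 hr].
have r2 : r / 2 < r by rewrite ltr_pdivrMr// ltr_pMr// ltr1n.
have r22 : r / 2 + r / 2 = r by rewrite -splitr.
exists (ball x (r / 2), [set del | del < r / 2]) => /=.
  split; first by apply: nbhsx_ballx; rewrite divr_gt0.
  by apply: nbhs_right_lt; rewrite divr_gt0.
move=> [x' del] /= [xx' delr] Kx' y Ky x'y.
move: xx'; rewrite -ball_normE /= => xx'.
have h1 : `|f x - f x'| < e / 2.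
  by apply: hr => //; rewrite -ball_normE/=; exact: lt_trans xx' _.
have h2 : `|f x - f y| < e / 2.
  apply: hr => //; rewrite -ball_normE/=.
  apply: le_lt_trans (ler_distD x' x y) _; rewrite -r22.
  by apply: ltrD => //; exact: lt_trans delr.
apply: le_lt_trans (ler_distD (f x) (f x') (f y)) _.
by rewrite (distrC (f x')) [ltRHS]splitr ltrD.
Qed.

Lemma itv_uniform_continuous (V : normedModType R) (f : R -> V) (a b : R) :
  {within `[a, b]%classic, continuous f} ->
  forall e, 0 < e -> exists2 del, 0 < del &
  forall x y, a <= x <= b -> a <= y <= b -> `|x - y| < del -> `|f x - f y| < e.
Proof.
move=> cf e e0; have [del del0 h] := compact_uniform_continuous (@segment_compact _ a b) cf e0.
by exists del => // x y xab yab; apply: h; rewrite /= in_itv.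
Qed.

Lemma within_continuousP (V : normedModType R) (f : R -> V) (a b : R) :
  (forall x e, a <= x <= b -> 0 < e -> exists2 del, 0 < del &
     forall y, a <= y <= b -> `|x - y| < del -> `|f x - f y| <= e) ->
  {within `[a, b]%classic, continuous f}.
Proof.
move=> h; apply/subspace_continuousP => x /=; rewrite in_itv/= => xab.
apply/cvgrPdist_le => e e0; have [del del0 hd] := h x e xab e0.
rewrite near_withinE; apply/nbhs_ballP; exists del => //= y.
by rewrite -ball_normE /= in_itv/= => xy yab; apply: hd.
Qed.

End UniformContinuity.

Section Integrals.
Variable R : realType.
Notation mu := (@lebesgue_measure R).

Lemma Rintegral_split (f : R -> R) (a c b : R) : a <= c -> c <= b ->
  mu.-integrable `[a, b]%classic (EFin \o f) ->
  Rintegral mu `[a, b]%classic f =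
  Rintegral mu `[a, c]%classic f + Rintegral mu `[c, b]%classic f.
Proof.
move=> ac cb intf.
have := @Rintegral_itvB R f (BLeft a) (BRight b) c intf.
rewrite !bnd_simp => /(_ ac cb) /eqP.
rewrite subr_eq addrC => /eqP ->; congr (_ + _).
rewrite Rintegral_itv_obnd_cbnd//.
apply: integrableS intf => //; apply: subset_itvr; rewrite bnd_simp//.
Qed.

End Integrals.

(** * Calculus of C^3_b fields *)

Section Calculus.
Variable R : realType.

(** Turns the quadratic Taylor errors obtained below into genuine derivatives, along lines and in
    arbitrary directions, since only partial derivatives are given at the outset. *)
Lemma is_derive_of_bound (W : normedModType R) (V : normedModType R) (f : V -> W) x v (c : W) (K : R) :
  (forall h : R, `|f (x + h *: v) - f x - h *: c| <= K * h ^+ 2) -> is_derive x v f c.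
Proof.
move=> fK.
suff fc : h^-1 *: ((f \o shift x) (h *: v) - f x) @[h --> 0^'] --> c.
  by apply: DeriveDef; [apply/cvg_ex; exists c|exact: cvg_lim fc].
apply/cvgrPdist_le => e e0.
have K1 : 0 < `|K| + 1 by rewrite ltr_wpDl.
exists (e / (`|K| + 1)) => /=; first by rewrite divr_gt0.
move=> h /=; rewrite sub0r normrN => he h0.
have -> : c - h^-1 *: (f (h *: v + x) - f x) = - (h^-1 *: (f (x + h *: v) - f x - h *: c)).
  by rewrite [x + _]addrC [in RHS]scalerBr scalerA mulVf// scale1r opprB.
rewrite normrN normrZ normfV.
have hp : 0 < `|h| by rewrite normr_gt0.
rewrite mulrC ler_pdivrMr//; apply: le_trans (fK h) _.
rewrite -(real_normK (num_real h)) expr2 mulrA ler_wpM2r//.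
apply: (@le_trans _ _ ((`|K| + 1) * `|h|)).
  by rewrite ler_wpM2r// (le_trans (ler_norm _))// lerDl.
by rewrite mulrC -ler_pdivlMr// ltW.
Qed.

Lemma MVT0 (f df : R -> R) (b : R) : (forall t : R, is_derive t 1 f (df t)) ->
  exists2 s, `|s| <= `|b| & f b - f 0 = df s * b.
Proof.
move=> fd.
have cf (u v : R) : {within `[u, v]%classic, continuous f}.
  apply: derivable_within_continuous => t _; exact: ex_derive.
have [b0|b0|->] := ltgtP b 0.
- have [s] := MVT b0 (fun t _ => fd t) (cf b 0).
  rewrite in_itv/= => /andP[bs s0] fs; exists s.
    by rewrite !ltr0_norm// lerN2 ltW.
  by rewrite -opprB fs sub0r mulrN opprK.
- have [s] := MVT b0 (fun t _ => fd t) (cf 0 b).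
  rewrite in_itv/= => /andP[s0 sb] fs; exists s.
    by rewrite !gtr0_norm// ltW.
  by rewrite fs subr0.
by exists 0; rewrite ?subrr ?mulr0.
Qed.

Variable d : nat.
Notation V := 'rV[R]_d.
Notation e_ i := (delta_mx 0 i : 'rV[R]_d).

(** Phrased as one-variable derivatives along coordinate lines, because [C3b] provides partial
    derivatives and no total differential. *)
Definition coord_partials (g : V -> R) (dg : 'I_d -> V -> R) :=
  forall i (x : V) (t : R), is_derive t 1 (fun t : R => g (x + t *: e_ i)) (dg i (x + t *: e_ i)).

(** Coordinates are changed one at a time through the hybrid points [w k], whose first [k] entries
    come from [y], with the mean value theorem on each leg. The intermediate points stay within the
    distance of [x] and [y] from [x], without a constant, because the norm is the maximum norm. *)
Lemma partials_telescope g dg : coord_partials g dg -> forall x y,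
  exists2 z : 'I_d -> V, (forall i, `|z i - x| <= `|y - x|) &
    g y - g x = \sum_i (y - x) 0 i * dg i (z i).
Proof.
move=> gdg x y.
pose w k : V := \row_j (if (j < k)%N then y 0 j else x 0 j).
have wS (i : 'I_d) : w i.+1 = w i + (y - x) 0 i *: e_ i.
  apply/rowP => j; rewrite !mxE eqxx/=; have [->|ji] := eqVneq j i.
    by rewrite ltnSn ltnn mulr1 addrC subrK.
  by rewrite mulr0 addr0 ltnS leq_eqVlt val_eqE (negbTE ji).
have mv (i : 'I_d) : exists z : V, `|z - x| <= `|y - x| /\
    g (w i.+1) - g (w i) = (y - x) 0 i * dg i z.
  have [s sb sE] := MVT0 ((y - x) 0 i) (gdg i (w i)).
  exists (w i + s *: e_ i); split; last first.
    by rewrite wS mulrC -sE scale0r addr0.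
  apply: norm_mx_le => // a j; rewrite (ord1 a).
  have [->|ji] := eqVneq j i.
    rewrite !mxE !eqxx ltnn mulr1 addrC addKr.
    by apply: le_trans sb _; exact: norm_coord_le.
  rewrite !mxE (negbTE ji) andbF mulr0 addr0; case: ifP => _; last by rewrite subrr normr0.
  by have := norm_coord_le (y - x) 0 j; rewrite !mxE.
have [z zP] := choice mv.
exists z; first by move=> i; have [] := zP i.
have w0 : w 0%N = x by apply/rowP => j; rewrite !mxE.
have wd : w d = y by apply/rowP => j; rewrite !mxE ltn_ord.
rewrite -{1}wd -{1}w0 -(@telescope_sumr _ 0 d (fun k => g (w k)))// big_mkord.
by apply: eq_bigr => i _; have [_] := zP i.
Qed.

Lemma sum_coord_le (v : V) (c : 'I_d -> R) (K : R) : (forall i, `|c i| <= K) ->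
  `|\sum_i v 0 i * c i| <= d%:R * `|v| * K.
Proof.
move=> cK; apply: le_trans (ler_norm_sum _ _ _) _.
rewrite -mulrA mulr_natl -[X in _ *+ X]card_ord -sumr_const.
apply: ler_sum => i _; rewrite normrM ler_pM//; exact: norm_coord_le.
Qed.

Lemma partials_lipschitz g dg (K : R) : coord_partials g dg ->
  (forall i x, `|dg i x| <= K) -> forall x y, `|g y - g x| <= d%:R * `|y - x| * K.
Proof.
move=> gdg dgK x y; have [z _ ->] := partials_telescope gdg x y.
exact: sum_coord_le.
Qed.

Lemma partials_taylor g dg (K : R) : coord_partials g dg ->
  (forall i x y, `|dg i y - dg i x| <= K * `|y - x|) -> 0 <= K ->
  forall x y, `|g y - g x - \sum_i (y - x) 0 i * dg i x| <= d%:R * K * `|y - x| ^+ 2.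
Proof.
move=> gdg dgK K0 x y; have [z zx ->] := partials_telescope gdg x y.
rewrite -sumrB (eq_bigr (fun i => (y - x) 0 i * (dg i (z i) - dg i x))); last first.
  by move=> i _; rewrite mulrBr.
apply: le_trans (sum_coord_le (K := K * `|y - x|) _ _) _.
  by move=> i; apply: le_trans (dgK _ _ _) _; rewrite ler_wpM2l.
by rewrite le_eqVlt; apply/orP; left; apply/eqP; ring.
Qed.

(** Chain rule along a line: Taylor's estimate at the running point has an error quadratic in the
    step, which [is_derive_of_bound] accepts. *)
Lemma partials_line g dg (K : R) : coord_partials g dg ->
  (forall i x y, `|dg i y - dg i x| <= K * `|y - x|) -> 0 <= K ->
  forall (x a : V) (t : R), is_derive t 1 (fun t : R => g (x + t *: a)) (\sum_i a 0 i * dg i (x + t *: a)).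
Proof.
move=> gdg dgK K0 x a t.
apply: (@is_derive_of_bound _ _ _ _ _ _ (d%:R * K * `|a| ^+ 2)) => h.
have := partials_taylor gdg dgK K0 (x + t *: a) (x + (t + h *: 1) *: a).
have -> : x + (t + h *: 1) *: a - (x + t *: a) = h *: a.
  by apply/rowP => j; rewrite !mxE /GRing.scale/=; ring.
rewrite normrZ exprMn real_normK ?num_real// -mulrA [h ^+ 2 * _]mulrC !mulrA.
congr (`| _ - _ | <= _).
by rewrite scaler_sumr; apply: eq_bigr => i _; rewrite !mxE -mulrA.
Qed.

(* Four-point (second-difference) control; it is what survives of [C^{1,1}]
   when comparing increments along two different trajectories. *)
Definition nice (K : R) (g : V -> R) :=
  [/\ forall x, `|g x| <= K,
      forall x y, `|g y - g x| <= K * `|y - x| &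
      forall x y x' y', `|g y - g x - (g y' - g x')| <=
        K * (`|(y - x) - (y' - x')| +
             (`|x - x'| + `|y - y'|) * (`|y - x| + `|y' - x'|))].

(** Leibniz rule for second differences. Two of the four terms are products of a first difference
    along a trajectory and one across the two trajectories; the second summand in [nice] is there to
    absorb them. *)
Lemma niceM (K : R) f g : 0 <= K -> nice K f -> nice K g -> nice (4 * K ^+ 2) (fun x => f x * g x).
Proof.
move=> K0 [fb fl f4] [gb gl g4]; split => [x|x y|x y x' y'].
- rewrite normrM; apply: le_trans (ler_pM _ _ (fb x) (gb x)) _ => //.
  by rewrite -expr2 ler_peMl ?sqr_ge0//; lra.
- have -> : f y * g y - f x * g x = (f y - f x) * g y + f x * (g y - g x) by ring.
  apply: le_trans (ler_normD _ _) _; rewrite !normrM.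
  have h1 := ler_pM (normr_ge0 _) (normr_ge0 _) (fl x y) (gb y).
  have h2 := ler_pM (normr_ge0 _) (normr_ge0 _) (fb x) (gl x y).
  apply: le_trans (lerD h1 h2) _.
  have : 0 <= K ^+ 2 * `|y - x| by rewrite mulr_ge0// sqr_ge0.
  lra.
have -> : f y * g y - f x * g x - (f y' * g y' - f x' * g x') =
  (f y - f x - (f y' - f x')) * g y + (f y' - f x') * (g y - g y') +
  (f x - f x') * (g y - g x) + f x' * (g y - g x - (g y' - g x')) by ring.
have h1 := ler_pM (normr_ge0 _) (normr_ge0 _) (f4 x y x' y') (gb y).
have h2 := ler_pM (normr_ge0 _) (normr_ge0 _) (fl x' y') (gl y' y).
have h3 := ler_pM (normr_ge0 _) (normr_ge0 _) (fl x' x) (gl x y).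
have h4 := ler_pM (normr_ge0 _) (normr_ge0 _) (fb x') (g4 x y x' y').
apply: le_trans (ler_normD _ _) _.
apply: le_trans (lerD (ler_normD _ _) (lexx _)) _.
apply: le_trans (lerD (lerD (ler_normD _ _) (lexx _)) (lexx _)) _.
rewrite !normrM; apply: le_trans (lerD (lerD (lerD h1 h2) h3) h4) _.
set E := `|(y - x) - (y' - x')|; set a := `|y - x|; set a' := `|y' - x'|.
set u := `|x - x'|; set v := `|y - y'|.
have [E0 a0 a'0 u0 v0] : [/\ 0 <= E, 0 <= a, 0 <= a', 0 <= u & 0 <= v].
  by split; exact: normr_ge0.
have K2 : 0 <= K ^+ 2 by exact: sqr_ge0.
have p1 : 0 <= K ^+ 2 * (u * a) by do ?[apply: mulr_ge0].
have p2 : 0 <= K ^+ 2 * (u * a') by do ?[apply: mulr_ge0].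
have p3 : 0 <= K ^+ 2 * (v * a) by do ?[apply: mulr_ge0].
have p4 : 0 <= K ^+ 2 * (v * a') by do ?[apply: mulr_ge0].
have p5 : 0 <= K ^+ 2 * E by do ?[apply: mulr_ge0].
lra.
Qed.

Lemma nice_sum (K : R) n (f : 'I_n -> V -> R) : 0 <= K -> (forall i, nice K (f i)) ->
  nice (n%:R * K) (fun x => \sum_i f i x).
Proof.
move=> K0 fK.
have bnd (c : 'I_n -> R) B : (forall i, `|c i| <= K * B) -> `|\sum_i c i| <= n%:R * K * B.
  move=> cB; apply: le_trans (ler_norm_sum _ _ _) _.
  rewrite -mulrA mulr_natl -[X in _ *+ X]card_ord -sumr_const.
  exact: ler_sum.
split => [x|x y|x y x' y'].
- rewrite -[leRHS]mulr1; apply: bnd => i; rewrite mulr1.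
  by have [] := fK i.
- by rewrite -sumrB; apply: bnd => i; have [] := fK i.
- by rewrite -!sumrB; apply: bnd => i; have [] := fK i.
Qed.

(** Both segments are run through simultaneously: the mean value theorem is applied to the
    difference [f] of [g] along them. Its derivative is [a - a'] against a bounded gradient, plus
    [a'] against a difference of gradients at two points no farther apart than the two pairs of end
    points together. *)
Lemma partials_nice g dg (K : R) : coord_partials g dg ->
  (forall x, `|g x| <= K) -> (forall i x, `|dg i x| <= K) ->
  (forall i x y, `|dg i y - dg i x| <= K * `|y - x|) ->
  nice ((1 + d%:R) * K) g.
Proof.
move=> gdg gK dgK dgl.
have K0 : 0 <= K by apply: le_trans (normr_ge0 _) (gK 0).
have dK0 : 0 <= d%:R * K by rewrite mulr_ge0.
split=> [x|x y|x y x' y'].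
- by apply: le_trans (gK x) _; rewrite mulrDl mul1r lerDl.
- apply: le_trans (partials_lipschitz gdg dgK x y) _.
  have : 0 <= K * `|y - x| by rewrite mulr_ge0.
  lra.
pose a : V := y - x; pose a' : V := y' - x'; rewrite -/a -/a'.
have line := partials_line gdg dgl K0.
pose f (t : R) := g (x + t *: a) - g (x' + t *: a').
pose df (t : R) := \sum_i a 0 i * dg i (x + t *: a) - \sum_i a' 0 i * dg i (x' + t *: a').
have fdf (t : R) : t \in `]0, 1[%R -> is_derive t 1 f (df t).
  by move=> _; apply: is_deriveB; apply: line.
have cf : {within `[0, 1]%classic, continuous f}.
  by apply: derivable_within_continuous => t _; apply: ex_derive; apply: is_deriveB; apply: line.
have [s] := MVT ltr01 fdf cf.
rewrite in_itv/= => /andP[s0 s1].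
have xa : x + a = y by rewrite /a addrC subrK.
have xa' : x' + a' = y' by rewrite /a' addrC subrK.
rewrite /f !scale1r !scale0r !addr0 xa xa' subr0 mulr1 => fE.
have -> : g y - g x - (g y' - g x') = df s by rewrite -fE; ring.
have -> : df s = \sum_i (a - a') 0 i * dg i (x + s *: a) +
    \sum_i a' 0 i * (dg i (x + s *: a) - dg i (x' + s *: a')).
  rewrite /df -sumrB -big_split; apply: eq_bigr => i _ /=.
  by rewrite [(a - a') 0 i]mxE [(- a') 0 i]mxE; ring.
apply: le_trans (ler_normD _ _) _.
have h1 := sum_coord_le (a - a') (fun i => dgK i (x + s *: a)).
have xx : `|x + s *: a - (x' + s *: a')| <= `|x - x'| + `|y - y'|.
  have -> : x + s *: a - (x' + s *: a') = (1 - s) *: (x - x') + s *: (y - y').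
    by apply/rowP => j; rewrite !mxE; ring.
  apply: le_trans (ler_normD _ _) _; rewrite !normrZ lerD// ler_piMl//.
    by rewrite ger0_norm; lra.
  by rewrite ger0_norm; lra.
have h2 : `|\sum_i a' 0 i * (dg i (x + s *: a) - dg i (x' + s *: a'))| <=
    d%:R * `|a'| * (K * (`|x - x'| + `|y - y'|)).
  by apply: sum_coord_le => i; apply: le_trans (dgl _ _ _) _; rewrite ler_wpM2l.
apply: le_trans (lerD h1 h2) _; rewrite -/a -/a'.
have u0 : 0 <= `|x - x'| + `|y - y'| by rewrite addr_ge0.
move: (normr_ge0 (a - a')) (normr_ge0 a) (normr_ge0 a') u0.
set E := `|a - a'|; set al := `|a|; set al' := `|a'|; set u := `|x - x'| + `|y - y'| => E0 al0 al'0 u0.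
have p1 : 0 <= d%:R * K * (u * al) by rewrite !mulr_ge0.
have p2 : 0 <= K * E by rewrite mulr_ge0.
have p3 : 0 <= K * (u * al) by rewrite !mulr_ge0.
have p4 : 0 <= K * (u * al') by rewrite !mulr_ge0.
lra.
Qed.

(** Same two-segment argument with the first-order terms subtracted. The part carrying [a - a']
    needs a Lipschitz gradient, the part carrying [a'] its second differences, hence [nice] for
    [dg]. For [g] a coordinate of a field this rests on third derivatives. *)
Lemma partials_taylor4 g dg (K : R) : coord_partials g dg -> 0 <= K ->
  (forall i, nice K (dg i)) -> forall x y x' y',
  `|g y - g x - \sum_i (y - x) 0 i * dg i x -
    (g y' - g x' - \sum_i (y' - x') 0 i * dg i x')| <=
  3 * (d%:R * K) * (`|(y - x) - (y' - x')| * (`|y - x| + `|y' - x'|) +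
         (`|x - x'| + `|y - y'|) * (`|y - x| + `|y' - x'|) ^+ 2).
Proof.
move=> gdg K0 dgN x y x' y'.
have dgl i z w : `|dg i w - dg i z| <= K * `|w - z| by have [] := dgN i.
have dK0 : 0 <= d%:R * K by rewrite mulr_ge0.
pose a : V := y - x; pose a' : V := y' - x'; rewrite -/a -/a'.
have line := partials_line gdg dgl K0.
pose f (t : R) := g (x + t *: a) - g (x' + t *: a').
pose df (t : R) := \sum_i a 0 i * dg i (x + t *: a) - \sum_i a' 0 i * dg i (x' + t *: a').
have fdf (t : R) : t \in `]0, 1[%R -> is_derive t 1 f (df t).
  by move=> _; apply: is_deriveB; apply: line.
have cf : {within `[0, 1]%classic, continuous f}.
  by apply: derivable_within_continuous => t _; apply: ex_derive; apply: is_deriveB; apply: line.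
have [s] := MVT ltr01 fdf cf.
rewrite in_itv/= => /andP[s0 s1].
have xa : x + a = y by rewrite /a addrC subrK.
have xa' : x' + a' = y' by rewrite /a' addrC subrK.
rewrite /f !scale1r !scale0r !addr0 xa xa' subr0 mulr1 => fE.
pose S := \sum_i (a - a') 0 i * (dg i (x + s *: a) - dg i x).
pose S' := \sum_i a' 0 i * (dg i (x + s *: a) - dg i x - (dg i (x' + s *: a') - dg i x')).
have -> : g y - g x - \sum_i a 0 i * dg i x - (g y' - g x' - \sum_i a' 0 i * dg i x') = S + S'.
  have -> : g y - g x - \sum_i a 0 i * dg i x - (g y' - g x' - \sum_i a' 0 i * dg i x') =
    df s - (\sum_i a 0 i * dg i x - \sum_i a' 0 i * dg i x') by rewrite -fE; ring.
  rewrite /df /S /S' -!sumrB -big_split; apply: eq_bigr => i _ /=.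
  by rewrite [(a - a') 0 i]mxE [(- a') 0 i]mxE; ring.
have xx : `|x + s *: a - (x' + s *: a')| <= `|x - x'| + `|y - y'|.
  have -> : x + s *: a - (x' + s *: a') = (1 - s) *: (x - x') + s *: (y - y').
    by apply/rowP => j; rewrite !mxE; ring.
  apply: le_trans (ler_normD _ _) _; rewrite !normrZ lerD// ler_piMl//.
    by rewrite ger0_norm; lra.
  by rewrite ger0_norm; lra.
have sle (z : V) : `|s *: z| <= `|z| by rewrite normrZ ler_piMl// ger0_norm; lra.
have h1 : `|S| <= d%:R * `|a - a'| * (K * `|a|).
  apply: sum_coord_le => i; apply: le_trans (dgl _ _ _) _.
  by rewrite ler_wpM2l// addrC addKr.
set u := `|x - x'| + `|y - y'|.
have u0 : 0 <= u by rewrite addr_ge0.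
have h2 : `|S'| <= d%:R * `|a'| * (K * (`|a - a'| + 2 * u * (`|a| + `|a'|))).
  apply: sum_coord_le => i; have [_ _ /(_ x (x + s *: a) x' (x' + s *: a'))] := dgN i.
  move=> /le_trans; apply; rewrite ler_wpM2l//.
  have -> : x + s *: a - x = s *: a by rewrite addrC addKr.
  have -> : x' + s *: a' - x' = s *: a' by rewrite addrC addKr.
  rewrite -scalerBr lerD// ler_pM ?addr_ge0// ?lerD//.
  have := normr_ge0 (y - y'); rewrite /u in xx *; lra.
apply: le_trans (ler_normD _ _) _; apply: le_trans (lerD h1 h2) _.
move: (normr_ge0 (a - a')) (normr_ge0 a) (normr_ge0 a').
set E := `|a - a'|; set al := `|a|; set al' := `|a'| => E0 al0 al'0.
have p1 : 0 <= d%:R * K * (E * al) by rewrite !mulr_ge0.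
have p2 : 0 <= d%:R * K * (E * al') by rewrite !mulr_ge0.
have p3 : 0 <= d%:R * K * (u * (al * al')) by rewrite !mulr_ge0.
have p4 : 0 <= d%:R * K * (u * (al' * al')) by rewrite !mulr_ge0.
have p5 : 0 <= d%:R * K * (u * (al * al)) by rewrite !mulr_ge0.
lra.
Qed.

End Calculus.

Ltac rv_ring := apply/rowP => ?; rewrite !mxE; ring.

(* [lia] tries to interpret every hypothesis, so the real-valued ones are dropped first. *)
Ltac nat_lia :=
  repeat match goal with H : ?T |- _ =>
    lazymatch T with
    | is_true (leq _ _) => fail
    | is_true (andb _ _) => fail
    | nat => fail
    | @eq nat _ _ => fail
    | is_true (negb (eq_op ?a _)) => lazymatch type of a with nat => fail | _ => clear H end
    | _ => clear H
    end
  end; lia.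

(** * Discrete sewing and Euler recursions *)

Section Sewing.
Variables (R : realType).

(** Strong induction on the length: split at [k], discard the step from [k] to [k.+1], on which [A]
    vanishes, and pay two defects, whence the factor in [2 * c <= (1 - kappa) * K]. The defect is
    bounded only under the conclusion for the left piece, which the induction supplies; remainder
    estimates may thus be used while they are being proved. *)
Lemma discrete_sewing (d : nat) (A : nat -> nat -> 'rV[R]_d)
    (E : nat -> nat -> R) (kappa c K : R) (a b : nat) :
  0 <= c -> 0 <= kappa -> 0 <= K -> 2 * c <= (1 - kappa) * K ->
  (forall i, A i i = 0) ->
  (forall l, (a <= l < b)%N -> A l l.+1 = 0) ->
  (forall i j, (a <= i <= j)%N -> (j <= b)%N -> 0 <= E i j) ->
  (forall i k j, (a <= i <= k)%N -> (k <= j <= b)%N -> E k j <= E i j) ->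
  (forall i j, (a <= i < j)%N -> (j <= b)%N ->
     exists2 k, (i <= k < j)%N & E i k + E k.+1 j <= kappa * E i j) ->
  (forall i k j, (a <= i <= k)%N -> (k <= j <= b)%N ->
     `|A i k| <= K * E i k -> `|A i j - A i k - A k j| <= c * E i j) ->
  forall i j, (a <= i <= j)%N -> (j <= b)%N -> `|A i j| <= K * E i j.
Proof.
move=> c0 kappa0 K0 cK A0 A1 E0 Emono mid defect i j.
have [n] := ubnP (j - i); elim: n => // n IH in i j *.
rewrite ltnS => jin /andP[ai ij] jb.
have [<-|ltij] := eqVneq i j.
  by rewrite A0 normr0 mulr_ge0// E0//; nat_lia.
have {}ltij : (i < j)%N by rewrite ltn_neqAle ltij.
have [k /andP[ik kj] Ek] := mid i j (introT andP (conj ai ltij)) jb.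
have Ekj : E k j <= E i j by apply: Emono; nat_lia.
have ak := leq_trans ai ik.
have iE0 : 0 <= E i j by apply: E0; nat_lia.
have Aik : `|A i k| <= K * E i k by apply: IH; nat_lia.
have Akj : `|A k.+1 j| <= K * E k.+1 j by apply: IH; nat_lia.
have d1 := defect i k j (introT andP (conj ai ik)) (introT andP (conj (ltnW kj) jb)) Aik.
(* The left piece is a single step, where [A] is zero, so the premise of the defect bound is
   free. *)
have d2 : `|A k j - A k k.+1 - A k.+1 j| <= c * E k j.
  apply: defect; [nat_lia|nat_lia|].
  by rewrite A1 ?normr0 ?mulr_ge0 ?E0//; nat_lia.
rewrite A1 ?subr0 in d2; last by rewrite ak/=; nat_lia.
have -> : A i j = (A i j - A i k - A k j) + (A k j - A k.+1 j) + A i k + A k.+1 j.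
  by rv_ring.
have cc : c * E k j <= c * E i j by exact: ler_wpM2l.
have H1 := ler_normD (A i j - A i k - A k j + (A k j - A k.+1 j) + A i k) (A k.+1 j).
have H2 := ler_normD (A i j - A i k - A k j + (A k j - A k.+1 j)) (A i k).
have H3 := ler_normD (A i j - A i k - A k j) (A k j - A k.+1 j).
have H4 : K * (E i k + E k.+1 j) <= K * (kappa * E i j) by exact: ler_wpM2l.
have H5 : (2 * c) * E i j <= ((1 - kappa) * K) * E i j by exact: ler_wpM2r.
lra.
Qed.

End Sewing.

(** * Abstract rough fields and the scale of a control *)

Section RoughEuler.
Variables (R : realType) (d m : nat).
Notation V := 'rV[R]_d.
Notation W := 'rV[R]_m.
Notation M := 'M[R]_(m, m).

(** What the estimates use of [xi]: [X x z] stands for the field at [x] contracted with [z],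
    [J x v z] for its derivative in direction [v], [G] for [Xi]. [rf_GX] is the compatibility that
    makes Chen's relation cancel; [rf_T] and [rf_T4] are Taylor's formula and its difference along
    two trajectories. One constant [L] keeps later constants free of the particular field. *)
Record rough_field (L : R) (X : V -> W -> V) (J : V -> V -> W -> V)
    (G : V -> M -> V) : Prop := RoughField {
  rf_ge1 : 1 <= L;
  rf_XD : forall x z w, X x (z + w) = X x z + X x w;
  rf_JD : forall x v w z, J x (v + w) z = J x v z + J x w z;
  rf_GD : forall x A B, G x (A + B) = G x A + G x B;
  rf_GX : forall x z w, G x (z^T *m w) = J x (X x z) w;
  rf_Xb : forall x z, `|X x z| <= L * `|z|;
  rf_Xlip : forall x y z, `|X x z - X y z| <= L * `|x - y| * `|z|;
  rf_Jb : forall x v z, `|J x v z| <= L * `|v| * `|z|;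
  rf_Jlip : forall x y v z, `|J x v z - J y v z| <= L * `|x - y| * `|v| * `|z|;
  rf_Gb : forall x A, `|G x A| <= L * `|A|;
  rf_Glip : forall x y A, `|G x A - G y A| <= L * `|x - y| * `|A|;
  rf_G4 : forall x y x' y' A,
    `|G y A - G x A - (G y' A - G x' A)| <=
    L * (`|(y - x) - (y' - x')| +
         (`|x - x'| + `|y - y'|) * (`|y - x| + `|y' - x'|)) * `|A|;
  rf_T : forall x y z, `|X y z - X x z - J x (y - x) z| <= L * `|y - x| ^+ 2 * `|z|;
  rf_T4 : forall x y x' y' z,
    `|X y z - X x z - J x (y - x) z - (X y' z - X x' z - J x' (y' - x') z)| <=
    L * (`|(y - x) - (y' - x')| * (`|y - x| + `|y' - x'|) +
         (`|x - x'| + `|y - y'|) * (`|y - x| + `|y' - x'|) ^+ 2) * `|z| }.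

Variable p : R.

(** The unit of length of the sewing estimates: increments of the driver are of order one in it,
    areas of order two, Euler remainders of order three. *)
Definition hold (phi : nat -> R) (i j : nat) : R := (phi j - phi i) `^ p^-1.

Lemma hold_ge0 phi i j : 0 <= hold phi i j.
Proof. exact: powR_ge0. Qed.

Lemma le_hold phi i j i' j' : 2 <= p -> phi i <= phi i' -> phi i' <= phi j' ->
  phi j' <= phi j -> hold phi i' j' <= hold phi i j.
Proof.
move=> p2 h1 h2 h3; have p0 : 0 < p by lra.
have pV0 : 0 <= p^-1 by rewrite invr_ge0 ltW.
by apply: ge0_ler_powR => //; rewrite ?nnegrE ?subr_ge0; lra.
Qed.

(** Drift increments are bounded by increments of [phi], the power [p] of [hold]; for [p >= 2] and
    small windows they are thus no larger than areas. *)
Lemma hold_le1 phi i j : 2 <= p -> phi i <= phi j -> hold phi i j <= 1 ->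
  phi j - phi i <= hold phi i j ^+ 2.
Proof.
move=> p2; rewrite /hold -subr_ge0; set x := phi j - phi i; move=> x0 a1.
have [->|xn0] := eqVneq x 0; first by rewrite sqr_ge0.
have xp : 0 < x by rewrite lt_neqAle eq_sym xn0.
have p0 : p != 0 by rewrite lt0r_neq0//; lra.
have xE : x = (x `^ p^-1) `^ p by rewrite -powRrM mulVf// powRr1.
rewrite [X in X <= _]xE -powR_mulrn ?powR_ge0//.
by apply: ger_powR => //; rewrite powR_gt0.
Qed.

(** Halving the control multiplies [hold] by at most [lam], the power [1 / p] of one half. Two
    halves of a third-order error sum to at most [2 * lam ^+ 3 < 1] times the whole, which is where
    [p < 3] enters; [lam] alone serves errors that are an additive quantity times [hold]. *)
Lemma half_hold : 2 <= p -> p < 3 -> exists lam kappa : R,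
  [/\ 0 <= lam, kappa < 1, lam <= kappa, 2 * lam ^+ 3 <= kappa &
   forall x y : R, 0 <= x -> x <= y / 2 -> x `^ p^-1 <= lam * y `^ p^-1].
Proof.
move=> p2 p3; have p0 : 0 < p by lra.
have ip0 : 0 < p^-1 by rewrite invr_gt0.
pose lam : R := 2^-1 `^ p^-1.
have lam0 : 0 <= lam by apply: powR_ge0.
have half1 : (2^-1 : R) < 1 by lra.
have lam1 : lam < 1.
  have := @gt0_ltr_powR R _ ip0 2^-1 1; rewrite !nnegrE powR1.
  by apply; rewrite ?invr_ge0.
have lam3 : lam ^+ 3 < 2^-1.
  rewrite -powR_mulrn// -powRrM -[X in _ < X]powRr1; last by lra.
  rewrite /powR gt_eqF//= ltr_expR -subr_gt0 -mulrBl.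
  have l2 : ln (2^-1 : R) < 0 by rewrite ln_lt0//; lra.
  rewrite nmulr_lgt0// subr_lt0 mulrC ltr_pdivlMr// mul1r//.
exists lam, (Num.max lam (2 * lam ^+ 3)); split => //.
- by rewrite gt_max lam1/=; lra.
- by rewrite le_max lexx.
- by rewrite le_max lexx orbT.
move=> x y x0 xy; rewrite /lam -powRM; [|lra|lra].
by rewrite mulrC; apply: ge0_ler_powR; rewrite ?nnegrE; lra.
Qed.

End RoughEuler.

(** * From bounded third derivatives to abstract rough fields *)

Section FieldOfC3b.
Variables (R : realType) (d m : nat).
Notation V := 'rV[R]_d.
Notation W := 'rV[R]_m.
Notation M := 'M[R]_(m, m).
Notation e_ i := (delta_mx 0 i : 'rV[R]_d).
Implicit Type xi : 'I_m -> V -> V.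

Lemma supnorm_ub (f : V -> V) x : bounded_cont f -> enorm (f x) <= supnorm f.
Proof.
move=> [_ [B fB]]; apply: ub_le_sup; last by exists x.
by exists B => _ [y _ <-].
Qed.

Lemma supnorm_ge0 (f : V -> V) : bounded_cont f -> 0 <= supnorm f.
Proof. by move=> bf; apply: le_trans (enorm_ge0 _) (supnorm_ub 0 bf). Qed.

Lemma has_partials_coord (f : V -> V) c : has_partials f ->
  coord_partials (fun x => f x 0 c) (fun i x => pd i f x 0 c).
Proof.
move=> pf i x t; set p := x + t *: e_ i.
have df := pf i p.
have cD : h^-1 *: ((f \o shift p) (h *: e_ i) - f p) @[h --> (0 : R)^'] --> 'D_(e_ i) f p := df.
have cc : (h^-1 *: ((f \o shift p) (h *: e_ i) - f p)) 0 c @[h --> (0 : R)^'] -->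
    pd i f p 0 c.
  exact: (cvg_comp _ _ cD (@coord_continuous R 1 d 0 c _)).
suff fc : h^-1 *: (((fun t : R => f (x + t *: e_ i) 0 c) \o shift t) (h *: 1) -
    f (x + t *: e_ i) 0 c) @[h --> (0 : R)^'] --> pd i f p 0 c.
  by apply: DeriveDef; [apply/cvg_ex; exists (pd i f p 0 c)|exact: cvg_lim fc].
apply: cvg_trans cc; apply: near_eq_cvg; apply: nearW => h /=.
have -> : h *: e_ i + p = x + (h *: (1 : R) + t) *: e_ i.
  have -> : h *: (1 : R) = h by rewrite /GRing.scale/= mulr1.
  by rewrite /p scalerDl addrCA.
by rewrite !mxE.
Qed.

Lemma sum_mx_le (A : M) (c : 'I_m -> 'I_m -> R) (K : R) : (forall i j, `|c i j| <= K) ->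
  `|\sum_i \sum_j A i j * c i j| <= (m * m)%:R * `|A| * K.
Proof.
move=> cK; apply: le_trans (ler_norm_sum _ _ _) _.
rewrite natrM -!mulrA mulr_natl -[X in _ *+ X]card_ord -sumr_const.
apply: ler_sum => i _; apply: le_trans (ler_norm_sum _ _ _) _.
rewrite mulr_natl -[X in _ *+ X]card_ord -sumr_const.
by apply: ler_sum => j _; rewrite normrM ler_pM// norm_coord_le.
Qed.

Definition field_lin xi (x : V) (z : W) : V := \sum_k z 0 k *: xi k x.
(** Written through partial derivatives, so that additivity in [v] is immediate; it is identified
    with the directional derivative once that is known to exist. *)
Definition field_der xi (x v : V) (z : W) : V :=
  \sum_k z 0 k *: \sum_i v 0 i *: pd i (xi k) x.

Definition brackets xi j k c (x : V) : R := \sum_i xi j x 0 i * pd i (xi k) x 0 c.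

(** Each property is checked coordinatewise. In the constant, [m K] comes from the fields, [3 m d K]
    from the two-trajectory Taylor estimate, and [4 m^2 d K^2] from [brackets], a sum of [d]
    products of [nice] functions. *)
Lemma rough_field_of_nice xi (K : R) : 0 <= K ->
  (forall k, has_partials (xi k)) ->
  (forall k x v, 'D_v (xi k) x = \sum_i v 0 i *: pd i (xi k) x) ->
  (forall k c, nice K (fun x => xi k x 0 c)) ->
  (forall k i c, nice K (fun x => pd i (xi k) x 0 c)) ->
  rough_field (1 + m%:R * K + 3 * (m%:R * (d%:R * K)) + (m * m)%:R * (d%:R * (4 * K ^+ 2)))
    (field_lin xi) (field_der xi) (Xi xi).
Proof.
move=> K0 hp dirE xiN dxiN.
have braN j k c : nice (d%:R * (4 * K ^+ 2)) (brackets xi j k c).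
  apply: nice_sum => [|i]; first by rewrite mulr_ge0// sqr_ge0.
  exact: niceM.
set K3 := d%:R * (4 * K ^+ 2) in braN *.
have K30 : 0 <= K3 by rewrite mulr_ge0// mulr_ge0// sqr_ge0.
have mK : 0 <= m%:R * K by rewrite mulr_ge0.
have mdK : 0 <= m%:R * (d%:R * K) by rewrite !mulr_ge0.
have mmK : 0 <= (m * m)%:R * K3 by rewrite mulr_ge0.
set L := 1 + _ + _ + _.
have L1 : m%:R * K <= L by rewrite /L; lra.
have L2 : 3 * (m%:R * (d%:R * K)) <= L by rewrite /L; lra.
have L2' : m%:R * (d%:R * K) <= L by rewrite /L; lra.
have L3 : (m * m)%:R * K3 <= L by rewrite /L; lra.
have L0 : 0 <= L by rewrite /L; lra.
have linc x z c : field_lin xi x z 0 c = \sum_k z 0 k * xi k x 0 c.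
  by rewrite summxE; apply: eq_bigr => k _; rewrite mxE.
have derc x v z c : field_der xi x v z 0 c =
    \sum_k z 0 k * \sum_i v 0 i * pd i (xi k) x 0 c.
  rewrite summxE; apply: eq_bigr => k _; rewrite mxE summxE; congr (_ * _).
  by apply: eq_bigr => i _; rewrite mxE.
have Xic x A c : Xi xi x A 0 c = \sum_j \sum_k A j k * brackets xi j k c x.
  rewrite summxE; apply: eq_bigr => j _; rewrite summxE; apply: eq_bigr => k _.
  rewrite mxE dirE summxE; congr (_ * _).
  by apply: eq_bigr => i _; rewrite mxE.
(* Abstracting the fields: otherwise coordinate rewriting unfolds them. *)
move: (field_lin xi) (field_der xi) (Xi xi) linc derc Xic => X J G linc derc Xic.
have linZ (z : W) (c : 'I_m -> R) (B l : R) : 0 <= B -> l <= L -> (forall k, `|c k| * m%:R <= l * B) ->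
    `|\sum_k z 0 k * c k| <= L * B * `|z|.
  move=> B0 lL cB.
  apply: (@le_trans _ _ (\sum_(k < m) `|z| * `|c k|)).
    apply: le_trans (ler_norm_sum _ _ _) _; apply: ler_sum => k _.
    by rewrite normrM ler_wpM2r// norm_coord_le.
  (* The bound for each index is divided by [m], so the empty family is set apart. *)
  case: (posnP m) => [m0|mp].
    rewrite big1 ?mulr_ge0// => k _.
    by exfalso; have := ltn_ord k; rewrite [X in (_ < X)%N]m0.
  have mR : 0 < m%:R :> R by rewrite ltr0n.
  apply: (@le_trans _ _ (\sum_(k < m) `|z| * (l * B / m%:R))).
    by apply: ler_sum => k _; rewrite ler_wpM2l// ler_pdivlMr.
  rewrite sumr_const card_ord -[leLHS]mulr_natr -[leLHS]mulrA divfK ?gt_eqF// mulrC.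
  by rewrite ler_wpM2r// ler_wpM2r.
have linA (A : M) (c : 'I_m -> 'I_m -> R) (B : R) : 0 <= B -> (forall i j, `|c i j| <= K3 * B) ->
    `|\sum_i \sum_j A i j * c i j| <= L * B * `|A|.
  move=> B0 cB; apply: le_trans (sum_mx_le A cB) _.
  rewrite [X in _ <= X](_ : _ = L * (`|A| * B)); last by ring.
  rewrite [X in X <= _](_ : _ = (m * m)%:R * K3 * (`|A| * B)); last by ring.
  by rewrite ler_wpM2r// mulr_ge0.
have linZ2 (z : W) (c c' : 'I_m -> R) (B l : R) : 0 <= B -> l <= L ->
    (forall k, `|c k - c' k| * m%:R <= l * B) ->
    `|\sum_k z 0 k * c k - \sum_k z 0 k * c' k| <= L * B * `|z|.
  move=> B0 lL cB; rewrite -sumrB.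
  by under eq_bigr do rewrite -mulrBr; apply: linZ lL cB.
have linZ3 (z : W) (c c' c'' : 'I_m -> R) (B l : R) : 0 <= B -> l <= L ->
    (forall k, `|c k - c' k - c'' k| * m%:R <= l * B) ->
    `|\sum_k z 0 k * c k - \sum_k z 0 k * c' k - \sum_k z 0 k * c'' k| <= L * B * `|z|.
  move=> B0 lL cB; rewrite -!sumrB.
  by under eq_bigr do rewrite -!mulrBr; apply: linZ lL cB.
have linZ6 (z : W) (c c' c'' g g' g'' : 'I_m -> R) (B l : R) : 0 <= B -> l <= L ->
    (forall k, `|c k - c' k - c'' k - (g k - g' k - g'' k)| * m%:R <= l * B) ->
    `|\sum_k z 0 k * c k - \sum_k z 0 k * c' k - \sum_k z 0 k * c'' k -
      (\sum_k z 0 k * g k - \sum_k z 0 k * g' k - \sum_k z 0 k * g'' k)| <= L * B * `|z|.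
  move=> B0 lL cB; rewrite -!sumrB.
  by under eq_bigr do rewrite -!mulrBr; apply: linZ lL cB.
have linA2 (A : M) (c c' : 'I_m -> 'I_m -> R) (B : R) : 0 <= B ->
    (forall i j, `|c i j - c' i j| <= K3 * B) ->
    `|\sum_i \sum_j A i j * c i j - \sum_i \sum_j A i j * c' i j| <= L * B * `|A|.
  move=> B0 cB; rewrite -sumrB.
  under eq_bigr do (rewrite -sumrB; under eq_bigr do rewrite -mulrBr).
  exact: linA.
have linA4 (A : M) (c c' g g' : 'I_m -> 'I_m -> R) (B : R) : 0 <= B ->
    (forall i j, `|c i j - c' i j - (g i j - g' i j)| <= K3 * B) ->
    `|\sum_i \sum_j A i j * c i j - \sum_i \sum_j A i j * c' i j -
      (\sum_i \sum_j A i j * g i j - \sum_i \sum_j A i j * g' i j)| <= L * B * `|A|.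
  move=> B0 cB; rewrite -!sumrB.
  under eq_bigr do (rewrite -!sumrB; under eq_bigr do rewrite -!mulrBr).
  exact: linA.
have coordB (u v : V) (a : 'I_1) c : (u - v) a c = u 0 c - v 0 c by rewrite (ord1 a) !mxE.
have cmp (c B l : R) : 0 <= B -> `|c| <= l * B -> `|c| * m%:R <= m%:R * l * B.
  by move=> B0 h; rewrite mulrC -mulrA ler_wpM2l.
split.
- by rewrite /L; lra.
- move=> x z w; apply/rowP => c; rewrite mxE !linc -big_split; apply: eq_bigr => k _ /=.
  by rewrite mxE mulrDl.
- move=> x v w z; apply/rowP => c; rewrite mxE !derc -big_split; apply: eq_bigr => k _ /=.
  rewrite -mulrDr -big_split; congr (_ * _); apply: eq_bigr => i _ /=.
  by rewrite mxE mulrDl.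
- move=> x A B; apply/rowP => c; rewrite mxE !Xic -big_split; apply: eq_bigr => j _ /=.
  by rewrite -big_split; apply: eq_bigr => k _ /=; rewrite mxE mulrDl.
- move=> x z w; apply/rowP => c; rewrite Xic derc exchange_big; apply: eq_bigr => k _ /=.
  under [in RHS]eq_bigr => i _ do rewrite linc mulr_suml.
  rewrite exchange_big mulr_sumr; apply: eq_bigr => j _ /=.
  rewrite mxE big_ord1 mxE /brackets !mulr_sumr; apply: eq_bigr => i _.
  by ring.
- move=> x z; apply: norm_mx_le => [|a c]; first by rewrite mulr_ge0.
  rewrite (ord1 a) linc -[L]mulr1; apply: linZ L1 _ => // k; apply: cmp => //.
  by rewrite mulr1; have [] := xiN k c.
- move=> x y z; apply: norm_mx_le => [|a c]; first by rewrite !mulr_ge0.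
  rewrite coordB (linc x) (linc y).
  by apply: linZ2 L1 _ => // k; apply: cmp => //; have [_ lip _] := xiN k c; apply: lip.
- move=> x v z; apply: norm_mx_le => [|a c]; first by rewrite !mulr_ge0.
  rewrite (ord1 a) derc; apply: linZ L2' _ => // k; apply: cmp => //.
  rewrite -mulrA [K * _]mulrC mulrA; apply: sum_coord_le => i.
  by have [] := dxiN k i c.
- move=> x y v z; apply: norm_mx_le => [|a c]; first by rewrite !mulr_ge0.
  rewrite coordB (derc x) (derc y).
  rewrite -(mulrA L); apply: linZ2 L2' _ => [|k]; first by rewrite mulr_ge0.
  apply: cmp; first by rewrite mulr_ge0.
  rewrite -sumrB; under eq_bigr do rewrite -mulrBr.
  rewrite [leRHS](_ : _ = d%:R * `|v| * (K * `|x - y|)); last by ring.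
  by apply: sum_coord_le => i; have [_ lip _] := dxiN k i c; apply: lip.
- move=> x A; apply: norm_mx_le => [|a c]; first by rewrite mulr_ge0.
  rewrite (ord1 a) Xic -[L]mulr1; apply: linA => // j k.
  by rewrite mulr1; have [] := braN j k c.
- move=> x y A; apply: norm_mx_le => [|a c]; first by rewrite !mulr_ge0.
  rewrite coordB (Xic x) (Xic y).
  by apply: linA2 => // j k; have [_ lip _] := braN j k c; apply: lip.
- move=> x y x' y' A.
  have B0 : 0 <= `|(y - x) - (y' - x')| + (`|x - x'| + `|y - y'|) * (`|y - x| + `|y' - x'|).
    by rewrite addr_ge0// mulr_ge0// addr_ge0.
  apply: norm_mx_le => [|a c]; first by rewrite !mulr_ge0.
  rewrite coordB (coordB (G y A)) (coordB (G y' A)).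
  rewrite (Xic y) (Xic x) (Xic y') (Xic x').
  by apply: linA4 => // j k; have [_ _ +] := braN j k c; apply.
- move=> x y z.
  have B0 : 0 <= `|y - x| ^+ 2 by rewrite exprn_ge0.
  apply: norm_mx_le => [|a c]; first by rewrite !mulr_ge0.
  rewrite coordB (coordB (X y z)) (linc y) (linc x) (derc x).
  apply: linZ3 L2' _ => // k; apply: cmp => //.
  apply: (partials_taylor (has_partials_coord c (hp k))) => // i x' y'.
  by have [_ lip _] := dxiN k i c; apply: lip.
- move=> x y x' y' z.
  have B0 : 0 <= `|(y - x) - (y' - x')| * (`|y - x| + `|y' - x'|) +
      (`|x - x'| + `|y - y'|) * (`|y - x| + `|y' - x'|) ^+ 2.
    by rewrite addr_ge0// mulr_ge0 ?exprn_ge0 ?addr_ge0.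
  apply: norm_mx_le => [|a c]; first by rewrite !mulr_ge0.
  rewrite coordB (coordB (X y z - _)) (coordB (X y z)).
  rewrite (coordB (X y' z - _)) (coordB (X y' z)).
  rewrite (linc y) (linc x) (linc y') (linc x') (derc x) (derc x').
  rewrite mulrCA in L2.
  apply: linZ6 L2 _ => // k; apply: cmp => //.
  exact: (partials_taylor4 (has_partials_coord c (hp k))).
Qed.

(** [L] is chosen before [xi], so it depends on the bound [N] only. Bounds on derivatives up to
    order three give the Lipschitz constant [K1] for orders up to two and the second-difference
    constant [K] for orders up to one. *)
Lemma C3b_rough_field (N : R) : 0 <= N -> exists2 L : R, 1 <= L &
  forall xi, C3b_family xi -> C3b_family_norm xi <= N ->
  rough_field L (field_lin xi) (fun (x v : V) (z : W) => \sum_k z 0 k *: 'D_v (xi k) x) (Xi xi).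
Proof.
move=> N0; pose K1 := (1 + d%:R) * N; pose K := (1 + d%:R) * K1.
have dN : 0 <= d%:R * N by rewrite mulr_ge0.
have K10 : 0 <= K1 by rewrite /K1; lra.
have dK1 : 0 <= d%:R * K1 by rewrite mulr_ge0.
have K0 : 0 <= K by rewrite /K; lra.
exists (1 + m%:R * K + 3 * (m%:R * (d%:R * K)) + (m * m)%:R * (d%:R * (4 * K ^+ 2))).
  by rewrite -!addrA lerDl !addr_ge0// !mulr_ge0// exprn_ge0.
move=> xi C3 xiN.
have sn0 k : [/\ 0 <= supnorm (xi k), forall i, 0 <= supnorm (pd i (xi k)),
    forall i j, 0 <= supnorm (pd j (pd i (xi k))) &
    forall i j l, 0 <= supnorm (pd l (pd j (pd i (xi k))))].
  have [b0 _ b1 b2 b3] := C3 k; split.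
  - exact: supnorm_ge0.
  - by move=> i; apply: supnorm_ge0; have [] := b1 i.
  - by move=> i j; apply: supnorm_ge0; have [] := b2 i j.
  - by move=> i j l; apply: supnorm_ge0.
have s1 k : 0 <= \sum_i supnorm (pd i (xi k)) by apply: sumr_ge0 => i _; have [] := sn0 k.
have s2 k : 0 <= \sum_i \sum_j supnorm (pd j (pd i (xi k))).
  by apply: sumr_ge0 => i _; apply: sumr_ge0 => j _; have [] := sn0 k.
have s3 k : 0 <= \sum_i \sum_j \sum_l supnorm (pd l (pd j (pd i (xi k)))).
  by apply: sumr_ge0 => i _; apply: sumr_ge0 => j _; apply: sumr_ge0 => l _; have [] := sn0 k.
have C3N k : C3b_norm (xi k) <= N.
  apply: le_trans xiN; rewrite /C3b_family_norm (bigD1 k)//= lerDl sumr_ge0// => k' _.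
  have [x0 _ _ _] := sn0 k'; rewrite /C3b_norm.
  by rewrite !addr_ge0.
have dec (a b c e : R) : 0 <= a -> 0 <= b -> 0 <= c -> 0 <= e -> a + b + c + e <= N ->
    [/\ a <= N, b <= N, c <= N & e <= N] by move=> *; split; lra.
have bnds k := let: And4 x0 _ _ _ := sn0 k in dec _ _ _ _ x0 (s1 k) (s2 k) (s3 k) (C3N k).
have term (I : finType) (F : I -> R) i : (forall i, 0 <= F i) -> F i <= \sum_i F i.
  by move=> F0; rewrite (bigD1 i)//= lerDl sumr_ge0.
have c0 k x c : `|xi k x 0 c| <= N.
  have [b0 _ _ _ _] := C3 k.
  apply: le_trans (norm_coord_le _ _ _) _; apply: le_trans (norm_le_enorm _) _.
  by apply: le_trans (supnorm_ub x b0) _; have [] := bnds k.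
have c1 k i x c : `|pd i (xi k) x 0 c| <= N.
  have [_ _ b1 _ _] := C3 k; have [x0 x1 x2 x3] := sn0 k.
  apply: le_trans (norm_coord_le _ _ _) _; apply: le_trans (norm_le_enorm _) _.
  apply: le_trans (supnorm_ub x (b1 i).1) _; apply: le_trans (term _ _ i x1) _.
  by have [] := bnds k.
have c2 k i j x c : `|pd j (pd i (xi k)) x 0 c| <= N.
  have [_ _ _ b2 _] := C3 k; have [x0 x1 x2 x3] := sn0 k.
  apply: le_trans (norm_coord_le _ _ _) _; apply: le_trans (norm_le_enorm _) _.
  apply: le_trans (supnorm_ub x (b2 i j).1) _.
  have t1 := term _ _ j (x2 i).
  have t2 := term _ (fun i => \sum_j supnorm (pd j (pd i (xi k)))) i
    (fun i => sumr_ge0 _ (fun j _ => x2 i j)).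
  by apply: le_trans t1 (le_trans t2 _); have [] := bnds k.
have c3 k i j l x c : `|pd l (pd j (pd i (xi k))) x 0 c| <= N.
  have [_ _ _ _ b3] := C3 k; have [x0 x1 x2 x3] := sn0 k.
  apply: le_trans (norm_coord_le _ _ _) _; apply: le_trans (norm_le_enorm _) _.
  apply: le_trans (supnorm_ub x (b3 i j l)) _.
  have t1 := term _ _ l (x3 i j).
  have t2 := term _ (fun j => \sum_l supnorm (pd l (pd j (pd i (xi k))))) j
    (fun j => sumr_ge0 _ (fun l _ => x3 i j l)).
  have t3 := term _ (fun i => \sum_j \sum_l supnorm (pd l (pd j (pd i (xi k))))) i
    (fun i => sumr_ge0 _ (fun j _ => sumr_ge0 _ (fun l _ => x3 i j l))).
  by apply: le_trans t1 (le_trans t2 (le_trans t3 _)); have [] := bnds k.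
have hp k : has_partials (xi k) by have [] := C3 k.
have hp1 k i : has_partials (pd i (xi k)) by have [_ _ /(_ i)[]] := C3 k.
have hp2 k i j : has_partials (pd j (pd i (xi k))) by have [_ _ _ /(_ i j)[]] := C3 k.
have NK1 : N <= K1 by rewrite /K1; lra.
have lipK1 (f : V -> V) (hf : has_partials f) : (forall i x c, `|pd i f x 0 c| <= N) ->
    forall x y c, `|f y 0 c - f x 0 c| <= K1 * `|y - x|.
  move=> fN x y c; have := partials_lipschitz (has_partials_coord c hf) (fun i x => fN i x c) x y.
  move=> /le_trans; apply.
  have : 0 <= N * `|y - x| by rewrite mulr_ge0.
  by rewrite /K1; lra.
have nice0 k c : nice K (fun x => xi k x 0 c).
  apply: (partials_nice (has_partials_coord c (hp k))).
  - by move=> x; apply: le_trans NK1.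
  - by move=> i x; apply: le_trans NK1.
  - by move=> i x y; apply: lipK1.
have nice1 k i c : nice K (fun x => pd i (xi k) x 0 c).
  apply: (partials_nice (has_partials_coord c (hp1 k i))).
  - by move=> x; apply: le_trans NK1.
  - by move=> j x; apply: le_trans NK1.
  - by move=> j x y; apply: lipK1.
(* Taylor's estimate with Lipschitz partial derivatives shows that the directional derivative
   exists, and what it is. *)
have dirE k x v : 'D_v (xi k) x = \sum_i v 0 i *: pd i (xi k) x.
  have [_ ->//] : is_derive x v (xi k) (\sum_i v 0 i *: pd i (xi k) x).
  apply: (@is_derive_of_bound _ _ _ _ _ _ _ (d%:R * K1 * `|v| ^+ 2)) => h.
  have B0 : 0 <= d%:R * K1 * `|v| ^+ 2 * h ^+ 2.
    by apply: mulr_ge0; [rewrite mulr_ge0|exact: sqr_ge0].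
  apply: norm_mx_le => // a c; rewrite (ord1 a).
  have lip1 i x' y' : `|pd i (xi k) y' 0 c - pd i (xi k) x' 0 c| <= K1 * `|y' - x'|.
    exact: lipK1.
  have := partials_taylor (has_partials_coord c (hp k)) lip1 K10 x (x + h *: v).
  have -> : x + h *: v - x = h *: v by rewrite addrC addKr.
  rewrite normrZ exprMn real_normK ?num_real// mulrCA [h ^+ 2 * _]mulrC.
  have -> : (xi k (x + h *: v) - xi k x - h *: (\sum_i v 0 i *: pd i (xi k) x)) 0 c =
    xi k (x + h *: v) 0 c - xi k x 0 c - \sum_i (h *: v) 0 i * pd i (xi k) x 0 c.
    rewrite !mxE summxE mulr_sumr; congr (_ - _); apply: eq_bigr => i _.
    by rewrite !mxE mulrA.
  by [].
have -> : (fun (x v : V) (z : W) => \sum_k z 0 k *: 'D_v (xi k) x) = field_der xi.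
  apply/funext => x; apply/funext => v; apply/funext => z.
  by apply: eq_bigr => k _; rewrite dirE.
exact: rough_field_of_nice.
Qed.

End FieldOfC3b.

(** * Remainders of Euler recursions on a grid *)

Section EulerBounds.
Variables (R : realType) (d m : nat) (p : R).
Notation V := 'rV[R]_d.
Notation W := 'rV[R]_m.
Notation M := 'M[R]_(m, m).

Record rough_grid (phi : nat -> R) (n : nat) (Z : nat -> nat -> W)
    (ZZ : nat -> nat -> M) : Prop := RoughGrid {
  rg_phi : forall i j, (i <= j <= n)%N -> phi i <= phi j;
  rg_Z : forall i j, (i <= j <= n)%N -> `|Z i j| <= hold p phi i j;
  rg_ZZ : forall i j, (i <= j <= n)%N -> `|ZZ i j| <= hold p phi i j ^+ 2;
  rg_ZD : forall i k j, (i <= k <= j)%N -> (j <= n)%N -> Z i j = Z i k + Z k j;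
  rg_ZZD : forall i k j, (i <= k <= j)%N -> (j <= n)%N ->
    ZZ i j = ZZ i k + ZZ k j + (Z i k)^T *m Z k j }.

Section Remainders.
Variables (X : V -> W -> V) (G : V -> M -> V) (Z : nat -> nat -> W)
  (ZZ : nat -> nat -> M) (y B : nat -> V).

(** [rem1] is the remainder of the first-order expansion, of order two in [hold]. [rem2] also
    removes the drift and the area term, and is the discrete counterpart of [rde_remainder]. *)
Definition rem1 i j := y j - y i - X (y i) (Z i j).
Definition rem2 i j := rem1 i j - (B j - B i) - G (y i) (ZZ i j).

Record euler_seq (phi : nat -> R) (n : nat) : Prop := EulerSeq {
  es_step : forall l, (l < n)%N -> rem2 l l.+1 = 0;
  es_drift : forall i j, (i <= j <= n)%N -> `|B j - B i| <= phi j - phi i }.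

Lemma rem2_diag L J phi n : rough_field L X J G -> rough_grid phi n Z ZZ ->
  forall i, (i <= n)%N -> rem2 i i = 0.
Proof.
move=> fX gZ i iN.
have Z0 : Z i i = 0.
  have := rg_ZD gZ (introT andP (conj (leqnn i) (leqnn i))) iN.
  by rewrite -{1}[Z i i]addr0 => /addrI <-.
have ZZ0 : ZZ i i = 0.
  have := rg_ZZD gZ (introT andP (conj (leqnn i) (leqnn i))) iN.
  by rewrite Z0 mulmx0 addr0 -{1}[ZZ i i]addr0 => /addrI <-.
have X0 x : X x 0 = 0.
  by have := rf_XD fX x 0 0; rewrite addr0 -{1}[X x 0]addr0 => /addrI <-.
have G0 x : G x 0 = 0.
  by have := rf_GD fX x 0 0; rewrite addr0 -{1}[G x 0]addr0 => /addrI <-.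
by rewrite /rem2 /rem1 Z0 ZZ0 X0 G0 !subrr.
Qed.

(** Increments of [y] and [B] telescope. The tensor product in Chen's relation contributes, by
    [rf_GX], the value of [J] at the increment [X (y i) (Z i k)]; this is the leading part of the
    linear Taylor term and cancels against it. What remains is of third order. *)
Lemma rem2_defect L J phi n : rough_field L X J G -> rough_grid phi n Z ZZ ->
  forall i k j, (i <= k <= j)%N -> (j <= n)%N ->
  rem2 i j - rem2 i k - rem2 k j =
  (X (y k) (Z k j) - X (y i) (Z k j) - J (y i) (y k - y i) (Z k j))
  + J (y i) (rem1 i k) (Z k j) + (G (y k) (ZZ k j) - G (y i) (ZZ k j)).
Proof.
move=> fX gZ i k j ikj jn.
have -> : y k - y i = rem1 i k + X (y i) (Z i k) by rewrite /rem1 subrK.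
rewrite (rf_JD fX) /rem2 [rem1 i j]/rem1 [rem1 k j]/rem1.
rewrite (rg_ZD gZ ikj jn) (rg_ZZD gZ ikj jn) !(rf_XD fX) !(rf_GD fX) (rf_GX fX).
rewrite {1}/rem1.
rv_ring.
Qed.

End Remainders.

(** [k] is the last index before half of the increment of [phi] is used up, so [k.+1] is past it
    unless it equals [j]. The step from [k] to [k.+1] may itself carry a large increment; this is
    why sewing drops it. *)
Lemma grid_mid (phi : nat -> R) i j : (i < j)%N -> phi i <= phi j ->
  exists2 k, (i <= k < j)%N &
    phi k - phi i <= (phi j - phi i) / 2 /\
    phi j - phi k.+1 <= (phi j - phi i) / 2.
Proof.
move=> ij phij.
pose P k := (i <= k < j)%N && (phi k - phi i <= (phi j - phi i) / 2).
have exP : exists k, P k by exists i; rewrite /P leqnn ij subrr/=; lra.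
have ubP k : P k -> (k <= j)%N by move=> /andP[/andP[_ /ltnW]].
case: (ex_maxnP exP ubP) => k /andP[ikj kh] kmax.
exists k => //; split => //.
have [jk|jk] := eqVneq k.+1 j; first by rewrite jk; lra.
have [//|h] := lerP (phi j - phi k.+1) ((phi j - phi i) / 2).
have : P k.+1 by rewrite /P; apply/andP; split; [nat_lia|lra].
by move/kmax; rewrite ltnn.
Qed.

End EulerBounds.

Section EulerEstimates.
Variables (R : realType) (d m : nat).
Notation V := 'rV[R]_d.
Notation W := 'rV[R]_m.
Notation M := 'M[R]_(m, m).

(** On a window with [K * hold <= 1] a cubic bound on [rem2] implies a quadratic one with constant
    1, so the bounds on [rem1] and on increments carry a constant [c] independent of [K]. The defect
    constant [cd] is therefore fixed before [K], and sewing closes without circularity. *)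
Lemma euler_seq_apriori (p L : R) : 2 <= p -> p < 3 -> 1 <= L ->
  exists eps c K : R, [/\ 0 < eps <= 1, 0 <= c, 0 <= K &
  forall (X : V -> W -> V) J (G : V -> M -> V) phi n Z ZZ y B,
  rough_field L X J G -> rough_grid p phi n Z ZZ ->
  euler_seq X G Z ZZ y B phi n ->
  forall a b, (a <= b <= n)%N -> hold p phi a b <= eps ->
  forall i j, (a <= i <= j)%N -> (j <= b)%N ->
  [/\ `|rem2 X G Z ZZ y B i j| <= K * hold p phi i j ^+ 3,
      `|rem1 X Z y i j| <= c * hold p phi i j ^+ 2 &
      `|y j - y i| <= c * hold p phi i j]].
Proof.
move=> p2 p3 L1.
have [lam [kappa [lam0 kappa1 lamk lam3 half]]] := half_hold p2 p3.
have kappa0 : 0 <= kappa := le_trans lam0 lamk.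
(* [rem2], drift and area contribute [1 + 1 + L] to [rem1]; the term in [X] adds another [L] for
   increments. In [cd], the square of [c] is due to the Taylor term of [rem2_defect], the two linear
   ones to its terms in [J] and [G]. *)
pose c := 2 * L + 2.
pose cd := L * (c ^+ 2 + 2 * c).
have c0 : 0 <= c by rewrite /c; lra.
have cd0 : 0 <= cd by rewrite /cd; apply: mulr_ge0; [lra|nra].
pose K := 2 * cd / (1 - kappa).
have k1 : 0 < 1 - kappa by lra.
have K0 : 0 <= K by apply: divr_ge0; [exact: mulr_ge0|exact: ltW].
have K1 : 0 < 1 + K by lra.
have eps0 : 0 < (1 + K)^-1 by rewrite invr_gt0.
have eps1 : (1 + K)^-1 <= 1 by rewrite invf_le1// lerDl.
exists (1 + K)^-1, c, K; split; rewrite ?eps0//.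
move=> X J G phi n Z ZZ y B fX gZ [sy By] a b /andP[ab bn] hab.
pose q i j := hold p phi i j.
have q0 i j : 0 <= q i j by apply: hold_ge0.
have phi_le i j : (i <= j <= n)%N -> phi i <= phi j by apply: (rg_phi gZ).
have qle i j i' j' : (i <= i')%N -> (i' <= j' <= j)%N -> (j <= n)%N ->
    q i' j' <= q i j.
  by move=> ii' ij jn; apply: le_hold => //; apply: phi_le; nat_lia.
have qeps i j : (a <= i <= j)%N -> (j <= b)%N -> q i j <= (1 + K)^-1.
  by move=> ij jb; apply: le_trans hab; apply: qle; nat_lia.
have q1 i j : (a <= i <= j)%N -> (j <= b)%N -> q i j <= 1.
  by move=> ij jb; apply: le_trans eps1; apply: qeps.
have Kq i j : (a <= i <= j)%N -> (j <= b)%N -> K * q i j <= 1.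
  move=> ij jb; have := ler_wpM2l K0 (qeps i j ij jb).
  by move=> /le_trans; apply; rewrite ler_pdivrMr; lra.
have Lc : L * 1 <= c by rewrite /c; lra.
have bounds i j : (a <= i <= j)%N -> (j <= b)%N ->
    `|rem2 X G Z ZZ y B i j| <= K * q i j ^+ 3 ->
    `|rem1 X Z y i j| <= c * q i j ^+ 2 /\ `|y j - y i| <= c * q i j.
  move=> ij jb A3.
  have ijn : (i <= j <= n)%N by nat_lia.
  have Q1 := q1 i j ij jb; have Q0 := q0 i j; have KQ := Kq i j ij jb.
  have QQ : 0 <= q i j ^+ 2 by rewrite sqr_ge0.
  have A2 : `|rem2 X G Z ZZ y B i j| <= q i j ^+ 2.
    apply: le_trans A3 _; rewrite exprS mulrA.
    by rewrite -[X in _ <= X]mul1r ler_wpM2r.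
  have B2 : `|B j - B i| <= q i j ^+ 2.
    by apply: le_trans (By i j ijn) _; apply: hold_le1 => //; apply: phi_le.
  have G2 : `|G (y i) (ZZ i j)| <= L * q i j ^+ 2.
    apply: le_trans (rf_Gb fX _ _) _.
    by rewrite ler_wpM2l//; [lra|exact: (rg_ZZ gZ)].
  have X2 : `|X (y i) (Z i j)| <= L * q i j.
    apply: le_trans (rf_Xb fX _ _) _.
    by rewrite ler_wpM2l//; [lra|exact: (rg_Z gZ)].
  have rE : rem1 X Z y i j = rem2 X G Z ZZ y B i j + (B j - B i) + G (y i) (ZZ i j).
    by rewrite /rem2; rv_ring.
  have r2 : `|rem1 X Z y i j| <= (L + 2) * q i j ^+ 2.
    rewrite rE.
    have := ler_normD (rem2 X G Z ZZ y B i j + (B j - B i)) (G (y i) (ZZ i j)).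
    have := ler_normD (rem2 X G Z ZZ y B i j) (B j - B i).
    lra.
  have q2q : q i j ^+ 2 <= q i j by rewrite expr2 ler_piMl.
  split; first by apply: le_trans r2 _; rewrite ler_wpM2r// /c; lra.
  have -> : y j - y i = rem1 X Z y i j + X (y i) (Z i j) by rewrite /rem1 subrK.
  have := ler_normD (rem1 X Z y i j) (X (y i) (Z i j)).
  have : (L + 2) * q i j ^+ 2 <= (L + 2) * q i j by rewrite ler_wpM2l//; lra.
  by rewrite /c; lra.
have A0 i : (a <= i <= b)%N -> rem2 X G Z ZZ y B i i = 0.
  by move=> ib; apply: (rem2_diag y B fX gZ); nat_lia.
(* Extended by zero, because sewing asks for a vanishing diagonal at every index. *)
pose A i j := if (i <= b)%N && (a <= i)%N then rem2 X G Z ZZ y B i j else 0.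
suff main i j : (a <= i <= j)%N -> (j <= b)%N -> `|A i j| <= K * q i j ^+ 3.
  move=> i j ij jb; have := main i j ij jb; rewrite /A ifT; last by nat_lia.
  by move=> A3; have [r2 y1] := bounds i j ij jb A3; split.
apply: (discrete_sewing (E := fun i j => q i j ^+ 3) (a := a) (b := b) cd0 kappa0 K0) => //.
- by rewrite /K [X in _ <= X]mulrC divfK// gt_eqF.
- by move=> k; rewrite /A; case: ifP => // hk; rewrite A0//; nat_lia.
- by move=> l lb; rewrite /A; case: ifP => // hk; rewrite sy//; nat_lia.
- by move=> *; rewrite exprn_ge0.
- by move=> i' k' j' h h'; rewrite lerXn2r ?nnegrE// qle//; nat_lia.
- move=> i' j' h h'.
  have phij : phi i' <= phi j' by apply: phi_le; nat_lia.
  have [k kk [hk1 hk2]] := grid_mid (proj2 (andP h)) phij.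
  exists k => //.
  have h1 : q i' k <= lam * q i' j' by apply: half => //; rewrite subr_ge0 phi_le//; nat_lia.
  have h2 : q k.+1 j' <= lam * q i' j' by apply: half => //; rewrite subr_ge0 phi_le//; nat_lia.
  have h3 : q i' k ^+ 3 <= (lam * q i' j') ^+ 3 by rewrite lerXn2r ?nnegrE// mulr_ge0.
  have h4 : q k.+1 j' ^+ 3 <= (lam * q i' j') ^+ 3 by rewrite lerXn2r ?nnegrE// mulr_ge0.
  have h5 : (2 * lam ^+ 3) * q i' j' ^+ 3 <= kappa * q i' j' ^+ 3.
    by rewrite ler_wpM2r// exprn_ge0.
  rewrite exprMn in h3 h4; lra.
move=> i' k j' h h'; rewrite /A !ifT; [|nat_lia..] => Aik.
have ik : (a <= i' <= k)%N by nat_lia.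
have [r2 y1] := bounds i' k ik (leq_trans (proj1 (andP h')) (proj2 (andP h'))) Aik.
rewrite (rem2_defect y B fX gZ); [|nat_lia..].
have kjn : (k <= j' <= n)%N by nat_lia.
set Q := q i' j'; have Q0 : 0 <= Q by apply: q0.
have qik : q i' k <= Q by apply: qle; nat_lia.
have qkj : q k j' <= Q by apply: qle; nat_lia.
have Zkj : `|Z k j'| <= Q by apply: le_trans qkj; apply: (rg_Z gZ).
have ZZkj : `|ZZ k j'| <= Q ^+ 2.
  apply: le_trans (rg_ZZ gZ kjn) _; rewrite lerXn2r ?nnegrE//.
have yQ : `|y k - y i'| <= c * Q by apply: le_trans y1 _; rewrite ler_wpM2l.
have rQ : `|rem1 X Z y i' k| <= c * Q ^+ 2.
  by apply: le_trans r2 _; rewrite ler_wpM2l// lerXn2r ?nnegrE.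
have L0 : 0 <= L by lra.
have cQ : 0 <= c * Q by rewrite mulr_ge0.
have T1 := rf_T fX (y i') (y k) (Z k j').
have T2 : L * `|y k - y i'| ^+ 2 * `|Z k j'| <= L * (c * Q) ^+ 2 * Q.
  by rewrite ler_pM ?mulr_ge0 ?sqr_ge0// ler_wpM2l// lerXn2r ?nnegrE.
have J1 := rf_Jb fX (y i') (rem1 X Z y i' k) (Z k j').
have J2 : L * `|rem1 X Z y i' k| * `|Z k j'| <= L * (c * Q ^+ 2) * Q.
  by rewrite ler_pM ?mulr_ge0// ler_wpM2l.
have G1 := rf_Glip fX (y k) (y i') (ZZ k j').
have G2 : L * `|y k - y i'| * `|ZZ k j'| <= L * (c * Q) * Q ^+ 2.
  by rewrite ler_pM ?mulr_ge0// ler_wpM2l.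
have -> : cd * Q ^+ 3 =
    L * (c * Q) ^+ 2 * Q + L * (c * Q ^+ 2) * Q + L * (c * Q) * Q ^+ 2.
  by rewrite /cd; ring.
apply: le_trans (ler_normD _ _) _.
rewrite lerD ?(le_trans G1 G2)//.
apply: le_trans (ler_normD _ _) _.
by rewrite lerD ?(le_trans J1 J2) ?(le_trans T1 T2).
Qed.

End EulerEstimates.

Section EulerDifference.
Variables (R : realType) (d m : nat).
Notation V := 'rV[R]_d.
Notation W := 'rV[R]_m.
Notation M := 'M[R]_(m, m).

(** Adds up the bounds on the defect terms. As [Q <= 1], every monomial is dominated by [S * Q ^+ 3]
    or [D * Q]; the factor 13 is a crude common coefficient. *)
Lemma euler_difference_arith (L c D S Q : R) :
  0 <= L -> 0 <= c -> 0 <= D -> 0 <= S -> 0 <= Q -> Q <= 1 ->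
  L * ((2 * D + (2 * L + 1) * S * Q) * (2 * (c * Q)) + 2 * S * (2 * (c * Q)) ^+ 2) * Q
   + (L * S * (c * Q ^+ 2) * Q + L * (2 * D + (L + 1) * S * Q ^+ 2) * Q)
   + L * ((2 * D + (2 * L + 1) * S * Q) + 2 * S * (2 * (c * Q))) * Q ^+ 2 <=
  L * (13 * (1 + c) * (1 + c) * (1 + L)) * (S * Q ^+ 3 + D * Q).
Proof.
move=> L0 c0 D0 S0 Q0 Q1.
have DQ : 0 <= D * Q by rewrite mulr_ge0.
have SQ3 : 0 <= S * Q ^+ 3 by rewrite mulr_ge0// exprn_ge0.
have DQ2 : D * Q ^+ 2 <= D * Q by rewrite ler_wpM2l// expr2 ler_piMl.
have -> : L * ((2 * D + (2 * L + 1) * S * Q) * (2 * (c * Q)) + 2 * S * (2 * (c * Q)) ^+ 2) * Q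
   + (L * S * (c * Q ^+ 2) * Q + L * (2 * D + (L + 1) * S * Q ^+ 2) * Q)
   + L * ((2 * D + (2 * L + 1) * S * Q) + 2 * S * (2 * (c * Q))) * Q ^+ 2 =
   L * ((4 * c + 2) * (D * Q ^+ 2) + 2 * (D * Q) +
     (2 * c * (2 * L + 1) + 8 * c ^+ 2 + c + (L + 1) + (2 * L + 1) + 4 * c) * (S * Q ^+ 3)).
  by ring.
rewrite -[X in _ <= X]mulrA; apply: ler_wpM2l => //; rewrite mulrDr.
have cL : 0 <= c * L by rewrite mulr_ge0.
have ccL : 0 <= c * (c * L) by rewrite mulr_ge0.
have cc : 0 <= c * c by rewrite mulr_ge0.
set C := 13 * (1 + c) * (1 + c) * (1 + L).
have : (2 * c * (2 * L + 1) + 8 * c ^+ 2 + c + (L + 1) + (2 * L + 1) + 4 * c) * (S * Q ^+ 3)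
    <= C * (S * Q ^+ 3).
  by apply: ler_wpM2r => //; rewrite /C; lra.
have : (4 * c + 2) * (D * Q ^+ 2) <= (4 * c + 2) * (D * Q) by apply: ler_wpM2l => //; lra.
have : (4 * c + 4) * (D * Q) <= C * (D * Q).
  by apply: ler_wpM2r => //; rewrite /C; lra.
lra.
Qed.

(** Sewing for the difference of two remainders, with error [S * hold ^+ 3] plus the increment of
    [D] times [hold]: [S] bounds the distance on the window, [D] the discrepancy of the drifts. The
    first part contracts by [2 * lam ^+ 3], the second by [lam], since increments of [D] over
    disjoint pieces add up. The term in [S] survives with a factor [hold], to be absorbed on short
    windows. *)
Lemma euler_seq_difference (p L : R) : 2 <= p -> p < 3 -> 1 <= L ->
  exists2 eps : R, 0 < eps <= 1 &
  forall (X : V -> W -> V) J (G : V -> M -> V) phi n Z ZZ y B y' B' (D : nat -> R),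
  rough_field L X J G -> rough_grid p phi n Z ZZ ->
  euler_seq X G Z ZZ y B phi n -> euler_seq X G Z ZZ y' B' phi n ->
  (forall i j, (i <= j <= n)%N -> `|(B j - B i) - (B' j - B' i)| <= D j - D i) ->
  forall a b S, (a <= b <= n)%N -> hold p phi a b <= eps ->
  (forall i, (a <= i <= b)%N -> `|y i - y' i| <= S) ->
  forall i j, (a <= i <= j)%N -> (j <= b)%N ->
  `|(y j - y' j) - (y i - y' i)| <= 2 * (D j - D i) + (2 * L + 1) * S * hold p phi i j.
Proof.
move=> p2 p3 L1.
have shuffle (v1 v2 v3 w1 w2 w3 : V) :
  (v1 - w1) - (v2 - w2) - (v3 - w3) = (v1 - v2 - v3) - (w1 - w2 - w3) by rv_ring.
have shuffle' (v1 v2 v3 w1 w2 w3 : V) :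
  (v1 + v2 + v3) - (w1 + w2 + w3) = (v1 - w1) + (v2 - w2) + (v3 - w3) by rv_ring.
have [eps1 [c [K1 [/andP[e0 e1] c0 K10 apriori]]]] := euler_seq_apriori d m p2 p3 L1.
have [lam [kappa [lam0 kappa1 lamk lam3 half]]] := half_hold p2 p3.
have kappa0 : 0 <= kappa := le_trans lam0 lamk.
pose cd := L * (13 * (1 + c) * (1 + c) * (1 + L)).
have L0 : 0 <= L by lra.
have cd0 : 0 <= cd by rewrite /cd !mulr_ge0//; lra.
pose K := 2 * cd / (1 - kappa).
have k1 : 0 < 1 - kappa by lra.
have K0 : 0 <= K by apply: divr_ge0; [exact: mulr_ge0|exact: ltW].
have KK : 0 < 1 + K by lra.
have eps0 : 0 < (1 + K)^-1 by rewrite invr_gt0.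
exists (Num.min eps1 (1 + K)^-1).
  by rewrite lt_min e0 eps0/= ge_min e1.
move=> X J G phi n Z ZZ y B y' B' D fX gZ ey ey' BD a b S /andP[ab bn] hab uS.
move: hab; rewrite le_min => /andP[habe habK].
have ap := apriori X J G phi n Z ZZ y B fX gZ ey a b (introT andP (conj ab bn)) habe.
have ap' := apriori X J G phi n Z ZZ y' B' fX gZ ey' a b (introT andP (conj ab bn)) habe.
pose q i j := hold p phi i j.
have q0 i j : 0 <= q i j by apply: hold_ge0.
have phi_le i j : (i <= j <= n)%N -> phi i <= phi j by apply: (rg_phi gZ).
have qle i j i' j' : (i <= i')%N -> (i' <= j' <= j)%N -> (j <= n)%N ->
    q i' j' <= q i j.
  by move=> ii' ij jn; apply: le_hold => //; apply: phi_le; nat_lia.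
have q1 i j : (a <= i <= j)%N -> (j <= b)%N -> q i j <= 1.
  move=> ij jb; apply: le_trans e1; apply: le_trans habe; apply: qle; nat_lia.
have Kq i j : (a <= i <= j)%N -> (j <= b)%N -> K * q i j <= 1.
  move=> ij jb.
  have qab : q i j <= q a b by apply: qle; nat_lia.
  have := ler_wpM2l K0 (le_trans qab habK).
  by move=> /le_trans; apply; rewrite ler_pdivrMr; lra.
have D0 i j : (i <= j <= n)%N -> 0 <= D j - D i.
  by move=> ij; apply: le_trans (BD _ _ ij).
have S0 : 0 <= S by apply: le_trans (normr_ge0 _) (uS a _); rewrite leqnn.
pose a2 i j := rem2 X G Z ZZ y B i j - rem2 X G Z ZZ y' B' i j.
have bounds i j : (a <= i <= j)%N -> (j <= b)%N ->
    `|a2 i j| <= K * (S * q i j ^+ 3 + (D j - D i) * q i j) ->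
    `|rem1 X Z y i j - rem1 X Z y' i j| <= 2 * (D j - D i) + (L + 1) * S * q i j ^+ 2 /\
    `|(y j - y' j) - (y i - y' i)| <= 2 * (D j - D i) + (2 * L + 1) * S * q i j.
  move=> ij jb A3.
  have ijn : (i <= j <= n)%N by nat_lia.
  have Q1 := q1 i j ij jb; have Q0 := q0 i j; have KQ := Kq i j ij jb.
  have Dij := D0 _ _ ijn; have BDij := BD _ _ ijn.
  have SQ : 0 <= S * q i j ^+ 2 + (D j - D i) by rewrite addr_ge0// mulr_ge0// sqr_ge0.
  have A2 : `|a2 i j| <= S * q i j ^+ 2 + (D j - D i).
    apply: le_trans A3 _.
    rewrite (_ : K * _ = (K * q i j) * (S * q i j ^+ 2 + (D j - D i))); last by ring.
    by rewrite ler_piMl.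
  have ui : `|y i - y' i| <= S by apply: uS; nat_lia.
  have G2 : `|G (y i) (ZZ i j) - G (y' i) (ZZ i j)| <= L * S * q i j ^+ 2.
    apply: le_trans (rf_Glip fX _ _ _) _.
    rewrite ler_pM ?mulr_ge0 ?ler_wpM2l//.
    exact: (rg_ZZ gZ).
  have X2 : `|X (y i) (Z i j) - X (y' i) (Z i j)| <= L * S * q i j.
    apply: le_trans (rf_Xlip fX _ _ _) _.
    rewrite ler_pM ?mulr_ge0 ?ler_wpM2l//.
    exact: (rg_Z gZ).
  have rE : rem1 X Z y i j - rem1 X Z y' i j =
      a2 i j + ((B j - B i) - (B' j - B' i)) + (G (y i) (ZZ i j) - G (y' i) (ZZ i j)).
    by rewrite /a2 /rem2; rv_ring.
  have r2 : `|rem1 X Z y i j - rem1 X Z y' i j| <=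
      2 * (D j - D i) + (L + 1) * S * q i j ^+ 2.
    rewrite rE.
    have := ler_normD (a2 i j + ((B j - B i) - (B' j - B' i)))
      (G (y i) (ZZ i j) - G (y' i) (ZZ i j)).
    have := ler_normD (a2 i j) ((B j - B i) - (B' j - B' i)).
    lra.
  split => //.
  have SqSq : S * q i j ^+ 2 <= S * q i j by rewrite ler_wpM2l// expr2 ler_piMl.
  have LSq : L * (S * q i j ^+ 2) <= L * (S * q i j) by rewrite ler_wpM2l.
  have -> : (y j - y' j) - (y i - y' i) = (rem1 X Z y i j - rem1 X Z y' i j) +
      (X (y i) (Z i j) - X (y' i) (Z i j)) by rewrite /rem1; rv_ring.
  have := ler_normD (rem1 X Z y i j - rem1 X Z y' i j) (X (y i) (Z i j) - X (y' i) (Z i j)).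
  lra.
pose A i j := if (i <= b)%N && (a <= i)%N then a2 i j else 0.
pose E i j := S * q i j ^+ 3 + (D j - D i) * q i j.
suff main i j : (a <= i <= j)%N -> (j <= b)%N -> `|A i j| <= K * E i j.
  move=> i j ij jb; have := main i j ij jb; rewrite /A ifT; last by nat_lia.
  by move=> A3; have [] := bounds i j ij jb A3.
have E0 i' j' : (a <= i' <= j')%N -> (j' <= b)%N -> 0 <= E i' j'.
  move=> h h'; rewrite /E addr_ge0// mulr_ge0// ?exprn_ge0//.
  by apply: D0; nat_lia.
apply: (discrete_sewing (E := E) (a := a) (b := b) cd0 kappa0 K0) => //.
- by rewrite /K [X in _ <= X]mulrC divfK// gt_eqF.
- move=> k; rewrite /A; case: ifP => // hk.
  by rewrite /a2 (rem2_diag y B fX gZ) ?(rem2_diag y' B' fX gZ) ?subrr//; nat_lia.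
- move=> l lb; rewrite /A; case: ifP => // hk.
  by rewrite /a2 (es_step ey) ?(es_step ey') ?subrr//; nat_lia.
- move=> i' k' j' h h'; rewrite /E.
  have hD : D j' - D k' <= D j' - D i'.
    by have := D0 i' k' ltac:(nat_lia); lra.
  have hq : q k' j' <= q i' j' by apply: qle; nat_lia.
  have hD0 : 0 <= D j' - D k' by apply: D0; nat_lia.
  by apply: lerD; [rewrite ler_wpM2l// lerXn2r ?nnegrE|rewrite ler_pM].
- move=> i' j' h h'.
  have phij : phi i' <= phi j' by apply: phi_le; nat_lia.
  have [k kk [hk1 hk2]] := grid_mid (proj2 (andP h)) phij.
  exists k => //.
  have h1 : q i' k <= lam * q i' j' by apply: half => //; rewrite subr_ge0 phi_le//; nat_lia.
  have h2 : q k.+1 j' <= lam * q i' j' by apply: half => //; rewrite subr_ge0 phi_le//; nat_lia.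
  have h3 : q i' k ^+ 3 <= (lam * q i' j') ^+ 3 by rewrite lerXn2r ?nnegrE// mulr_ge0.
  have h4 : q k.+1 j' ^+ 3 <= (lam * q i' j') ^+ 3 by rewrite lerXn2r ?nnegrE// mulr_ge0.
  have h5 : (2 * lam ^+ 3) * (S * q i' j' ^+ 3) <= kappa * (S * q i' j' ^+ 3).
    by rewrite ler_wpM2r// mulr_ge0// exprn_ge0.
  have h6 : S * (q i' k ^+ 3 + q k.+1 j' ^+ 3) <= S * (2 * (lam * q i' j') ^+ 3).
    by rewrite ler_wpM2l//; lra.
  have hD1 : 0 <= D k - D i' by apply: D0; nat_lia.
  have hD2 : 0 <= D j' - D k.+1 by apply: D0; nat_lia.
  have hD3 : 0 <= D k.+1 - D k by apply: D0; nat_lia.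
  have h7 : (D k - D i') * q i' k <= (D k - D i') * (lam * q i' j') by rewrite ler_wpM2l.
  have h8 : (D j' - D k.+1) * q k.+1 j' <= (D j' - D k.+1) * (lam * q i' j').
    by rewrite ler_wpM2l.
  have h9 : (D j' - D i' - (D k.+1 - D k)) * (lam * q i' j') <= (D j' - D i') * (lam * q i' j').
    by rewrite ler_wpM2r ?mulr_ge0// gerBl.
  have h10 : (D j' - D i') * (lam * q i' j') <= (D j' - D i') * (kappa * q i' j').
    by rewrite ler_wpM2l ?ler_wpM2r//; lra.
  rewrite exprMn in h6; rewrite /E; lra.
move=> i' k j' h h'; rewrite /A !ifT; [|nat_lia..] => Aik.
have ik : (a <= i' <= k)%N by nat_lia.
have kb : (k <= b)%N by nat_lia.
have [_ r2 y1] := ap i' k ik kb; have [_ r2' y1'] := ap' i' k ik kb.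
have [dr du] := bounds i' k ik kb Aik.
have kjn : (k <= j' <= n)%N by nat_lia.
have ikn : (i' <= k <= n)%N by nat_lia.
set Q := q i' j'; have Q0 : 0 <= Q by apply: q0.
have Q1 : Q <= 1 by apply: q1; nat_lia.
have qik : q i' k <= Q by apply: qle; nat_lia.
have qkj : q k j' <= Q by apply: qle; nat_lia.
have Zkj : `|Z k j'| <= Q by apply: le_trans qkj; apply: (rg_Z gZ).
have ZZkj : `|ZZ k j'| <= Q ^+ 2.
  by apply: le_trans (rg_ZZ gZ kjn) _; rewrite lerXn2r ?nnegrE.
have q2 : q i' k ^+ 2 <= Q ^+ 2 by rewrite lerXn2r ?nnegrE.
have y1Q : `|y k - y i'| <= c * Q by apply: le_trans y1 _; rewrite ler_wpM2l.
have y1Q' : `|y' k - y' i'| <= c * Q by apply: le_trans y1' _; rewrite ler_wpM2l.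
have rQ : `|rem1 X Z y i' k| <= c * Q ^+ 2 by apply: le_trans r2 _; rewrite ler_wpM2l.
set Dij := D j' - D i'.
have DD : D k - D i' <= Dij by rewrite /Dij lerD2r -subr_ge0; exact: D0.
have Dij0 : 0 <= Dij by apply: D0; nat_lia.
have SL0 : 0 <= (L + 1) * S by rewrite mulr_ge0// addr_ge0.
have SL0' : 0 <= (2 * L + 1) * S by rewrite mulr_ge0// addr_ge0// mulr_ge0.
have drQ : `|rem1 X Z y i' k - rem1 X Z y' i' k| <= 2 * Dij + (L + 1) * S * Q ^+ 2.
  by apply: le_trans dr _; have := ler_wpM2l SL0 q2; lra.
have duQ : `|(y k - y i') - (y' k - y' i')| <= 2 * Dij + (2 * L + 1) * S * Q.
  have -> : (y k - y i') - (y' k - y' i') = (y k - y' k) - (y i' - y' i') by rv_ring.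
  by apply: le_trans du _; have := ler_wpM2l SL0' qik; lra.
have uiS : `|y i' - y' i'| <= S by apply: uS; nat_lia.
have ukS : `|y k - y' k| <= S by apply: uS; nat_lia.
have cQ : 0 <= c * Q by rewrite mulr_ge0.
have yy : `|y k - y i'| + `|y' k - y' i'| <= 2 * (c * Q).
  by rewrite [leRHS]mulr_natl mulr2n lerD.
have uu : `|y i' - y' i'| + `|y k - y' k| <= 2 * S.
  by rewrite [leRHS]mulr_natl mulr2n lerD.
have T1 := rf_T4 fX (y i') (y k) (y' i') (y' k) (Z k j').
have T2 : L * (`|(y k - y i') - (y' k - y' i')| * (`|y k - y i'| + `|y' k - y' i'|) +
         (`|y i' - y' i'| + `|y k - y' k|) * (`|y k - y i'| + `|y' k - y' i'|) ^+ 2)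
         * `|Z k j'| <=
   L * ((2 * Dij + (2 * L + 1) * S * Q) * (2 * (c * Q)) + 2 * S * (2 * (c * Q)) ^+ 2) * Q.
  apply: ler_pM => //.
    by rewrite mulr_ge0// addr_ge0// mulr_ge0 ?addr_ge0 ?exprn_ge0// addr_ge0.
  rewrite ler_wpM2l// lerD// ler_pM// ?addr_ge0 ?exprn_ge0 ?addr_ge0//.
  by rewrite lerXn2r ?nnegrE ?addr_ge0// mulr_ge0.
have G1 := rf_G4 fX (y i') (y k) (y' i') (y' k) (ZZ k j').
have G2 : L * (`|(y k - y i') - (y' k - y' i')| +
         (`|y i' - y' i'| + `|y k - y' k|) * (`|y k - y i'| + `|y' k - y' i'|))
         * `|ZZ k j'| <=
   L * ((2 * Dij + (2 * L + 1) * S * Q) + 2 * S * (2 * (c * Q))) * Q ^+ 2.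
  apply: ler_pM => //.
    by rewrite mulr_ge0// addr_ge0// mulr_ge0// addr_ge0.
  by rewrite ler_wpM2l// lerD// ler_pM// addr_ge0.
(* The two values of [J] are compared in two stages: first the base point, then the direction, where
   additivity is used. *)
have Jdec : J (y i') (rem1 X Z y i' k) (Z k j') - J (y' i') (rem1 X Z y' i' k) (Z k j') =
  (J (y i') (rem1 X Z y i' k) (Z k j') - J (y' i') (rem1 X Z y i' k) (Z k j')) +
  J (y' i') (rem1 X Z y i' k - rem1 X Z y' i' k) (Z k j').
  have := rf_JD fX (y' i') (rem1 X Z y i' k - rem1 X Z y' i' k) (rem1 X Z y' i' k) (Z k j').
  by rewrite subrK => ->; rv_ring.
have J1 := rf_Jlip fX (y i') (y' i') (rem1 X Z y i' k) (Z k j').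
have J1' : L * `|y i' - y' i'| * `|rem1 X Z y i' k| * `|Z k j'| <= L * S * (c * Q ^+ 2) * Q.
  by rewrite ler_pM ?mulr_ge0// ler_pM ?mulr_ge0// ler_wpM2l.
have J2 := rf_Jb fX (y' i') (rem1 X Z y i' k - rem1 X Z y' i' k) (Z k j').
have J2' : L * `|rem1 X Z y i' k - rem1 X Z y' i' k| * `|Z k j'| <=
    L * (2 * Dij + (L + 1) * S * Q ^+ 2) * Q.
  by rewrite ler_pM ?mulr_ge0// ler_wpM2l.
have aE : a2 i' j' - a2 i' k - a2 k j' =
  (X (y k) (Z k j') - X (y i') (Z k j') - J (y i') (y k - y i') (Z k j') -
   (X (y' k) (Z k j') - X (y' i') (Z k j') - J (y' i') (y' k - y' i') (Z k j'))) +
  (J (y i') (rem1 X Z y i' k) (Z k j') - J (y' i') (rem1 X Z y' i' k) (Z k j')) +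
  (G (y k) (ZZ k j') - G (y i') (ZZ k j') - (G (y' k) (ZZ k j') - G (y' i') (ZZ k j'))).
  have e1' := @rem2_defect R d m p X G Z ZZ y B L J phi n fX gZ i' k j' ltac:(nat_lia) ltac:(nat_lia).
  have e2' := @rem2_defect R d m p X G Z ZZ y' B' L J phi n fX gZ i' k j' ltac:(nat_lia) ltac:(nat_lia).
  rewrite (_ : a2 i' j' - a2 i' k - a2 k j' =
   (rem2 X G Z ZZ y B i' j' - rem2 X G Z ZZ y B i' k - rem2 X G Z ZZ y B k j') -
   (rem2 X G Z ZZ y' B' i' j' - rem2 X G Z ZZ y' B' i' k - rem2 X G Z ZZ y' B' k j')).
    by rewrite e1' e2' shuffle'.
  by rewrite /a2 shuffle.
have Nall : `|a2 i' j' - a2 i' k - a2 k j'| <=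
   L * ((2 * Dij + (2 * L + 1) * S * Q) * (2 * (c * Q)) + 2 * S * (2 * (c * Q)) ^+ 2) * Q
   + (L * S * (c * Q ^+ 2) * Q + L * (2 * Dij + (L + 1) * S * Q ^+ 2) * Q)
   + L * ((2 * Dij + (2 * L + 1) * S * Q) + 2 * S * (2 * (c * Q))) * Q ^+ 2.
  rewrite aE; apply: le_trans (ler_normD _ _) _.
  apply: lerD (le_trans G1 G2).
  apply: le_trans (ler_normD _ _) _.
  apply: lerD (le_trans T1 T2) _.
  rewrite Jdec; apply: le_trans (ler_normD _ _) _.
  exact: lerD (le_trans J1 J1') (le_trans J2 J2').
apply: le_trans Nall _; rewrite /E -/Q -/Dij.
exact: euler_difference_arith.
Qed.

End EulerDifference.

(** * Two-sided stability by chaining windows *)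

Section EulerStability.
Variables (R : realType).

Lemma grid_argmax (f : nat -> R) a b : (a <= b)%N ->
  exists2 l, (a <= l <= b)%N & forall i, (a <= i <= b)%N -> f i <= f l.
Proof.
elim: b => [|b IH] ab.
  exists 0%N; first by nat_lia.
  by move=> i /andP[_]; rewrite leqn0 => /eqP->.
have [ab'|ab'] := leqP a b; last first.
  exists b.+1; first by nat_lia.
  move=> i ib; rewrite (_ : i = b.+1)//; nat_lia.
have [l lb lmax] := IH ab'.
have [h|h] := leP (f b.+1) (f l).
  exists l; first by nat_lia.
  move=> i ib; have [->//|ne] := eqVneq i b.+1.
  by apply: lmax; nat_lia.
exists b.+1; first by nat_lia.
move=> i ib; have [->//|ne] := eqVneq i b.+1.
by apply: le_trans (ltW h); apply: lmax; nat_lia.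
Qed.

(** Induction on the number of windows, cutting at the last index [l] reached with budget [k * e].
    What is left exceeds [e] by at most the one step that overshoots, hence windows of size [2 * e].
    Both directions of the grid are carried along. *)
Lemma grid_chain (phi f D : nat -> R) n e (k : nat) :
  (forall i, 0 <= f i) ->
  (forall i j, (i <= j <= n)%N -> phi i <= phi j) ->
  (forall i j, (i <= j <= n)%N -> D i <= D j) ->
  (forall l, (l < n)%N -> phi l.+1 - phi l <= e) ->
  (forall i j, (i <= j <= n)%N -> phi j - phi i <= 2 * e ->
    f j <= 2 * f i + 4 * (D j - D i) /\ f i <= 2 * f j + 4 * (D j - D i)) ->
  0 <= e ->
  forall i j, (i <= j <= n)%N -> phi j - phi i <= k%:R * e ->
    f j <= 4 ^+ k.+1 * (f i + (D j - D i)) /\ f i <= 4 ^+ k.+1 * (f j + (D j - D i)).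
Proof.
move=> f0 phi_nd D_nd step win e0; elim: k => [|k IH] i j ijn phij.
  have [|h1 h2] := win i j ijn; first by rewrite mul0r in phij; lra.
  rewrite expr1; have := f0 i; have := f0 j; split; lra.
have c1 : 1 <= (4 : R) ^+ k.+1 by rewrite exprn_ege1//; lra.
pose P l := (i <= l <= j)%N && (phi l - phi i <= k%:R * e).
have exP : exists l, P l.
  exists i; rewrite /P subrr mulr_ge0// andbT; nat_lia.
have ubP l : P l -> (l <= j)%N by move=> /andP[/andP[_]].
case: (ex_maxnP exP ubP) => l /andP[ilj phil] lmax.
have lj2 : phi j - phi l <= 2 * e.
  have [<-|lj] := eqVneq l j; first by rewrite subrr; lra.
  have h : k%:R * e < phi l.+1 - phi i.
    rewrite ltNge; apply/negP => h.
    have : P l.+1 by rewrite /P h andbT; nat_lia.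
    by move=> /lmax; rewrite ltnn.
  have := step l ltac:(nat_lia); move: phij; rewrite -natr1 mulrDl; lra.
have [h1 h2] := IH i l ltac:(nat_lia) phil.
have [h3 h4] := win l j ltac:(nat_lia) lj2.
have Dil := D_nd i l ltac:(nat_lia); have Dlj := D_nd l j ltac:(nat_lia).
have fi := f0 i; have fj := f0 j; have fl := f0 l.
move: c1 h1 h2; rewrite [4 ^+ k.+2]exprS; set c := 4 ^+ k.+1 => c1 h1 h2.
have g1 : 0 <= (c - 1) * (D j - D l) by apply: mulr_ge0; lra.
have g2 : 0 <= c * f i by apply: mulr_ge0; lra.
have g3 : 0 <= c * (D l - D i) by apply: mulr_ge0; lra.
have g4 : c * f l <= c * (2 * f j + 4 * (D j - D l)) by apply: ler_wpM2l => //; lra.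
have g5 : 0 <= c * f j by apply: mulr_ge0; lra.
clear - h1 h2 h3 h4 g1 g2 g3 g4 g5; split; lra.
Qed.

Variables (d m : nat).
Notation V := 'rV[R]_d.
Notation W := 'rV[R]_m.
Notation M := 'M[R]_(m, m).

(** On a window where [(2 * L + 1) * hold] is at most one half, let the distance have its maximum
    [S] at index [l]. Between [l] and either end it changes by at most [S / 2] plus twice the
    increment of [D], so [S] is at most twice the distance at that end plus a multiple of that
    increment. The choice of [e] includes a division by 2, as [grid_chain] works with windows of
    size [2 * e]. *)
Lemma euler_seq_stability (p L : R) : 2 <= p -> p < 3 -> 1 <= L ->
  exists2 e : R, 0 < e &
  forall (X : V -> W -> V) J (G : V -> M -> V) phi n Z ZZ y B y' B' (D : nat -> R) k,
  rough_field L X J G -> rough_grid p phi n Z ZZ ->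
  euler_seq X G Z ZZ y B phi n -> euler_seq X G Z ZZ y' B' phi n ->
  (forall i j, (i <= j <= n)%N -> `|(B j - B i) - (B' j - B' i)| <= D j - D i) ->
  (forall l, (l < n)%N -> phi l.+1 - phi l <= e) ->
  phi n - phi 0%N <= k%:R * e ->
  forall i j, (i <= j <= n)%N ->
  `|y j - y' j| <= 4 ^+ k.+1 * (`|y i - y' i| + (D j - D i)) /\
  `|y i - y' i| <= 4 ^+ k.+1 * (`|y j - y' j| + (D j - D i)).
Proof.
move=> p2 p3 L1.
have [eps0 /andP[e0 e1] diff] := euler_seq_difference d m p2 p3 L1.
have L2 : 0 < 2 * (2 * L + 1) by lra.
pose eps := Num.min eps0 (2 * (2 * L + 1))^-1.
have epsp : 0 < eps by rewrite lt_min e0 invr_gt0.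
exists (eps `^ p / 2); first by rewrite divr_gt0// powR_gt0.
move=> X J G phi n Z ZZ y B y' B' D k fX gZ ey ey' BD step phin i j ijn.
have phi_nd a b : (a <= b <= n)%N -> phi a <= phi b by exact: (rg_phi gZ).
have D_nd a b : (a <= b <= n)%N -> D a <= D b.
  by move=> ab; rewrite -subr_ge0; apply: le_trans (BD _ _ ab).
have e20 : 0 <= eps `^ p / 2 by rewrite divr_ge0// powR_ge0.
have win a b : (a <= b <= n)%N -> phi b - phi a <= 2 * (eps `^ p / 2) ->
    `|y b - y' b| <= 2 * `|y a - y' a| + 4 * (D b - D a) /\
    `|y a - y' a| <= 2 * `|y b - y' b| + 4 * (D b - D a).
  move=> abn; rewrite mulrC divfK// => phiab.
  have p0 : 0 < p by lra.
  have pV0 : 0 <= p^-1 by rewrite invr_ge0 ltW.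
  have hab : hold p phi a b <= eps.
    rewrite /hold -[X in _ <= X](@powRr1 _ eps) ?(ltW epsp)// -(@mulfV _ p) ?gt_eqF//.
    rewrite powRrM; apply: ge0_ler_powR => //; rewrite ?nnegrE ?powR_ge0//.
    by rewrite subr_ge0 phi_nd.
  have [l lab lmax] := @grid_argmax (fun i => `|y i - y' i|) a b (proj1 (andP abn)).
  set S := `|y l - y' l| in lmax *.
  have S0 : 0 <= S by exact: normr_ge0.
  have hab0 : hold p phi a b <= eps0 by apply: le_trans hab _; rewrite ge_min lexx.
  have dab := diff X J G phi n Z ZZ y B y' B' D fX gZ ey ey' BD a b S abn hab0 lmax.
  have LS0 : 0 <= (2 * L + 1) * S by apply: mulr_ge0; lra.
  have small i' j' : (a <= i' <= j')%N -> (j' <= b)%N ->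
      (2 * L + 1) * S * hold p phi i' j' <= S / 2.
    move=> h h'.
    have hle : hold p phi i' j' <= (2 * (2 * L + 1))^-1.
      apply: (@le_trans _ _ (hold p phi a b)).
        by apply: le_hold => //; apply: phi_nd; nat_lia.
      by apply: le_trans hab _; rewrite ge_min lexx orbT.
    apply: le_trans (ler_wpM2l LS0 hle) _.
    rewrite (_ : _ * _ = S / 2)//; field.
    by rewrite gt_eqF//; lra.
  have n1 i' j' : (a <= i' <= j')%N -> (j' <= b)%N ->
     `|y j' - y' j'| <= `|y i' - y' i'| + 2 * (D j' - D i') + S / 2 /\
     `|y i' - y' i'| <= `|y j' - y' j'| + 2 * (D j' - D i') + S / 2.
    move=> h h'; have := dab i' j' h h'; have := small i' j' h h'.
    set u := y j' - y' j'; set v := y i' - y' i' => hs hd.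
    have t1 := lerB_dist u v; have t2 := lerB_dist v u; rewrite (distrC v u) in t2.
    by split; lra.
  have [a1 a2] := n1 a l ltac:(nat_lia) ltac:(nat_lia).
  have [b1 b2] := n1 l b ltac:(nat_lia) ltac:(nat_lia).
  have Dal := D_nd a l ltac:(nat_lia); have Dlb := D_nd l b ltac:(nat_lia).
  have la := lmax a ltac:(nat_lia); have lb := lmax b ltac:(nat_lia).
  rewrite -/S in a1 a2 b1 b2.
  move: a1 a2 b1 b2 Dal Dlb la lb; clear; split; lra.
apply: (@grid_chain phi (fun i => `|y i - y' i|) D n _ k _ phi_nd D_nd step) => //.
apply: le_trans phin.
by apply: lerB; apply: phi_nd; nat_lia.
Qed.

End EulerStability.

(** * Variation of paths *)

Section Variation.
Variable R : realType.
Implicit Types (f : R -> R -> R) (s t : R) (ts : seq R).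

Definition psum f s ts : R := \sum_(ab <- zip (s :: ts) ts) f ab.1 ab.2.

Lemma psum_nil f s : psum f s [::] = 0.
Proof. by rewrite /psum big_nil. Qed.

Lemma psum_cons f s t ts : psum f s (t :: ts) = f s t + psum f t ts.
Proof. by rewrite /psum big_cons. Qed.

Lemma psum_cat f s ts us : psum f s (ts ++ us) = psum f s ts + psum f (last s ts) us.
Proof.
elim: ts s => [|t ts IH] s; first by rewrite psum_nil add0r.
by rewrite /= !psum_cons IH addrA.
Qed.

Lemma psum_ge0 f s ts : (forall a b, 0 <= f a b) -> 0 <= psum f s ts.
Proof. by move=> f0; apply: sumr_ge0. Qed.

Lemma is_partition_le s t ts : is_partition s t ts -> s <= t.
Proof.
move=> [+ <-]; elim: ts s => [|x ts IH] s //= /andP[sx /IH]; exact: le_trans (ltW sx).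
Qed.

Lemma is_partition_diag s ts : is_partition s s ts -> ts = [::].
Proof.
case: ts => // x ts [/= /andP[sx xts] lx].
by have := is_partition_le (conj xts lx); rewrite leNgt sx.
Qed.

Lemma is_partition_cat s u t ts us : is_partition s u ts -> is_partition u t us ->
  is_partition s t (ts ++ us).
Proof.
by move=> [sts lts] [pus lus]; split; rewrite ?last_cat ?cat_path lts// sts.
Qed.

Lemma is_partition1 s t : s < t -> is_partition s t [:: t].
Proof. by move=> st; split => //=; rewrite st. Qed.

Lemma exists_partition s t : s <= t -> exists ts, is_partition s t ts.
Proof.
rewrite le_eqVlt => /predU1P[->|st]; first by exists [::]; split.
by exists [:: t]; apply: is_partition1.
Qed.

(** No final root is taken: for [f] the power [q] of a norm this is the [q]-variation to the power
    [q], which is superadditive and hence a control. *)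
Definition varsum f s t : R := sup [set psum f s ts | ts in is_partition s t].

Section Bounded.
Variables (f : R -> R -> R) (T : R).
Hypothesis f0 : forall a b, 0 <= f a b.
Hypothesis fdiag : forall a, 0 <= a <= T -> f a a = 0.
Hypothesis fbnd : exists B, forall ts, is_partition 0 T ts -> psum f 0 ts <= B.

Lemma psum_ub s t : 0 <= s -> s <= t -> t <= T ->
  has_ubound [set psum f s ts | ts in is_partition s t].
Proof.
move=> s0 st tT; have [B fB] := fbnd; exists B => _ [ts pts <-].
have [us pus] := exists_partition s0; have [vs pvs] := exists_partition tT.
apply: le_trans (fB _ (is_partition_cat (is_partition_cat pus pts) pvs)).
have [_ lus] := pus; rewrite !psum_cat lus.
have := psum_ge0 0 us f0; have := psum_ge0 (last 0 (us ++ ts)) vs f0; lra.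
Qed.

Lemma psum_le_varsum s t ts : 0 <= s -> t <= T -> is_partition s t ts ->
  psum f s ts <= varsum f s t.
Proof.
move=> s0 tT pts; apply: ub_le_sup; last by exists ts.
by apply: psum_ub => //; exact: is_partition_le pts.
Qed.

Lemma varsum_approx s t e : 0 <= s -> s <= t -> t <= T -> 0 < e ->
  exists2 ts, is_partition s t ts & varsum f s t - e < psum f s ts.
Proof.
move=> s0 st tT e0.
have [|_ [ts pts <-] h] := @sup_adherent R [set psum f s ts | ts in is_partition s t] e e0.
  split; last exact: psum_ub.
  by have [ts pts] := exists_partition st; exists (psum f s ts), ts.
by exists ts.
Qed.

Lemma varsum_ge0 s t : 0 <= s -> s <= t -> t <= T -> 0 <= varsum f s t.
Proof.
move=> s0 st tT; have [ts pts] := exists_partition st.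
by apply: le_trans (psum_ge0 s ts f0) (psum_le_varsum s0 tT pts).
Qed.

Lemma varsum_add s u t : 0 <= s -> s <= u -> u <= t -> t <= T ->
  varsum f s u + varsum f u t <= varsum f s t.
Proof.
move=> s0 su ut tT; apply/ler_addgt0Pr => e e0.
have e2 : 0 < e / 2 by rewrite divr_gt0.
have [ts pts h1] := varsum_approx s0 su (le_trans ut tT) e2.
have [us pus h2] := varsum_approx (le_trans s0 su) ut tT e2.
have := psum_le_varsum s0 tT (is_partition_cat pts pus).
have [_ lts] := pts; rewrite psum_cat lts.
by move=> h3; rewrite [e]splitr; lra.
Qed.

Lemma le_varsum s t : 0 <= s -> s <= t -> t <= T -> f s t <= varsum f s t.
Proof.
move=> s0; rewrite le_eqVlt => /predU1P[<- sT|st tT].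
  by rewrite fdiag ?s0// varsum_ge0.
by have := psum_le_varsum s0 tT (is_partition1 st); rewrite psum_cons psum_nil addr0.
Qed.

Lemma varsum_split s t t' e ts : 0 <= s -> t' <= T -> 0 <= e -> s <= t -> t <= t' ->
  (forall a b, s <= a -> a <= t -> t <= b -> b <= t' -> f a b <= f a t + e) ->
  is_partition s t' ts -> psum f s ts <= varsum f s t + varsum f t t' + e.
Proof.
move=> s0 t'T e0 + tt'; elim: ts s s0 => [|x ts IH] s s0 st fe pts.
  rewrite psum_nil !addr_ge0// varsum_ge0//; lra.
have [/= /andP[sx xts] lts] := pts.
have px : is_partition x t' ts by split.
have x0 : 0 <= x by lra.
rewrite psum_cons; have [xt|tx] := leP x t.
  have {}IH := IH x x0 xt (fun a b xa => fe a b (le_trans (ltW sx) xa)) px.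
  have h1 := varsum_add s0 (ltW sx) xt (le_trans tt' t'T).
  have h2 := le_varsum s0 (ltW sx) (le_trans xt (le_trans tt' t'T)).
  lra.
have xt' := is_partition_le px.
have h1 := fe s x (lexx _) st (ltW tx) xt'.
have h2 := le_varsum s0 st (le_trans tt' t'T).
have h3 := psum_le_varsum x0 t'T px.
have t0 : 0 <= t by lra.
have h4 := varsum_add t0 (ltW tx) xt' t'T.
have h5 := varsum_ge0 t0 (ltW tx) (le_trans xt' t'T).
lra.
Qed.

Hypothesis fcont : forall e, 0 < e -> exists2 del, 0 < del &
  forall s t s' t', 0 <= s -> s <= t -> t <= T -> 0 <= s' -> s' <= t' -> t' <= T ->
    `|s - s'| < del -> `|t - t'| < del -> `|f s t - f s' t'| < e.

(** In a nearly optimal partition of [[t, T]], moving the left end to [t'] alters only the first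
    term, so superadditivity forces the variation on [[t, t']] to be small. Cutting the partitions
    of [[0, t']] at [t] concludes. *)
Lemma varsum_right_continuous t e : 0 <= t -> t <= T -> 0 < e -> exists2 del, 0 < del &
  forall t', t <= t' -> t' <= T -> t' - t < del -> varsum f 0 t' <= varsum f 0 t + e.
Proof.
move=> t0; rewrite le_eqVlt => /predU1P[tT e0|tT e0].
  exists 1 => // t' tt' t'T _; rewrite (@le_anti _ _ t' t) ?tt' ?tT ?t'T// -tT; lra.
have e3 : 0 < e / 3 by lra.
have [ts pts hts] := varsum_approx t0 (ltW tT) (lexx T) e3.
case: ts pts hts => [[_ /= tT']|t1 ts pts]; first by move: tT; rewrite tT' ltxx.
have [/= /andP[tt1 t1ts] lts] := pts.
have pt1 : is_partition t1 T ts by split.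
have t1T := is_partition_le pt1.
rewrite psum_cons => hts.
have [del del0 fdel] := fcont e3.
exists (Num.min del (t1 - t)); first by rewrite lt_min del0 subr_gt0.
move=> t' tt' t'T; rewrite lt_min => /andP[d1 d2].
have t'0 : 0 <= t' by lra.
have t't1 : t' <= t1 by lra.
have ft : `|f t t1 - f t' t1| < e / 3.
  apply: fdel => //; [by lra| |by rewrite subrr normr0].
  by rewrite distrC ger0_norm ?subr_ge0.
have h1 : varsum f t t' + varsum f t' T <= varsum f t T by apply: varsum_add.
have h2 : f t' t1 + psum f t1 ts <= varsum f t' T.
  have h3 := le_varsum t'0 t't1 t1T.
  have h4 := psum_le_varsum (le_trans t0 (ltW tt1)) (lexx T) pt1.
  have h5 := varsum_add t'0 t't1 t1T (lexx T).
  lra.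
have h6 : varsum f t t' <= 2 * (e / 3).
  have := ler_norm (f t t1 - f t' t1); lra.
suff : varsum f 0 t' <= varsum f 0 t + varsum f t t' + e / 3 by lra.
apply: ge_sup; first by have [us pus] := exists_partition t'0; exists (psum f 0 us), us.
move=> _ [us pus <-]; apply: varsum_split => //; first exact: ltW.
move=> a b a0 at_ tb bt'.
have : `|f a b - f a t| < e / 3.
  apply: fdel => //; [lra|lra|lra|by rewrite subrr normr0|].
  by rewrite ger0_norm ?subr_ge0//; lra.
have := ler_norm (f a b - f a t); lra.
Qed.

(** A nearly optimal partition of [[0, t]], with its last point moved back to [t'], has nearly the
    same sum. *)
Lemma varsum_left_continuous t e : 0 <= t -> t <= T -> 0 < e -> exists2 del, 0 < del &
  forall t', 0 <= t' -> t' <= t -> t - t' < del -> varsum f 0 t <= varsum f 0 t' + e.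
Proof.
rewrite le_eqVlt => /predU1P[<- tT e0|t0 tT e0].
  by exists 1 => // t' t'0 t't _; rewrite (@le_anti _ _ t' 0) ?t'0 ?t't//; lra.
have e2 : 0 < e / 2 by lra.
have [ts pts hts] := varsum_approx (lexx 0) (ltW t0) tT e2.
case/lastP: ts pts hts => [[_ /= tT']|ts x pts]; first by move: t0; rewrite -tT' ltxx.
have [] := pts; rewrite last_rcons => + xt; rewrite xt in pts *.
rewrite rcons_path => /andP[pts' at_].
set a := last 0 ts in at_.
have pa : is_partition 0 a ts by split.
have a0 := is_partition_le pa.
rewrite -cats1 psum_cat -/a psum_cons psum_nil addr0 => hts.
have [del del0 fdel] := fcont e2.
exists (Num.min del (t - a)); first by rewrite lt_min del0 subr_gt0.
move=> t' t'0 t't; rewrite lt_min => /andP[d1 d2].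
have at' : a < t' by lra.
have ft : `|f a t - f a t'| < e / 2.
  apply: fdel => //; [exact: ltW|exact: ltW|by lra|by rewrite subrr normr0|].
  by rewrite ger0_norm ?subr_ge0.
have := psum_le_varsum (lexx 0) (le_trans t't tT) (is_partition_cat pa (is_partition1 at')).
rewrite psum_cat -/a psum_cons psum_nil addr0.
have := ler_norm (f a t - f a t'); lra.
Qed.

Lemma varsum_continuous : {within `[0, T]%classic, continuous (varsum f 0)}.
Proof.
apply: within_continuousP => t e /andP[t0 tT] e0.
have [d1 d10 h1] := varsum_right_continuous t0 tT e0.
have [d2 d20 h2] := varsum_left_continuous t0 tT e0.
exists (Num.min d1 d2); first by rewrite lt_min d10.
have nd s s' : 0 <= s -> s <= s' -> s' <= T -> varsum f 0 s <= varsum f 0 s'.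
  move=> s0 ss' s'T; have := varsum_add (lexx 0) s0 ss' s'T.
  have := varsum_ge0 s0 ss' s'T; lra.
move=> t' /andP[t'0 t'T]; rewrite lt_min => /andP[D1 D2].
have [tt'|t't] := leP t t'.
  rewrite distrC ger0_norm ?subr_ge0 ?nd//.
  rewrite distrC ger0_norm ?subr_ge0// in D1.
  by have := h1 t' tt' t'T D1; lra.
rewrite ger0_norm ?subr_ge0 ?nd// ?(ltW t't)//.
rewrite ger0_norm ?subr_ge0 ?(ltW t't)// in D2.
by have := h2 t' t'0 (ltW t't) D2; lra.
Qed.

Lemma varsum_incr s t : 0 <= s -> s <= t -> t <= T ->
  f s t <= varsum f 0 t - varsum f 0 s.
Proof.
move=> s0 st tT; have := varsum_add (lexx 0) s0 st tT.
by have := le_varsum s0 st tT; lra.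
Qed.

End Bounded.

Lemma varsum_le_qvar (E : Type) (nrm : E -> R) (q : R) (g : R -> R -> E) (T : R) :
  0 < q -> 0 <= T -> finite_qvar nrm q g 0 T ->
  varsum (fun a b => (nrm (g a b)) `^ q) 0 T <= (qvar nrm q g 0 T) `^ q.
Proof.
move=> q0 T0 [B gB].
have s0 ts : 0 <= qvar_sum nrm q g 0 ts by apply: sumr_ge0 => *; exact: powR_ge0.
have qV : 0 <= q^-1 by rewrite invr_ge0 ltW.
have ub ts : is_partition 0 T ts -> (qvar_sum nrm q g 0 ts) `^ q^-1 <= qvar nrm q g 0 T.
  move=> pts; apply: ub_le_sup; last by exists ts.
  exists (B `^ q^-1) => _ [us pus <-]; apply: ge0_ler_powR => //; rewrite ?nnegrE//.
    by apply: le_trans (s0 us) (gB _ pus).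
  exact: gB.
have [ts0 pts0] := exists_partition T0.
apply: ge_sup; first by exists (psum (fun a b => (nrm (g a b)) `^ q) 0 ts0), ts0.
move=> _ [ts pts <-].
rewrite -[leLHS]powRr1 ?psum_ge0//; last by move=> *; exact: powR_ge0.
rewrite -(@mulVf _ q) ?gt_eqF// powRrM.
apply: ge0_ler_powR; rewrite ?nnegrE ?powR_ge0 ?(ltW q0)//; last exact: ub.
exact: le_trans (powR_ge0 _ _) (ub _ pts).
Qed.

End Variation.

(** * The drift along continuous trajectories *)

Section DriftIntegrals.
Variables (R : realType) (d : nat).
Notation V := 'rV[R]_d.
Notation mu := (@lebesgue_measure R).

(* The sets of space-time whose trace along the trajectory is measurable form a
   sigma-algebra containing the open sets. *)
Lemma drift_measurable (b : R -> V -> V) (y : R -> V) (T : R) (i : 'I_d) :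
  borel_meas_nonneg_time b -> {within `[0, T]%classic, continuous y} ->
  measurable_fun `[0, T]%classic (fun r => b r (y r) 0 i).
Proof.
move=> mb cy.
pose psi (r : R) : R * V := (r, y r).
pose C := [set A : set (R * V)%type | measurable (`[0, T]%classic `&` psi @^-1` A)].
have mT : measurable (`[0, T]%classic : set (measurableTypeR R)) by exact: measurable_itv.
have openC : @open (R * V)%type `<=` C.
  move=> A oA; apply: (@open_measurable_subspace R `[0, T]%classic (psi @^-1` A)) => //.
  have cpsi : {within `[0, T]%classic, continuous psi}.
    apply/subspace_continuousP => x xT.
    have cyx := (subspace_continuousP _ _).1 cy x xT.
    move=> W [[A' B'] /= [nA nB] AB]; have cB := cyx B' nB.
    apply: filterS2 nA cB => r Ar Br Dr; apply: AB; split => //=.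
    exact: Br.
  by move: A oA; apply/continuousP.
have sC : sigma_algebra setT C.
  split.
  - by rewrite /C /= preimage_set0 setI0; exact: measurable0.
  - move=> A mA; rewrite /C /= setTD preimage_setC.
    have -> : `[0, T]%classic `&` ~` (psi @^-1` A) =
        `[0, T]%classic `\` (`[0, T]%classic `&` psi @^-1` A) :> set R.
      by rewrite setDE setCI setIUr setICr set0U.
    exact: measurableD.
  - move=> A mA; rewrite /C /= preimage_bigcup setI_bigcupr.
    exact: bigcupT_measurable.
have sub : <<s @open (R * V)%type >> `<=` C by exact: smallest_sub.
apply: (measurability _ (RGenOpens.measurableE R)) => _ [_ [u [v ->] <-]].
pose O : set V := [set w | w 0 i \in `]u, v[%R].
have oO : open O.
  have -> : O = (fun w : V => w 0 i) @^-1` `]u, v[%classic by [].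
  apply: open_comp; last exact: interval_open.
  by move=> w _; exact: coord_continuous.
have := sub _ (mb O oO); rewrite /C /=.
congr (measurable _); apply/seteqP; split => r /=; rewrite !in_itv/=.
  by move=> [/andP[r0 rT] [_ h]]; split; [rewrite r0|].
by move=> [/andP[r0 rT] h]; split; [rewrite r0|split].
Qed.

Section Fixed.
Variables (b : R -> V -> V) (g : R -> R) (T : R).
Hypotheses (mb : borel_meas_nonneg_time b) (T0 : 0 <= T).
Hypothesis g0 : forall t, 0 <= t -> 0 <= g t.
Hypothesis ig : mu.-integrable `[0, T]%classic (EFin \o g).
Hypothesis bg : forall t x, 0 <= t -> enorm (b t x) <= g t.

Lemma itv_subset (s t : R) : 0 <= s -> t <= T -> `[s, t]%classic `<=` (`[0, T]%classic : set R).
Proof.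
move=> s0 tT r /=; rewrite !in_itv/= => /andP[sr rt].
by rewrite (le_trans s0 sr) (le_trans rt tT).
Qed.

Lemma g_integrable (s t : R) : 0 <= s -> t <= T ->
  mu.-integrable `[s, t]%classic (EFin \o g).
Proof.
by move=> s0 tT; apply: integrableS ig => //; exact: itv_subset.
Qed.

Lemma drift_integrable (y : R -> V) i : {within `[0, T]%classic, continuous y} ->
  mu.-integrable `[0, T]%classic (EFin \o (fun r => b r (y r) 0 i)).
Proof.
move=> cy; apply: le_integrable ig => //.
  by apply/measurable_EFinP; exact: drift_measurable.
move=> r /=; rewrite in_itv/= => /andP[r0 rT].
rewrite lee_fin [leRHS]ger0_norm ?g0//.
by apply: le_trans (norm_coord_le _ _ _) (le_trans (norm_le_enorm _) (bg _ r0)).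
Qed.

Definition gint (t : R) : R := Rintegral mu `[0, t]%classic g.

Lemma gintB (s t : R) : 0 <= s -> s <= t -> t <= T ->
  gint t - gint s = Rintegral mu `[s, t]%classic g.
Proof.
move=> s0 st tT; rewrite /gint (@Rintegral_split R g 0 s t)//; last exact: g_integrable.
by rewrite addrC addKr.
Qed.

Lemma gint_le (s t : R) : 0 <= s -> s <= t -> t <= T -> gint s <= gint t.
Proof.
move=> s0 st tT; rewrite -subr_ge0 gintB//; apply: Rintegral_ge0 => r /=.
by rewrite in_itv/= => /andP[sr _]; apply: g0; exact: le_trans sr.
Qed.

Lemma gint0 : gint 0 = 0.
Proof. by rewrite /gint set_itv1 Rintegral_set1. Qed.

Lemma gint_continuous : {within `[0, T]%classic, continuous gint}.
Proof. exact: parameterized_integral_continuous. Qed.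

Lemma vint_split (y : R -> V) (s u t : R) : {within `[0, T]%classic, continuous y} ->
  0 <= s -> s <= u -> u <= t -> t <= T ->
  vint (fun r => b r (y r)) s t = vint (fun r => b r (y r)) s u + vint (fun r => b r (y r)) u t.
Proof.
move=> cy s0 su ut tT; apply/rowP => i; rewrite !mxE.
apply: Rintegral_split => //; apply: integrableS (drift_integrable i cy) => //.
exact: itv_subset.
Qed.

Lemma vint_le (y : R -> V) (s t : R) : {within `[0, T]%classic, continuous y} ->
  0 <= s -> s <= t -> t <= T ->
  `|vint (fun r => b r (y r)) s t| <= gint t - gint s.
Proof.
move=> cy s0 st tT; apply: norm_mx_le => [|a i].
  by rewrite subr_ge0 gint_le.
rewrite (ord1 a) mxE gintB//.
have ib : mu.-integrable `[s, t]%classic (EFin \o (fun r => b r (y r) 0 i)).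
  by apply: integrableS (drift_integrable i cy) => //; exact: itv_subset.
apply: le_trans (le_normr_Rintegral _ ib) _ => //.
apply: le_Rintegral => //; [exact: integrable_norm|exact: g_integrable|].
move=> r /=; rewrite in_itv/= => /andP[sr rt].
apply: le_trans (norm_coord_le _ _ _) (le_trans (norm_le_enorm _) (bg _ _)).
exact: le_trans sr.
Qed.

Lemma vint_diff_le (h : R -> R) (y y' : R -> V) (s t K : R) :
  {within `[0, T]%classic, continuous y} -> {within `[0, T]%classic, continuous y'} ->
  (forall t x x', 0 <= t -> enorm (b t x - b t x') <= g t * h (enorm (x - x'))) ->
  0 <= s -> s <= t -> t <= T ->
  (forall r, s <= r -> r <= t -> h (enorm (y r - y' r)) <= K) ->
  `|vint (fun r => b r (y r)) s t - vint (fun r => b r (y' r)) s t| <= K * (gint t - gint s).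
Proof.
move=> cy cy' bh s0 st tT yK.
have bK i r : s <= r -> r <= t -> `|b r (y r) 0 i - b r (y' r) 0 i| <= K * g r.
  move=> sr rt; have r0 : 0 <= r by exact: le_trans sr.
  have := norm_coord_le (b r (y r) - b r (y' r)) 0 i; rewrite 2!mxE => /le_trans; apply.
  apply: le_trans (norm_le_enorm _) (le_trans (bh _ _ _ r0) _).
  by rewrite mulrC ler_wpM2r ?g0// yK.
have iKg : mu.-integrable `[s, t]%classic (EFin \o (fun r => K * g r)).
  rewrite (_ : EFin \o _ = (fun r => K%:E * (g r)%:E)%E); last first.
    by apply/funext => r; rewrite /= EFinM.
  by apply: integrableZl => //; exact: g_integrable.
have ib i z : {within `[0, T]%classic, continuous z} ->
    mu.-integrable `[s, t]%classic (EFin \o (fun r => b r (z r) 0 i)).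
  by move=> cz; apply: integrableS (drift_integrable i cz) => //; exact: itv_subset.
have Kg : Rintegral mu `[s, t]%classic (fun r => K * g r) = K * (gint t - gint s).
  by rewrite RintegralZl// ?gintB//; exact: g_integrable.
have KG0 i : `|(vint (fun r => b r (y r)) s t - vint (fun r => b r (y' r)) s t) 0 i| <=
    K * (gint t - gint s).
  rewrite !mxE -RintegralB//; [|exact: ib|exact: ib].
  have iD : mu.-integrable `[s, t]%classic (EFin \o (fun r => b r (y r) 0 i - b r (y' r) 0 i)).
    rewrite (_ : EFin \o _ = (fun r => (b r (y r) 0 i)%:E - (b r (y' r) 0 i)%:E)%E); last first.
      by apply/funext => r; rewrite /= EFinB.
    by apply: integrableB => //; exact: ib.
  rewrite -Kg; apply: le_trans (le_normr_Rintegral _ iD) _ => //.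
  apply: le_Rintegral => //; first exact: integrable_norm.
  by move=> r /=; rewrite in_itv/= => /andP[sr rt]; exact: bK.
apply: norm_mx_le => [|a i]; last by rewrite (ord1 a).
rewrite -Kg; apply: Rintegral_ge0 => r /=; rewrite in_itv/= => /andP[sr rt].
have gh := le_trans (enorm_ge0 _) (bh r (y r) (y' r) (le_trans s0 sr)).
rewrite mulrC; apply: le_trans gh _.
by rewrite ler_wpM2l ?yK// g0// (le_trans s0).
Qed.

Lemma drift_enorm_integral (y : R -> V) : {within `[0, T]%classic, continuous y} ->
  (\int[mu]_(s in `[0%R, T]%classic) (enorm (b s (y s)))%:E < +oo)%E.
Proof.
move=> cy; have /integrableP[mg gfin] := ig.
apply: le_lt_trans gfin; apply: ge0_le_integral => //.
- by move=> r _; rewrite lee_fin enorm_ge0.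
- apply/measurable_EFinP; rewrite /enorm.
  have msq i : measurable_fun `[0, T]%classic (fun r => b r (y r) 0 i ^+ 2).
    by apply: measurable_funX; exact: drift_measurable.
  have msum : measurable_fun `[0, T]%classic
      (fun r => \sum_(i < 1) \sum_(j < d) b r (y r) i j ^+ 2).
    apply: measurable_sum => i; apply: measurable_sum => j.
    by rewrite (ord1 i); exact: msq.
  have msqrt : measurable_fun setT (@Num.sqrt R).
    by apply: continuous_measurable_fun; exact: sqrt_continuous.
  exact: measurableT_comp msqrt msum.
- exact: measurableT_comp.
move=> r /=; rewrite in_itv/= => /andP[r0 rT].
by rewrite lee_fin ger0_norm ?g0// bg.
Qed.

End Fixed.
End DriftIntegrals.

(** * Osgood moduli *)

Section Osgood.
Variable R : realType.
Notation mu := (@lebesgue_measure R).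
Implicit Type h : R -> R.

Lemma osgood_gt0 h r : osgood h -> 0 < r -> 0 < h r.
Proof. by case=> _ hlt _ h0 _ r0; rewrite -h0; apply: hlt. Qed.

Lemma osgood_le h x y : osgood h -> 0 <= x -> x <= y -> h x <= h y.
Proof.
case=> _ hlt _ _ _ x0; rewrite le_eqVlt => /predU1P[->//|xy].
by apply: ltW; apply: hlt.
Qed.

Lemma osgood_ge0 h r : osgood h -> 0 <= r -> 0 <= h r.
Proof. by move=> oh r0; have [_ _ _ <- _] := oh; apply: osgood_le. Qed.

Lemma osgood_double h r r' : osgood h -> 0 <= r -> 0 <= r' -> r' <= 2 * r ->
  h r' <= 2 * h r.
Proof.
move=> oh r0 r'0 r'2; apply: le_trans (osgood_le oh r'0 r'2) _.
by have [_ _ sub _ _] := oh; rewrite !mulr_natl !mulr2n; apply: sub.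
Qed.

Lemma osgood_mulrn h r n : osgood h -> 0 <= r -> h (n%:R * r) <= n%:R * h r.
Proof.
move=> oh r0; have [_ _ sub h0 _] := oh; elim: n => [|n IH].
  by rewrite !mul0r h0.
rewrite -natr1 !mulrDl !mul1r; apply: le_trans (sub _ _ _ r0) _.
  by rewrite mulr_ge0.
by rewrite lerD2r.
Qed.

Lemma osgood_inv_integrable h a b : osgood h -> 0 < a ->
  mu.-integrable `[a, b]%classic (EFin \o (fun u => (h u)^-1)).
Proof.
move=> oh a0; have [ch _ _ _ _] := oh.
apply: continuous_compact_integrable; first exact: segment_compact.
apply/subspace_continuousP => x /= xab.
have x0 : 0 < x by move: xab; rewrite in_itv/= => /andP[+ _]; exact: lt_le_trans.
apply: cvgV; first by rewrite gt_eqF// osgood_gt0.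
have sub : `[a, b]%classic `<=` (`[0, +oo[%classic : set R).
  by move=> y /=; rewrite !in_itv/= andbT => /andP[+ _]; exact: le_trans (ltW a0).
by move/(continuous_subspaceW sub)/subspace_continuousP : ch; exact.
Qed.

Lemma GhB h a b : osgood h -> 0 < a -> a <= b ->
  Gh h b - Gh h a = Rintegral mu `[a, b]%classic (fun u => (h u)^-1).
Proof.
move=> oh a0 ab; have b0 : 0 < b by apply: lt_le_trans ab.
rewrite /Gh; have [b1|b1] := leP 1 b; have [a1|a1] := leP 1 a.
- rewrite (@Rintegral_split R _ 1 a b)//; last exact: osgood_inv_integrable.
  by rewrite addrC addKr.
- by rewrite opprK addrC (@Rintegral_split R _ a 1 b) ?(ltW a1)//; exact: osgood_inv_integrable.
- by have := le_lt_trans (le_trans a1 ab) b1; rewrite ltxx.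
- rewrite (@Rintegral_split R _ a b 1) ?(ltW b1)//; last exact: osgood_inv_integrable.
  by rewrite opprK addrC addrK.
Qed.

Lemma Rintegral_cst_itv (c a b : R) : a <= b ->
  Rintegral mu `[a, b]%classic (fun=> c) = c * (b - a).
Proof.
move=> ab; rewrite Rintegral_cst//= lebesgue_measure_itv/= lte_fin.
have [_|ba] := ltP a b; first by rewrite -EFinD.
by rewrite (@le_anti _ _ a b) ?ab ?ba// subrr.
Qed.

Lemma cst_integrable_itv (c a b : R) :
  mu.-integrable `[a, b]%classic (EFin \o (fun=> c)).
Proof.
apply: continuous_compact_integrable; first exact: segment_compact.
by move=> x; exact: cvg_cst.
Qed.

Lemma GhB_bounds h a b : osgood h -> 0 < a -> a <= b ->
  (b - a) / h b <= Gh h b - Gh h a <= (b - a) / h a.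
Proof.
move=> oh a0 ab; rewrite (GhB oh a0 ab).
have b0 : 0 < b by apply: lt_le_trans ab.
rewrite ![(b - a) / _]mulrC -!Rintegral_cst_itv//; apply/andP; split.
  apply: le_Rintegral => //; [exact: cst_integrable_itv|exact: osgood_inv_integrable|].
  move=> x /=; rewrite in_itv/= => /andP[ax xb].
  have x0 := lt_le_trans a0 ax.
  by rewrite lef_pV2 ?posrE ?osgood_gt0// osgood_le// ltW.
apply: le_Rintegral => //; [exact: osgood_inv_integrable|exact: cst_integrable_itv|].
move=> x /=; rewrite in_itv/= => /andP[ax xb].
have x0 := lt_le_trans a0 ax.
by rewrite lef_pV2 ?posrE ?osgood_gt0// osgood_le// ltW.
Qed.

Lemma Gh_lt h a b : osgood h -> 0 < a -> a < b -> Gh h a < Gh h b.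
Proof.
move=> oh a0 ab; rewrite -subr_gt0.
have /andP[+ _] := GhB_bounds oh a0 (ltW ab); apply: lt_le_trans.
by rewrite divr_gt0 ?subr_gt0// osgood_gt0// (lt_trans a0).
Qed.

Lemma Gh_le h a b : osgood h -> 0 < a -> a <= b -> Gh h a <= Gh h b.
Proof.
by move=> oh a0; rewrite le_eqVlt => /predU1P[->//|ab]; apply/ltW/Gh_lt.
Qed.

Lemma Gh_le_inj h a b : osgood h -> 0 < a -> 0 < b -> Gh h a <= Gh h b -> a <= b.
Proof.
by move=> oh a0 b0; apply: contraTT; rewrite -!ltNge => ba; apply: Gh_lt.
Qed.

(** The intervals from [1 / (n + 1)] to 1 exhaust []0, 1]]; a lower bound for [Gh] would, by
    monotone convergence, make the Osgood integral finite. *)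
Lemma Gh_unbounded_below h M : osgood h -> exists2 r : R, 0 < r & Gh h r <= M.
Proof.
move=> oh; apply: contrapT => nex.
have lb (r : R) : 0 < r -> M < Gh h r.
  by move=> r0; rewrite ltNge; apply/negP => rM; apply: nex; exists r.
have [_ _ _ _ hint] := oh.
pose F (n : nat) : set R := `[n.+1%:R^-1, 1]%classic.
have Fn0 n : 0 < n.+1%:R^-1 :> R by rewrite invr_gt0.
have UF : \bigcup_n F n = `]0%R, 1%R]%classic.
  apply/seteqP; split => x.
    move=> [n _]; rewrite /F /= !in_itv/= => /andP[nx ->]; rewrite andbT.
    exact: lt_le_trans nx.
  rewrite /= in_itv/= => /andP[x0 x1]; exists (Num.truncn x^-1) => //.
  rewrite /F /= in_itv/= x1 andbT.
  by rewrite -[leRHS]invrK lef_pV2 ?posrE ?invr_gt0// ltW// truncnS_gt.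
have nd : nondecreasing_seq F.
  move=> i j ij; rewrite subsetEset => x; rewrite /F /= !in_itv/= => /andP[ix ->].
  by rewrite andbT (le_trans _ ix)// lef_pV2 ?posrE// ler_nat ltnS.
have mf n := measurable_int mu (osgood_inv_integrable 1 oh (Fn0 n)).
have f0 n x : F n x -> (0 <= ((h x)^-1)%:E)%E.
  rewrite /F /= in_itv/= => /andP[nx _]; rewrite lee_fin invr_ge0.
  by apply: osgood_ge0 => //; apply: le_trans nx; exact: ltW.
have mF n : measurable (F n) by exact: measurable_itv.
have := @ge0_nondecreasing_set_cvg_integral _ (measurableTypeR R) R F _ mu nd mF mf f0.
rewrite UF hint => cvgoo.
have : (+oo <= (- M)%:E :> \bar R)%E.
  apply: (cvge_to_le cvgoo); apply: nearW => n.
  have /fineK <- : (\int[mu]_(x in F n) ((h x)^-1)%:E)%E \is a fin_num.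
    exact: integrable_fin_num (osgood_inv_integrable 1 oh (Fn0 n)).
  rewrite lee_fin.
  have n1 : n.+1%:R^-1 <= 1 :> R by rewrite invf_le1// ler1n.
  have := GhB oh (Fn0 n) n1.
  have -> : Gh h 1 = 0 by rewrite /Gh lexx set_itv1 Rintegral_set1.
  rewrite sub0r /Rintegral => <-.
  by rewrite lerN2; apply/ltW/lb.
by rewrite leye_eq.
Qed.

(** Subadditivity gives at most linear growth of [h], so each dyadic interval adds at least
    [1 / (2 h(1))] to [Gh]. With the divergence at 0 this makes [Gh] onto, and [Mh] finite. *)
Lemma Gh_unbounded_above h M : osgood h -> exists2 r : R, 1 <= r & M <= Gh h r.
Proof.
move=> oh; have h1 : 0 < h 1 by apply: osgood_gt0.
have G1 : Gh h 1 = 0 by rewrite /Gh lexx set_itv1 Rintegral_set1.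
have grow k : k%:R * (2 * h 1)^-1 <= Gh h (2 ^+ k).
  elim: k => [|k IH]; first by rewrite mul0r expr0 G1.
  have p0 : 0 < (2 : R) ^+ k by rewrite exprn_gt0.
  have le2 : (2 : R) ^+ k <= 2 ^+ k.+1 by rewrite exprS ler_peMl ?ler1n ?ltW.
  have /andP[lo _] := GhB_bounds oh p0 le2.
  have hk : h (2 ^+ k.+1) <= 2 ^+ k.+1 * h 1.
    by have := osgood_mulrn (2 ^ k.+1) oh ler01; rewrite mulr1 natrX.
  have : (2 * h 1)^-1 <= (2 ^+ k.+1 - 2 ^+ k) / h (2 ^+ k.+1).
    rewrite ler_pdivlMr; last by apply: osgood_gt0 => //; exact: exprn_gt0.
    rewrite mulrC ler_pdivrMr ?mulr_gt0//; apply: le_trans hk _.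
    by rewrite exprS le_eqVlt; apply/orP; left; apply/eqP; ring.
  have kS : k.+1%:R = k%:R + 1 :> R by rewrite natr1.
  by move=> inc; rewrite kS mulrDl mul1r; lra.
pose k := Num.truncn (Num.max 0 (M * (2 * h 1))).
exists (2 ^+ k.+1); first by rewrite exprn_ege1// ler1n.
apply: le_trans (grow k.+1).
rewrite ler_pdivlMr ?mulr_gt0//.
have := truncnS_gt (Num.max 0 (M * (2 * h 1))); rewrite -/k => /ltW; apply: le_trans.
by rewrite le_max lexx orbT.
Qed.

Lemma Gh_surj h v : osgood h -> exists2 r : R, 0 < r & Gh h r = v.
Proof.
move=> oh; have [a0 a00 Ga] := Gh_unbounded_below v oh.
have [b b1 Gb] := Gh_unbounded_above v oh.
pose a := Num.min a0 1.
have ap : 0 < a by rewrite lt_min a00/=.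
have Ga' : Gh h a <= v by apply: le_trans Ga; apply: Gh_le => //; rewrite ge_min lexx.
have ab : a <= b by apply: le_trans b1; rewrite ge_min lexx orbT.
have cG : {within `[a, b]%classic, continuous (Gh h)}.
  apply: within_continuousP => x e /andP[ax xb] e0.
  have ha : 0 < h a by apply: osgood_gt0.
  exists (e * h a); first by rewrite mulr_gt0.
  have lip s t : a <= s -> s <= t -> Gh h t - Gh h s <= (t - s) / h a.
    move=> as_ st; have s0 := lt_le_trans ap as_.
    have /andP[_ /le_trans] := GhB_bounds oh s0 st; apply.
    apply: ler_wpM2l; first by rewrite subr_ge0.
    by rewrite lef_pV2 ?posrE ?(osgood_gt0 oh)// (osgood_le oh)// ltW.
  move=> y /andP[ay yb] xy.
  have [lexy|ltyx] := leP x y.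
    rewrite distrC ger0_norm ?subr_ge0 ?Gh_le// ?(lt_le_trans ap)//.
    apply: le_trans (lip _ _ ax lexy) _; rewrite ler_pdivrMr// ltW//.
    by rewrite distrC in xy; apply: le_lt_trans (ler_norm _) xy.
  rewrite ger0_norm ?subr_ge0 ?Gh_le// ?(lt_le_trans ap)// ?(ltW ltyx)//.
  apply: le_trans (lip _ _ ay (ltW ltyx)) _; rewrite ler_pdivrMr// ltW//.
  by apply: le_lt_trans (ler_norm _) xy.
have vab : Num.min (Gh h a) (Gh h b) <= v <= Num.max (Gh h a) (Gh h b).
  by rewrite ge_min Ga'/= le_max Gb orbT.
have [c cab Gc] := IVT ab cG vab.
exists c => //; move: cab; rewrite in_itv/= => /andP[ac _].
exact: lt_le_trans ac.
Qed.

(** Since [Gh] is onto, the [get] in [Mh] never falls back on its default value when [a > 0]. *)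
Lemma Mh_spec h a b : osgood h -> 0 < a -> 0 < Mh h a b /\ Gh h (Mh h a b) = Gh h a + b.
Proof.
move=> oh a0; rewrite /Mh leNgt a0/=.
have [r r0 rE] := Gh_surj (Gh h a + b) oh.
by apply: (@getPex _ [set r | 0 < r /\ Gh h r = Gh h a + b]); exists r.
Qed.

Lemma Mh_ge0 h a b : osgood h -> 0 <= Mh h a b.
Proof.
move=> oh; have [a0|a0] := leP a 0; first by rewrite /Mh a0.
by have [/ltW] := Mh_spec b oh a0.
Qed.

(** The slack [eta] is what discretisation leaves behind. For [a > 0] it is removed by continuity of
    [Gh] at [a]; for [a = 0] a positive [v] is impossible, as [Gh] tends to minus infinity at 0. *)
Lemma le_Mh h v a b : osgood h -> 0 <= v -> 0 <= a ->
  (forall eta, 0 < eta -> 0 < v -> Gh h v <= Gh h (a + eta) + b) -> v <= Mh h a b.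
Proof.
move=> oh; rewrite le_eqVlt => /predU1P[<- _ _|v0]; first exact: Mh_ge0.
rewrite le_eqVlt => /predU1P[<-|a0] Gv.
  have [r r0 Gr] := Gh_unbounded_below (Gh h v - b - 1) oh.
  by have := Gv r r0 v0; rewrite add0r; lra.
have [M0 GM] := Mh_spec b oh a0.
apply: (Gh_le_inj oh) => //; rewrite GM; apply/ler_addgt0Pr => e e0.
have ha : 0 < h a by apply: osgood_gt0.
have eh : 0 < e * h a by rewrite mulr_gt0.
have := Gv _ eh v0.
have aa : a <= a + e * h a by rewrite lerDl ltW.
have /andP[_] := GhB_bounds oh a0 aa.
have -> : (a + e * h a - a) / h a = e by rewrite addrAC subrr add0r mulfK ?gt_eqF.
lra.
Qed.

(** The bound vanishes with the initial distance; this yields continuity of the flow and of its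
    inverse. *)
Lemma Mh_small h b e : osgood h -> 0 < e ->
  exists2 del : R, 0 < del & forall a, a <= del -> Mh h a b <= e.
Proof.
move=> oh e0; have [r r0 Gr] := Gh_unbounded_below (Gh h e - b) oh.
exists r => // a ar; have [a0|a0] := leP a 0; first by rewrite /Mh a0 ltW.
have [M0 GM] := Mh_spec b oh a0.
apply: (Gh_le_inj oh) => //; rewrite GM.
by have := Gh_le oh a0 ar; lra.
Qed.

(* With [W] the right-hand side of the assumed bound, [W l.+1 <= 2 * W l] by the
   smallness assumption, so that [Gh] grows by at most
   [(W l.+1 - W l) / h (W l) <= 2 * C * gam l] at each step. *)
Lemma discrete_bihari h (v gam : nat -> R) (C eta : R) n : osgood h ->
  1 <= C -> 0 < eta -> (forall l, 0 <= v l) ->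
  (forall l, (l < n)%N -> 0 <= gam l) ->
  (forall l, (l < n)%N -> C * (gam l * h (Num.max (v l) (v l.+1) + eta)) <= eta) ->
  (forall j, (j <= n)%N -> v j <= C * (v 0%N + eta +
     \sum_(0 <= l < j) gam l * h (Num.max (v l) (v l.+1) + eta))) ->
  0 < v n ->
  Gh h (v n) <= Gh h (C * v 0%N + (C + 1) * eta) + 2 * C * \sum_(0 <= l < n) gam l.
Proof.
move=> oh C1 eta0 v0 gam0 small vW vn.
pose d l := gam l * h (Num.max (v l) (v l.+1) + eta).
pose W j := C * (v 0%N + eta + \sum_(0 <= l < j) d l) + eta.
have mx0 l : 0 <= Num.max (v l) (v l.+1) by rewrite le_max v0.
have C0 : 0 < C by lra.
have d0 l : (l < n)%N -> 0 <= d l.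
  move=> ln; rewrite /d mulr_ge0 ?gam0// osgood_ge0//.
  by rewrite addr_ge0// ltW.
have WS l : W l.+1 = W l + C * d l by rewrite /W big_nat_recr//=; ring.
have vWl j : (j <= n)%N -> v j + eta <= W j by move=> jn; rewrite /W lerD2r vW.
have Wpos j : (j <= n)%N -> 0 < W j.
  by move=> jn; apply: lt_le_trans (vWl j jn); rewrite ltr_wpDl.
have main j : (j <= n)%N -> Gh h (W j) <= Gh h (W 0%N) + 2 * C * \sum_(0 <= l < j) gam l.
  elim: j => [|j IH] jn; first by rewrite big_geq// mulr0 addr0.
  have IHj := IH (ltnW jn); have Wj := Wpos j (ltnW jn).
  have dj := d0 j jn; have Cd : 0 <= C * d j by rewrite mulr_ge0// ltW.
  have WW : W j <= W j.+1 by rewrite WS lerDl.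
  have hW : 0 < h (W j) by apply: osgood_gt0.
  have dbl : h (Num.max (v j) (v j.+1) + eta) <= 2 * h (W j).
    apply: osgood_double => //; [exact: ltW|by rewrite addr_ge0// ltW|].
    have a1 := vWl j (ltnW jn); have a2 := vWl j.+1 jn; rewrite WS in a2.
    have sm := small j jn; rewrite -/(d j) in sm.
    have etaW : eta <= W j by have := v0 j; lra.
    by case: (leP (v j) (v j.+1)) => _; lra.
  have /andP[_ up] := GhB_bounds oh Wj WW.
  have up2 : (W j.+1 - W j) / h (W j) <= 2 * C * gam j.
    rewrite WS addrC addKr ler_pdivrMr// /d.
    have g0 := gam0 j jn; have Cg : 0 <= C * gam j by rewrite mulr_ge0// ltW.
    by have := ler_wpM2l Cg dbl; lra.
  rewrite big_nat_recr//= mulrDr; lra.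
have Wn := main n (leqnn n).
have vnW : Gh h (v n) <= Gh h (W n).
  by apply: Gh_le => //; have := vWl n (leqnn n); lra.
apply: le_trans vnW _; apply: le_trans Wn _.
by rewrite /W big_geq// addr0 [C * _ + eta](_ : _ = C * v 0%N + (C + 1) * eta)//; ring.
Qed.

End Osgood.

(** * A continuous control for rough path and drift *)

Section RoughControl.
Variable R : realType.

Lemma enorm_continuous p q : continuous (@enorm R p q).
Proof.
have csum : continuous (fun A : 'M[R]_(p, q) => \sum_(i < p) \sum_(j < q) A i j ^+ 2).
  apply: continuous_big => [|i _]; first exact: add_continuous.
  apply: continuous_big => [|j _]; first exact: add_continuous.
  have -> : (fun A : 'M[R]_(p, q) => A i j ^+ 2) = (fun A => A i j * A i j).
    by apply/funext => A; rewrite expr2.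
  move=> A; have c := @coord_continuous R p q i j A.
  exact: (cvgM c c).
by move=> A; apply: continuous_comp; [exact: csum|exact: sqrt_continuous].
Qed.

Lemma norm_powR_continuous (q : R) : 0 < q -> continuous (fun x : R => `|x| `^ q).
Proof.
move=> q0 x; have [->|x0] := eqVneq x 0.
  apply/cvgrPdist_le => e e0; rewrite normr0 powR0 ?gt_eqF//.
  have qV : 0 < q^-1 by rewrite invr_gt0.
  have ep : 0 < e `^ q^-1 by rewrite powR_gt0.
  exists (e `^ q^-1) => // y /=; rewrite sub0r normrN => ye.
  rewrite sub0r normrN ger0_norm ?powR_ge0//.
  rewrite -[leRHS]powRr1 ?(ltW e0)// -(@mulVf _ q) ?gt_eqF// powRrM.
  by apply: ge0_ler_powR; rewrite ?nnegrE ?(ltW q0) ?powR_ge0// ltW.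
apply: (@continuous_comp _ _ _ (fun x : R => `|x|) (fun x => x `^ q)).
  exact: norm_continuous.
apply: differentiable_continuous; apply/derivable1_diffP.
by apply: derivable_powR; rewrite in_itv/= andbT normr_gt0.
Qed.

Lemma simplex_compact (T : R) : compact (simplex T).
Proof.
apply: (@subclosed_compact _ _ (`[0, T]%classic `*` `[0, T]%classic : set (R * R)%type)).
- have -> : simplex T = [set st : R * R | 0 <= st.1] `&`
      [set st : R * R | 0 <= st.2 - st.1] `&` [set st : R * R | 0 <= T - st.2].
    apply/seteqP; split => -[s t] /=; rewrite /simplex/= !subr_ge0.
      by move=> [/andP[]].
    by move=> [[-> ->] ->].
  have cl (f : R * R -> R) : continuous f -> closed [set st | 0 <= f st].
    move=> cf; have -> : [set st | 0 <= f st] = f @^-1` [set x | 0 <= x] by [].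
    by apply: closed_comp => //; exact: closed_ge.
  apply: closedI; first apply: closedI; apply: cl => st.
  - exact: cvg_fst.
  - by apply: cvgB; [exact: cvg_snd|exact: cvg_fst].
  - by apply: cvgB; [exact: cvg_cst|exact: cvg_snd].
- by apply: compact_setX; exact: segment_compact.
move=> [s t] /=; rewrite /simplex/= !in_itv/= => -[/andP[s0 st] tT].
by rewrite s0 (le_trans st tT) (le_trans s0 st).
Qed.

Lemma pow_enorm_uniform k l (g : R -> R -> 'M[R]_(k, l)) (q T : R) : 0 < q ->
  {within simplex T, continuous (fun st => g st.1 st.2)} ->
  forall e, 0 < e -> exists2 del, 0 < del &
  forall s t s' t', 0 <= s -> s <= t -> t <= T -> 0 <= s' -> s' <= t' -> t' <= T ->
    `|s - s'| < del -> `|t - t'| < del ->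
    `|(enorm (g s t)) `^ q - (enorm (g s' t')) `^ q| < e.
Proof.
move=> q0 cg e e0.
have cf : {within simplex T, continuous (fun st : R * R => (enorm (g st.1 st.2)) `^ q)}.
  apply/subspace_continuousP => st Ast.
  have c1 := (subspace_continuousP _ _).1 cg st Ast.
  have c2 := cvg_comp _ _ c1 (@enorm_continuous k l (g st.1 st.2)).
  have c3 := cvg_comp _ _ c2 (@norm_powR_continuous q q0 (enorm (g st.1 st.2))).
  move: c3; rewrite /= (ger0_norm (enorm_ge0 _)).
  apply: cvg_trans; apply: near_eq_cvg; apply: nearW => st' /=.
  by rewrite (ger0_norm (enorm_ge0 _)).
have [del del0 h] := compact_uniform_continuous (@simplex_compact T) cf e0.
exists del => // s t s' t' s0 st tT s'0 st' t'T ss' tt'.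
apply: (h (s, t) (s', t')); rewrite /simplex/= ?s0 ?st ?s'0 ?st'//.
by rewrite prod_normE/= gt_max ss' tt'.
Qed.

Lemma delta_within_continuous k (Z : R -> 'rV[R]_k) (T : R) :
  {within `[0, T]%classic, continuous Z} ->
  {within simplex T, continuous (fun st => delta Z st.1 st.2)}.
Proof.
move=> cZ; apply/subspace_continuousP => -[s t] /= [/andP[s0 st] tT].
apply/cvgrPdist_lt => e e0; have e2 : 0 < e / 2 by rewrite divr_gt0.
have [del del0 h] := itv_uniform_continuous cZ e2.
rewrite near_withinE; apply/nbhs_ballP; exists del => //= -[s' t'].
rewrite -ball_normE /= prod_normE/= gt_max => /andP[ss' tt'] [/andP[s'0 st'] t'T].
have h1 : `|Z t - Z t'| < e / 2.
  by apply: h => //; rewrite ?tT ?t'T andbT; [exact: le_trans st|exact: le_trans st'].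
have h2 : `|Z s - Z s'| < e / 2.
  by apply: h => //; rewrite ?s0 ?s'0/=; [exact: le_trans tT|exact: le_trans t'T].
have -> : delta Z s t - delta Z s' t' = (Z t - Z t') - (Z s - Z s').
  by rewrite /delta; apply/matrixP => i j; rewrite !mxE; ring.
by rewrite [e]splitr; apply: le_lt_trans (ler_normB _ _) (ltrD h1 h2).
Qed.

Variables (m : nat) (p : R).
Notation W := 'rV[R]_m.
Notation M := 'M[R]_(m, m).

Definition path_var (Z : R -> W) : R -> R :=
  varsum (fun a b => (enorm (delta Z a b)) `^ p) 0.
Definition area_var (ZZ : R -> R -> M) : R -> R :=
  varsum (fun a b => (enorm (ZZ a b)) `^ (p / 2)) 0.

Definition clock (Z : R -> W) (ZZ : R -> R -> M) (g : R -> R) (t : R) : R :=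
  path_var Z t + area_var ZZ t + gint g t.

(** An interface to [clock], so that another control with the same bounds, such as the strictly
    increasing one used for existence, can take its place. The exponent [2 / p] for areas is written
    as a square to match powers of [hold]. *)
Record control (T : R) (Z : R -> W) (ZZ : R -> R -> M) (g phi : R -> R) : Prop := Control {
  ct_le : forall s t, 0 <= s -> s <= t -> t <= T -> phi s <= phi t;
  ct_Z : forall s t, 0 <= s -> s <= t -> t <= T ->
    `|delta Z s t| <= (phi t - phi s) `^ p^-1;
  ct_ZZ : forall s t, 0 <= s -> s <= t -> t <= T ->
    `|ZZ s t| <= ((phi t - phi s) `^ p^-1) ^+ 2;
  ct_g : forall s t, 0 <= s -> s <= t -> t <= T -> gint g t - gint g s <= phi t - phi s;
  ct_cont : {within `[0, T]%classic, continuous phi} }.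

Lemma le_powR_inv (x y q : R) : 0 < q -> 0 <= x -> x `^ q <= y -> x <= y `^ q^-1.
Proof.
move=> q0 x0 xy; rewrite -[leLHS]powRr1// -(@mulfV _ q) ?gt_eqF// powRrM.
apply: ge0_ler_powR; rewrite ?nnegrE ?powR_ge0 ?invr_ge0 ?(ltW q0)//.
by apply: le_trans xy; exact: powR_ge0.
Qed.

Lemma powR_inv_le (x y q : R) : 0 < q -> 0 <= x -> 0 <= y -> x <= y `^ q -> x `^ q^-1 <= y.
Proof.
move=> q0 x0 y0 xy; rewrite -[leRHS]powRr1// -(@mulfV _ q) ?gt_eqF// powRrM.
by apply: ge0_ler_powR; rewrite ?nnegrE ?powR_ge0 ?invr_ge0 ?(ltW q0).
Qed.

(** The bound at [T] is how the norm of the rough path enters the stability constant; continuity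
    makes one-step increments small on fine grids. *)
Lemma clock_control (T : R) Z ZZ g : 2 <= p -> 0 < T -> rough_path p T Z ZZ ->
  (forall t, 0 <= t -> 0 <= g t) ->
  (@lebesgue_measure R).-integrable `[0, T]%classic (EFin \o g) ->
  control T Z ZZ g (clock Z ZZ g) /\
  clock Z ZZ g T <= (rp_norm p T Z ZZ) `^ p + (rp_norm p T Z ZZ) `^ (p / 2) + gint g T /\
  clock Z ZZ g 0 = 0.
Proof.
have N3 (u v w : R) : 0 <= u -> 0 <= v -> 0 <= w ->
      [/\ 0 <= u + v + w, v <= u + v + w & w <= u + v + w] by move=> *; split; lra.
move=> p2 T0 [cZ vZ cZZ vZZ chen] g0 ig.
have p0 : 0 < p by lra.
have p20 : 0 < p / 2 by lra.
set f1 := fun a b => (enorm (delta Z a b)) `^ p.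
set f2 := fun a b => (enorm (ZZ a b)) `^ (p / 2).
have f10 a b : 0 <= f1 a b by exact: powR_ge0.
have f20 a b : 0 <= f2 a b by exact: powR_ge0.
have d1 a : 0 <= a <= T -> f1 a a = 0.
  by move=> _; rewrite /f1 /delta subrr enorm_eq0 powR0// gt_eqF.
have d2 a : 0 <= a <= T -> f2 a a = 0.
  move=> /andP[a0 aT]; rewrite /f2.
  (* Chen's relation at three equal times forces the area to vanish on the diagonal. *)
  have := chen a a a a0 (lexx _) (lexx _) aT.
  rewrite /delta subrr trmx0 mul0mx subrr sub0r => /eqP; rewrite oppr_eq0 => /eqP ->.
  by rewrite enorm_eq0 powR0// gt_eqF.
have inc1 := varsum_incr f10 d1 vZ.
have inc2 := varsum_incr f20 d2 vZZ.
have cont1 := varsum_continuous f10 d1 vZ (pow_enorm_uniform p0 (delta_within_continuous cZ)).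
have cont2 := varsum_continuous f20 d2 vZZ (pow_enorm_uniform p20 cZZ).
have nd1 s t : 0 <= s -> s <= t -> t <= T -> path_var Z s <= path_var Z t.
  by move=> s0 st tT; rewrite -subr_ge0; apply: le_trans (f10 s t) _; exact: inc1.
have nd2 s t : 0 <= s -> s <= t -> t <= T -> area_var ZZ s <= area_var ZZ t.
  by move=> s0 st tT; rewrite -subr_ge0; apply: le_trans (f20 s t) _; exact: inc2.
have gl := gint_le g0 ig.
have z1 : path_var Z 0 = 0.
  apply/eqP; rewrite eq_le; apply/andP; split; last exact: (varsum_ge0 f10 vZ (lexx 0) (lexx 0) (ltW T0)).
  apply: ge_sup; first by exists (psum f1 0 [::]), [::].
  by move=> _ [ts /is_partition_diag -> <-]; rewrite psum_nil.
have z2 : area_var ZZ 0 = 0.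
  apply/eqP; rewrite eq_le; apply/andP; split; last exact: (varsum_ge0 f20 vZZ (lexx 0) (lexx 0) (ltW T0)).
  apply: ge_sup; first by exists (psum f2 0 [::]), [::].
  by move=> _ [ts /is_partition_diag -> <-]; rewrite psum_nil.
split; [split|split].
- move=> s t s0 st tT; rewrite /clock.
  by have := nd1 s t s0 st tT; have := nd2 s t s0 st tT; have := gl s t s0 st tT; lra.
- move=> s t s0 st tT; apply: le_trans (norm_le_enorm _) _.
  apply: le_powR_inv => //; first exact: enorm_ge0.
  apply: le_trans (inc1 s t s0 st tT) _; rewrite /clock -/(path_var Z t) -/(path_var Z s).
  by have := nd2 s t s0 st tT; have := gl s t s0 st tT; lra.
- move=> s t s0 st tT; apply: le_trans (norm_le_enorm _) _.
  rewrite -powR_mulrn ?powR_ge0// -powRrM.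
  have -> : p^-1 * 2 = (p / 2)^-1 by rewrite invf_div mulrC.
  apply: le_powR_inv => //; first exact: enorm_ge0.
  apply: le_trans (inc2 s t s0 st tT) _; rewrite /clock -/(area_var ZZ t) -/(area_var ZZ s).
  by have := nd1 s t s0 st tT; have := gl s t s0 st tT; lra.
- move=> s t s0 st tT; rewrite /clock.
  by have := nd1 s t s0 st tT; have := nd2 s t s0 st tT; lra.
- have cg := gint_continuous (ltW T0) ig.
  move=> x; apply: cvgD; last exact: cg.
  by apply: cvgD; [exact: cont1|exact: cont2].
- have q1 := varsum_le_qvar p0 (ltW T0) vZ; have q2 := varsum_le_qvar p20 (ltW T0) vZZ.
  have qv0 (E : Type) (nrm : E -> R) (q : R) (h : R -> R -> E) :
      finite_qvar nrm q h 0 T -> 0 < q -> 0 <= qvar nrm q h 0 T.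
    move=> [B hB] q0; have [ts pts] := exists_partition (ltW T0).
    have s0 us : 0 <= qvar_sum nrm q h 0 us by apply: sumr_ge0 => *; exact: powR_ge0.
    apply: le_trans (powR_ge0 (qvar_sum nrm q h 0 ts) q^-1) _.
    apply: ub_le_sup; last by exists ts.
    exists (B `^ q^-1) => _ [us pus <-]; apply: ge0_ler_powR; rewrite ?nnegrE ?invr_ge0 ?(ltW q0)//.
      by apply: le_trans (s0 us) (hB _ pus).
    exact: hB.
  have v1 := qv0 _ _ _ _ vZ p0; have v2 := qv0 _ _ _ _ vZZ p20.
  have e0 := enorm_ge0 (Z 0).
  have [n0 n1 n2] := N3 _ _ _ e0 v1 v2.
  have P1 := ge0_ler_powR (ltW p0) v1 n0 n1.
  have P2 := ge0_ler_powR (ltW p20) v2 n0 n2.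
  exact: lerD (lerD (le_trans q1 P1) (le_trans q2 P2)) (lexx _).
by rewrite /clock z1 z2 gint0 !addr0.
Qed.

End RoughControl.

(** * Stability of solutions *)

Section SolutionGrid.
Variables (R : realType) (d m : nat).
Notation V := 'rV[R]_d.

(** [N] is the room for one-step errors: adding a monotone sequence to the control weakens the
    bounds on the driver, and lets the drift carry those errors. *)
Lemma grid_rough (p T : R) Z ZZ g phi (tt N : nat -> R) n : 2 <= p ->
  @rough_path R m p T Z ZZ -> control p T Z ZZ g phi ->
  (forall i j, (i <= j <= n)%N -> 0 <= tt i /\ tt i <= tt j /\ tt j <= T) ->
  (forall i j, (i <= j <= n)%N -> N i <= N j) ->
  rough_grid p (fun l => phi (tt l) + N l) n (fun i j => delta Z (tt i) (tt j))
    (fun i j => ZZ (tt i) (tt j)).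
Proof.
move=> p2 [_ _ _ _ chen] ct tt_nd N_nd.
have p0 : 0 < p by lra.
have pV0 : 0 <= p^-1 by rewrite invr_ge0 ltW.
have hle i j : (i <= j <= n)%N ->
    (phi (tt j) - phi (tt i)) `^ p^-1 <= hold p (fun l => phi (tt l) + N l) i j.
  move=> ij; have [t0 [tij tT]] := tt_nd i j ij.
  have h1 := ct_le ct t0 tij tT; have h2 := N_nd i j ij.
  by apply: ge0_ler_powR => //; rewrite ?nnegrE; lra.
split.
- move=> i j ij; have [t0 [tij tT]] := tt_nd i j ij.
  by rewrite lerD ?N_nd// (ct_le ct).
- move=> i j ij; have [t0 [tij tT]] := tt_nd i j ij.
  by apply: le_trans (ct_Z ct t0 tij tT) _; exact: hle.
- move=> i j ij; have [t0 [tij tT]] := tt_nd i j ij.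
  apply: le_trans (ct_ZZ ct t0 tij tT) _.
  by rewrite lerXn2r ?nnegrE ?powR_ge0 ?hle.
- by move=> i k j ikj jn; rewrite /delta; rv_ring.
- move=> i k j /andP[ik kj] jn.
  have [t0 [tik _]] := tt_nd i k (introT andP (conj ik (leq_trans kj jn))).
  have [_ [tkj tT]] := tt_nd k j (introT andP (conj kj jn)).
  rewrite -(chen _ _ _ t0 tik tkj tT).
  by apply/matrixP => ? ?; rewrite !mxE; ring.
Qed.

(** The drift sequence is the integral of the drift plus all earlier one-step remainders; with it
    the Euler recursion holds identically at each step. *)
Lemma solution_euler_seq (p T : R) (xi : 'I_m -> V -> V) b Z ZZ g phi y (tt N : nat -> R) n :
  control p T Z ZZ g phi ->
  borel_meas_nonneg_time b -> 0 <= T ->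
  (forall t, 0 <= t -> 0 <= g t) ->
  (@lebesgue_measure R).-integrable `[0, T]%classic (EFin \o g) ->
  (forall t x, 0 <= t -> enorm (b t x) <= g t) ->
  {within `[0, T]%classic, continuous y} ->
  tt 0%N = 0 ->
  (forall i j, (i <= j <= n)%N -> 0 <= tt i /\ tt i <= tt j /\ tt j <= T) ->
  (forall l, (l < n)%N ->
    `|rde_remainder b xi Z ZZ y (tt l) (tt l.+1)| <= N l.+1 - N l) ->
  euler_seq (field_lin xi) (Xi xi) (fun i j => delta Z (tt i) (tt j))
    (fun i j => ZZ (tt i) (tt j)) (y \o tt)
    (fun l => vint (fun r => b r (y r)) 0 (tt l) +
       \sum_(0 <= j < l) rde_remainder b xi Z ZZ y (tt j) (tt j.+1))
    (fun l => phi (tt l) + N l) n.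
Proof.
move=> ct mb T0 g0 ig bg cy tt0 tt_nd AN.
have vB i j : (i <= j <= n)%N -> vint (fun r => b r (y r)) 0 (tt j) -
    vint (fun r => b r (y r)) 0 (tt i) = vint (fun r => b r (y r)) (tt i) (tt j).
  move=> ij; have [t0 [tij tT]] := tt_nd i j ij.
  by rewrite (@vint_split R d b g T mb g0 ig bg y 0 (tt i) (tt j))// addrC addKr.
split.
- move=> l ln; have lln : (l <= l.+1 <= n)%N by rewrite leqnSn.
  rewrite /rem2 /rem1 /= big_nat_recr//=.
  have E (v v' S A : V) : v' + (S + A) - (v + S) = (v' - v) + A by rv_ring.
  rewrite E vB//.
  rewrite /rde_remainder /field_lin /delta.
  by rv_ring.
move=> i j /andP[ij jn].
have ijn : (i <= j <= n)%N by rewrite ij.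
have [t0 [tij tT]] := tt_nd i j ijn.
rewrite (big_cat_nat (n := i))//=.
set S1 := \sum_(0 <= l < i) _; set S2 := \sum_(i <= l < j) _.
have E (v v' : V) : v' + (S1 + S2) - (v + S1) = (v' - v) + S2 by rv_ring.
rewrite E vB//.
apply: le_trans (ler_normD _ _) _.
have h1 := vint_le mb g0 ig bg cy t0 tij tT.
have h2 := ct_g ct t0 tij tT.
have h3 : `|S2| <= N j - N i.
  apply: le_trans (ler_norm_sum _ _ _) _.
  rewrite -(telescope_sumr N ij) big_seq [leRHS]big_seq.
  apply: ler_sum => l; rewrite mem_index_iota => /andP[il lj].
  by apply: AN; exact: leq_trans jn.
apply: le_trans (lerD (le_trans h1 h2) h3) _.
by rewrite opprD addrACA.
Qed.

Lemma psum_map (f : R -> R -> R) (tt : nat -> R) n :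
  psum f (tt 0%N) [seq tt l | l <- iota 1 n] = \sum_(0 <= l < n) f (tt l) (tt l.+1).
Proof.
have gen k : psum f (tt k) [seq tt l | l <- iota k.+1 n] =
    \sum_(k <= l < k + n) f (tt l) (tt l.+1).
  elim: n k => [|n IH] k; first by rewrite addn0 big_geq// psum_nil.
  by rewrite /= psum_cons IH addSnnS [RHS]big_ltn// -addSnnS leq_addr.
by rewrite gen add0n.
Qed.

Lemma grid_partition (tt : nat -> R) n : (forall l, (l < n)%N -> tt l < tt l.+1) ->
  is_partition (tt 0%N) (tt n) [seq tt l | l <- iota 1 n].
Proof.
move=> ttS.
have gen k n' : (k + n' <= n)%N -> is_partition (tt k) (tt (k + n')%N) [seq tt l | l <- iota k.+1 n'].
  elim: n' k => [|n' IH] k kn; first by rewrite addn0; split.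
  have [p1 l1] := IH k.+1 ltac:(nat_lia).
  by split => /=; [rewrite ttS ?p1//; nat_lia|rewrite l1 addSnnS].
by have := gen 0%N n (leqnn _); rewrite add0n.
Qed.

(** Each term is factored into its powers [1 - q] and [q]. With [q = p / 3 < 1], smallness of the
    individual remainders turns boundedness of their [p / 3]-variation into smallness of their
    sum. *)
Lemma sum_le_of_powsum (a : nat -> R) n (q B kappa : R) : 0 < q -> q < 1 -> 0 <= kappa ->
  (forall l, 0 <= a l) -> (forall l, (l < n)%N -> a l <= kappa) ->
  \sum_(0 <= l < n) (a l) `^ q <= B ->
  \sum_(0 <= l < n) a l <= kappa `^ (1 - q) * B.
Proof.
move=> q0 q1 k0 a0 ak aB.
apply: (@le_trans _ _ (\sum_(0 <= l < n) kappa `^ (1 - q) * (a l) `^ q)).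
  rewrite big_seq [leRHS]big_seq; apply: ler_sum => l.
  rewrite mem_index_iota => /andP[_ ln].
  have q1q : 1 - q + q == 0 = false by rewrite subrK oner_eq0.
  have aE : a l = (a l) `^ (1 - q) * (a l) `^ q by rewrite -powRD ?q1q// subrK powRr1.
  rewrite [leLHS]aE ler_wpM2r ?powR_ge0//.
  by apply: ge0_ler_powR; rewrite ?nnegrE ?subr_ge0 ?(ltW q1)// ak.
by rewrite -mulr_sumr ler_wpM2l// powR_ge0.
Qed.

End SolutionGrid.

Section SolutionEstimates.
Variables (R : realType) (d m : nat).
Notation V := 'rV[R]_d.
Notation W := 'rV[R]_m.
Notation M := 'M[R]_(m, m).

Record rde_data (p L T : R) (Z : R -> W) (ZZ : R -> R -> M) (xi : 'I_m -> V -> V)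
    (b : R -> V -> V) (g h phi : R -> R) : Prop := RdeData {
  rd_p2 : 2 <= p;
  rd_p3 : p < 3;
  rd_T : 0 < T;
  rd_path : rough_path p T Z ZZ;
  rd_control : control p T Z ZZ g phi;
  rd_field : rough_field L (field_lin xi)
    (fun (x v : V) (z : W) => \sum_k z 0 k *: 'D_v (xi k) x) (Xi xi);
  rd_borel : borel_meas_nonneg_time b;
  rd_g0 : forall t, 0 <= t -> 0 <= g t;
  rd_g : (@lebesgue_measure R).-integrable `[0, T]%classic (EFin \o g);
  rd_bg : forall t x, 0 <= t -> enorm (b t x) <= g t;
  rd_bh : forall t x x', 0 <= t -> enorm (b t x - b t x') <= g t * h (enorm (x - x'));
  rd_h : osgood h }.

(** Valid for any continuous [y]: path, area, drift integral and [y] itself are continuous, and each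
    of the four terms is kept below [kap / 4]. It supplies the uniform smallness that
    [sum_le_of_powsum] asks for. *)
Lemma remainder_small p L T Z ZZ xi b g h phi (y : R -> V) :
  rde_data p L T Z ZZ xi b g h phi -> {within `[0, T]%classic, continuous y} ->
  forall kap, 0 < kap -> exists2 del, 0 < del &
  forall s t, 0 <= s -> s <= t -> t <= T -> t - s < del ->
  `|rde_remainder b xi Z ZZ y s t| <= kap.
Proof.
move=> D cy kap kap0.
have p2 := rd_p2 D; have T0 := ltW (rd_T D); have p0 : 0 < p by lra.
have L1 := rf_ge1 (rd_field D); have L0 : 0 <= L by lra.
pose c := Num.min 1 (kap / (4 * L)).
have c0 : 0 < c by rewrite lt_min ltr01 divr_gt0// mulr_gt0//; lra.
have cp0 : 0 < c `^ p by rewrite powR_gt0.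
have k4 : 0 < kap / 4 by rewrite divr_gt0.
have [d1 d10 h1] := itv_uniform_continuous cy k4.
have [d2 d20 h2] := itv_uniform_continuous (gint_continuous T0 (rd_g D)) k4.
have [d3 d30 h3] := itv_uniform_continuous (ct_cont (rd_control D)) cp0.
exists (Num.min d1 (Num.min d2 d3)); first by rewrite !lt_min d10 d20.
move=> s t s0 st tT; rewrite !lt_min => /andP[D1 /andP[D2 D3]].
have sT : 0 <= s <= T by rewrite s0 (le_trans st).
have t0T : 0 <= t <= T by rewrite tT (le_trans s0).
have ts : `|t - s| = t - s by rewrite ger0_norm ?subr_ge0.
have {}h1 : `|y t - y s| < kap / 4 by apply: h1; rewrite ?ts.
have {}h2 : `|gint g t - gint g s| < kap / 4 by apply: h2; rewrite ?ts.
have {}h3 : `|phi t - phi s| < c `^ p by apply: h3; rewrite ?ts.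
have phist := ct_le (rd_control D) s0 st tT.
have alc : (phi t - phi s) `^ p^-1 <= c.
  rewrite -[leRHS](@powRr1 _ c) ?(ltW c0)// -(@mulfV _ p) ?gt_eqF// powRrM.
  apply: ge0_ler_powR; rewrite ?nnegrE ?invr_ge0 ?(ltW p0) ?powR_ge0 ?subr_ge0//.
  exact: le_trans (ler_norm _) (ltW h3).
have al0 : 0 <= (phi t - phi s) `^ p^-1 by exact: powR_ge0.
have al1 : (phi t - phi s) `^ p^-1 <= 1 by apply: le_trans alc _; rewrite ge_min lexx.
have Lal : L * (phi t - phi s) `^ p^-1 <= kap / 4.
  apply: le_trans (ler_wpM2l L0 alc) _.
  apply: (@le_trans _ _ (L * (kap / (4 * L)))).
    by rewrite ler_wpM2l// ge_min lexx orbT.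
  by rewrite le_eqVlt; apply/orP; left; apply/eqP; field; rewrite gt_eqF//; lra.
have hX : `|\sum_(k < m) delta Z s t 0 k *: xi k (y s)| <= kap / 4.
  apply: le_trans (rf_Xb (rd_field D) (y s) (delta Z s t)) _.
  apply: le_trans Lal; rewrite ler_wpM2l//.
  exact: (ct_Z (rd_control D)).
have hG : `|Xi xi (y s) (ZZ s t)| <= kap / 4.
  apply: le_trans (rf_Gb (rd_field D) (y s) (ZZ s t)) _.
  apply: le_trans Lal; rewrite ler_wpM2l//.
  apply: le_trans (ct_ZZ (rd_control D) s0 st tT) _.
  by rewrite expr2 ler_piMl.
have hv := vint_le (rd_borel D) (rd_g0 D) (rd_g D) (rd_bg D) cy s0 st tT.
have {}h2 := le_trans (ler_norm _) (ltW h2).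
rewrite /rde_remainder.
have n1 := ler_normB (delta y s t - vint (fun r => b r (y r)) s t -
  \sum_(k < m) (delta Z s t) 0 k *: xi k (y s)) (Xi xi (y s) (ZZ s t)).
have n2 := ler_normB (delta y s t - vint (fun r => b r (y r)) s t)
  (\sum_(k < m) (delta Z s t) 0 k *: xi k (y s)).
have n3 := ler_normB (delta y s t) (vint (fun r => b r (y r)) s t).
have {}h1 := ltW h1.
move: h1 h2 hX hG hv n1 n2 n3; rewrite -/(delta y s t).
move: `|_| `|_| `|_| `|_| `|_| `|_| `|_| => x1 x2 x3 x4 x5 x6 x7.
move: (gint g t - gint g s) => x8; clear; lra.
Qed.

Lemma remainder_grid_sum p L T Z ZZ xi b g h phi (y : R -> V) :
  rde_data p L T Z ZZ xi b g h phi -> {within `[0, T]%classic, continuous y} ->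
  finite_qvar (@enorm R 1 d) (p / 3) (rde_remainder b xi Z ZZ y) 0 T ->
  forall eta, 0 < eta -> exists2 del, 0 < del &
  forall (tt : nat -> R) n, tt 0%N = 0 -> tt n <= T ->
    (forall l, (l < n)%N -> tt l < tt l.+1 /\ tt l.+1 - tt l < del) ->
    \sum_(0 <= l < n) `|rde_remainder b xi Z ZZ y (tt l) (tt l.+1)| <= eta.
Proof.
move=> D cy fq eta eta0.
have p2 := rd_p2 D; have p3 := rd_p3 D.
have q0 : 0 < p / 3 by lra.
have q1 : p / 3 < 1 by lra.
pose f a c := (enorm (rde_remainder b xi Z ZZ y a c)) `^ (p / 3).
have f0 a c : 0 <= f a c by exact: powR_ge0.
have [B fB] : exists B, forall t, 0 <= t -> t <= T -> forall ts, is_partition 0 t ts ->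
    psum f 0 ts <= B.
  have [B fB] := fq; exists B => t t0 tT ts pts.
  have [us pus] := exists_partition tT.
  apply: le_trans (fB _ (is_partition_cat pts pus)).
  rewrite [leRHS](_ : _ = psum f 0 (ts ++ us))// psum_cat lerDl.
  exact: psum_ge0.
have B0 : 0 <= B.
  have := fB 0 (lexx _) (ltW (rd_T D)) [::]; rewrite psum_nil; apply.
  by split.
pose x := eta / (B + 1).
have B1 : 0 < B + 1 by lra.
have x0 : 0 < x by rewrite divr_gt0.
have r0 : 0 < 1 - p / 3 by lra.
(* Chosen so that its power [1 - p / 3], times the variation bound [B], stays below [eta]. *)
pose kap := x `^ (1 - p / 3)^-1.
have kap0 : 0 < kap by rewrite powR_gt0.
have [del del0 hdel] := remainder_small D cy kap0.
exists del => // tt n tt0 ttn ttS.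
have ttmono i j : (i <= j <= n)%N -> tt i <= tt j.
  move=> /andP[ij jn]; elim: j ij jn => [|j IH]; first by rewrite leqn0 => /eqP->.
  rewrite leq_eqVlt => /predU1P[->//|ij jn].
  by apply: le_trans (IH ij (ltnW jn)) (ltW (ttS j jn).1).
have tt0l l : (l <= n)%N -> 0 <= tt l by move=> ln; rewrite -tt0 ttmono.
have ttT l : (l <= n)%N -> tt l <= T.
  by move=> ln; apply: le_trans ttn; apply: ttmono; rewrite ln leqnn.
apply: (@le_trans _ _ (kap `^ (1 - p / 3) * B)).
  apply: sum_le_of_powsum => //; [exact: ltW| |].
    move=> l ln; apply: hdel; rewrite ?tt0l ?ttT ?(ltnW ln)//; have [h1 h2] := ttS l ln => //.
    exact: ltW.
  apply: (@le_trans _ _ (psum f 0 [seq tt l | l <- iota 1 n])).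
    have := psum_map f tt n; rewrite tt0 => ->; apply: ler_sum => l _; apply: ge0_ler_powR; rewrite ?nnegrE ?(ltW q0) ?enorm_ge0//.
    exact: norm_le_enorm.
  apply: (fB (tt n)) => //; first exact: tt0l.
  by rewrite -{1}tt0; apply: grid_partition => l ln; have [] := ttS l ln.
rewrite /kap -powRrM mulVf ?gt_eqF// powRr1 ?(ltW x0)// /x mulrAC ler_pdivrMr//.
by rewrite ler_wpM2l ?(ltW eta0)//; lra.
Qed.

(* The one-step remainders are absorbed into the drift of an exact Euler
   recursion; [N] accumulates their (arbitrarily small) total size. *)
Lemma solution_grid p L T Z ZZ xi b g h phi (y y' : R -> V) (x x' : V) (t e eta K : R) :
  rde_data p L T Z ZZ xi b g h phi ->
  rde_solution p T b xi Z ZZ x y -> rde_solution p T b xi Z ZZ x' y' ->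
  0 < t -> t <= T -> 0 < e -> 0 < eta -> 0 <= K ->
  exists n (tt N : nat -> R) (B B' : nat -> V),
  let v l := enorm (y (tt l) - y' (tt l)) in
  let gam l := gint g (tt l.+1) - gint g (tt l) in
  let c l := gam l * h (Num.max (v l) (v l.+1) + eta) in
  let phi' l := phi (tt l) + N l in
  let Zt i j := delta Z (tt i) (tt j) in
  let ZZt i j := ZZ (tt i) (tt j) in
  [/\ [/\ tt 0%N = 0, tt n = t, N 0%N = 0 & N n <= eta],
      rough_grid p phi' n Zt ZZt,
      euler_seq (field_lin xi) (Xi xi) Zt ZZt (y \o tt) B phi' n,
      euler_seq (field_lin xi) (Xi xi) Zt ZZt (y' \o tt) B' phi' n &
      [/\ forall l, (l < n)%N -> phi' l.+1 - phi' l <= e,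
          forall l, (l < n)%N -> 0 <= gam l,
          forall l, (l < n)%N -> K * c l <= eta,
          forall i j, (i <= j <= n)%N -> N i <= N j &
          forall i j, (i <= j <= n)%N -> `|(B j - B i) - (B' j - B' i)| <=
            \sum_(i <= l < j) c l + (N j - N i)]].
Proof.
move=> D [cy _ _ qy] [cy' _ _ qy'] t0 tT e0 eta0 K0.
have T0 := ltW (rd_T D); have oh := rd_h D.
(* Two trajectories contribute errors, in total [2 * eta1]: at most [e / 2], for the steps of the
   control, and at most [eta]. *)
pose eta1 := Num.min (e / 4) (eta / 2).
have e40 : e / 4 > 0 by rewrite divr_gt0.
have e20 : eta / 2 > 0 by rewrite divr_gt0.
have eta10 : 0 < eta1 by rewrite lt_min e40.
have eta1e : eta1 <= e / 4 by rewrite /eta1 ge_min lexx.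
have eta1h : eta1 <= eta / 2 by rewrite /eta1 ge_min lexx orbT.
have small1 : e / 2 + 2 * eta1 <= e by lra.
have small2 : 2 * eta1 <= eta by lra.
have [d1 d10 h1] := remainder_grid_sum D cy qy eta10.
have [d2 d20 h2] := remainder_grid_sum D cy' qy' eta10.
have [d3 d30 h3] := itv_uniform_continuous (ct_cont (rd_control D)) (divr_gt0 e0 (ltr0n R 2 : 0 < 2%:R)).
have cu : {within `[0, T]%classic, continuous (fun r => y r - y' r)}.
  by move=> r; apply: cvgB; [exact: cy|exact: cy'].
have cun : {within `[0, T]%classic, continuous (fun r => enorm (y r - y' r))}.
  move=> r; exact: (cvg_comp _ _ (cu r) (@enorm_continuous R 1 d (y r - y' r))).
have [d4 d40 h4] := itv_uniform_continuous cun eta0.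
have [U U0 uU] : exists2 U, 0 <= U & forall r, 0 <= r -> r <= T -> enorm (y r - y' r) <= U.
  have [c _ hc] := EVT_max T0 cun.
  exists (enorm (y c - y' c)) => [|r r0 rT]; first exact: enorm_ge0.
  by apply: hc; rewrite in_itv/= r0.
have hU : 0 <= h (U + eta) by apply: osgood_ge0 => //; rewrite addr_ge0// ltW.
pose g1 := eta / ((K + 1) * (h (U + eta) + 1)).
have K1 : 0 < K + 1 by lra.
have hU1 : 0 < h (U + eta) + 1 by lra.
have g10 : 0 < g1 by rewrite divr_gt0// mulr_gt0.
have [d5 d50 h5] := itv_uniform_continuous (gint_continuous T0 (rd_g D)) g10.
(* [d1] and [d2] serve the sums of remainders, [d3] the steps of [phi], [d4] the oscillation of the
   distance within a cell, [d5] the steps of the integral of [g]. *)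
pose del := Num.min d1 (Num.min d2 (Num.min d3 (Num.min d4 d5))).
have del0 : 0 < del by rewrite !lt_min d10 d20 d30 d40.
pose n := (Num.truncn (t / del)).+1.
have n0 : 0 < n%:R :> R by rewrite ltr0n.
have mesh : t / n%:R < del.
  by rewrite ltr_pdivrMr// mulrC -ltr_pdivrMr//; exact: truncnS_gt.
pose tt l := l%:R * (t / n%:R).
have tn0 : 0 < t / n%:R by rewrite divr_gt0.
have ttS l : tt l.+1 - tt l = t / n%:R by rewrite /tt -natr1 mulrDl mul1r addrAC subrr add0r.
have ttle i j : (i <= j)%N -> tt i <= tt j by move=> ij; rewrite ler_wpM2r ?ler_nat// ltW.
have tt0 : tt 0%N = 0 by rewrite /tt mul0r.
have ttn : tt n = t by rewrite /tt mulrC divfK// gt_eqF.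
have tt0l l : 0 <= tt l by rewrite -tt0 ttle.
have ttT l : (l <= n)%N -> tt l <= T by move=> ln; apply: le_trans tT; rewrite -ttn ttle.
have tt_nd i j : (i <= j <= n)%N -> 0 <= tt i /\ tt i <= tt j /\ tt j <= T.
  by move=> /andP[ij jn]; split; [|split; [exact: ttle|exact: ttT]].
have steps (r : R) : del <= r -> forall l, (l < n)%N -> tt l < tt l.+1 /\ tt l.+1 - tt l < r.
  move=> dr l ln; rewrite -subr_gt0 ttS; split => //; exact: lt_le_trans mesh dr.
pose A l := rde_remainder b xi Z ZZ y (tt l) (tt l.+1).
pose A' l := rde_remainder b xi Z ZZ y' (tt l) (tt l.+1).
pose N l := \sum_(0 <= j < l) (`|A j| + `|A' j|).
have NS l : N l.+1 - N l = `|A l| + `|A' l| by rewrite /N big_nat_recr//= addrAC subrr add0r.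
have NB i j : (i <= j)%N -> N j - N i = \sum_(i <= l < j) (`|A l| + `|A' l|).
  by move=> ij; rewrite /N (big_cat_nat (n := i) (p := j))//= addrAC subrr add0r.
have N_nd i j : (i <= j <= n)%N -> N i <= N j.
  move=> /andP[ij _]; rewrite -subr_ge0 NB//; apply: sumr_ge0 => l _.
  by rewrite addr_ge0.
have Nn : N n <= 2 * eta1.
  rewrite /N big_split/= mulr_natl mulr2n; apply: lerD.
    by apply: h1 => //; [rewrite ttn|apply: steps; rewrite /del ge_min lexx].
  by apply: h2 => //; [rewrite ttn|apply: steps; rewrite /del !ge_min lexx orbT].
pose B l := vint (fun r => b r (y r)) 0 (tt l) + \sum_(0 <= j < l) A j.
pose B' l := vint (fun r => b r (y' r)) 0 (tt l) + \sum_(0 <= j < l) A' j.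
exists n, tt, N, B, B'.
have N0 : N 0%N = 0 by rewrite /N big_geq.
split => /=.
- by split => //; exact: le_trans small2.
- exact: grid_rough (rd_p2 D) (rd_path D) (rd_control D) tt_nd N_nd.
- apply: (solution_euler_seq (rd_control D) (rd_borel D) T0 (rd_g0 D) (rd_g D) (rd_bg D)) => //.
  by move=> l ln; rewrite NS lerDl.
- apply: (solution_euler_seq (rd_control D) (rd_borel D) T0 (rd_g0 D) (rd_g D) (rd_bg D)) => //.
  by move=> l ln; rewrite NS lerDr.
have ttabs l : `|tt l.+1 - tt l| = tt l.+1 - tt l by rewrite ttS ger0_norm// ltW.
have inT l : (l <= n)%N -> 0 <= tt l <= T by move=> ln; rewrite tt0l ttT.
have gam0 l : (l < n)%N -> 0 <= gint g (tt l.+1) - gint g (tt l).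
  move=> ln; rewrite subr_ge0; apply: (gint_le (rd_g0 D) (rd_g D)); rewrite ?tt0l ?ttT//.
  exact: ttle.
(* Taking the larger of the two end values keeps the bound invariant under reversal of the grid,
   which the backward estimate needs. *)
have osc l r : (l < n)%N -> tt l <= r -> r <= tt l.+1 ->
    enorm (y r - y' r) <= Num.max (enorm (y (tt l) - y' (tt l))) (enorm (y (tt l.+1) - y' (tt l.+1))) + eta.
  move=> ln lr rl.
  have rT : 0 <= r <= T.
    by rewrite (le_trans (tt0l l) lr) (le_trans rl (ttT _ ln)).
  have [_ hd4] := steps d4 ltac:(by rewrite /del !ge_min lexx !orbT) l ln.
  have hd : `|enorm (y r - y' r) - enorm (y (tt l) - y' (tt l))| < eta.
    apply: h4 => //; first exact/inT/ltnW.
    by rewrite ger0_norm ?subr_ge0//; apply: le_lt_trans hd4; rewrite lerD2r.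
  apply: (@le_trans _ _ (enorm (y (tt l) - y' (tt l)) + eta)); last first.
    by rewrite lerD2r le_max lexx.
  by rewrite -lerBlDl; apply: le_trans (ler_norm _) (ltW hd).
split => //.
- move=> l ln; rewrite opprD addrACA NS.
  have [_ hd3] := steps d3 ltac:(by rewrite /del !ge_min lexx !orbT) l ln.
  have hp : `|phi (tt l.+1) - phi (tt l)| < e / 2.
    by apply: h3; rewrite ?ttabs ?inT// ltnW.
  have NN : `|A l| + `|A' l| <= 2 * eta1.
    apply: le_trans Nn; rewrite -NS.
    have := N_nd l.+1 n (introT andP (conj ln (leqnn n))).
    have := N_nd 0%N l (introT andP (conj (leq0n l) (ltnW ln))); rewrite N0 => N1 N2.
    by rewrite lerBlDr (le_trans N2)// lerDl.
  apply: le_trans small1; apply: lerD => //.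
  exact: le_trans (ler_norm _) (ltW hp).
- move=> l ln.
  have [_ hd5] := steps d5 ltac:(by rewrite /del !ge_min lexx !orbT) l ln.
  have hg : `|gint g (tt l.+1) - gint g (tt l)| < g1.
    by apply: h5; rewrite ?ttabs ?inT// ltnW.
  have hm : h (Num.max (enorm (y (tt l) - y' (tt l))) (enorm (y (tt l.+1) - y' (tt l.+1))) + eta) <= h (U + eta).
    apply: osgood_le => //; first by rewrite addr_ge0 ?(ltW eta0)// le_max enorm_ge0.
    rewrite lerD2r ge_max; apply/andP.
    by split; apply: uU; rewrite ?tt0l ?ttT// ltnW.
  have hm0 : 0 <= h (Num.max (enorm (y (tt l) - y' (tt l))) (enorm (y (tt l.+1) - y' (tt l.+1))) + eta).
    by apply: osgood_ge0 => //; rewrite addr_ge0 ?(ltW eta0)// le_max enorm_ge0.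
  have hg' := le_trans (ler_norm _) (ltW hg).
  apply: (@le_trans _ _ ((K + 1) * (g1 * (h (U + eta) + 1)))).
    apply: ler_pM => //; first by rewrite mulr_ge0// gam0.
      by rewrite lerDl.
    apply: ler_pM => //; first exact: gam0.
    by apply: le_trans hm _; rewrite lerDl.
  rewrite /g1 le_eqVlt; apply/orP; left; apply/eqP; field.
  by rewrite !gt_eqF.
move=> i j ijn; have /andP[ij jn] := ijn.
have [ti0 [tij tjT]] := tt_nd i j ijn.
have vsplit z (cz : {within `[0, T]%classic, continuous z}) a :
    (a <= n)%N -> vint (fun r => b r (z r)) 0 (tt a) =
    \sum_(0 <= l < a) vint (fun r => b r (z r)) (tt l) (tt l.+1).
  elim: a => [|a IH] an.
    rewrite big_geq// tt0; apply/rowP => q; rewrite !mxE.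
    by rewrite set_itv1 Rintegral_set1.
  rewrite big_nat_recr//= -IH 1?ltnW//.
  apply: (vint_split (rd_borel D) (rd_g0 D) (rd_g D) (rd_bg D)) => //; rewrite ?ttle ?ttT//.
have bsum (F : nat -> V) : \sum_(0 <= l < j) F l - \sum_(0 <= l < i) F l = \sum_(i <= l < j) F l.
  by rewrite (big_cat_nat (n := i) (p := j))//= addrAC subrr add0r.
have Bd z (cz : {within `[0, T]%classic, continuous z}) (F : nat -> V) :
    vint (fun r => b r (z r)) 0 (tt j) + \sum_(0 <= l < j) F l -
    (vint (fun r => b r (z r)) 0 (tt i) + \sum_(0 <= l < i) F l) =
    \sum_(i <= l < j) (vint (fun r => b r (z r)) (tt l) (tt l.+1) + F l).
  rewrite (vsplit z cz j jn) (vsplit z cz i (leq_trans ij jn)).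
  by rewrite opprD addrACA (bsum F) (bsum (fun l => vint _ (tt l) _)) big_split.
have E1 := Bd y cy A; have E2 := Bd y' cy' A'.
have sB (F F' : nat -> V) : \sum_(i <= l < j) F l - \sum_(i <= l < j) F' l =
  \sum_(i <= l < j) (F l - F' l) by rewrite sumrB.
have E := etrans (f_equal2 (fun u w : V => u - w) E1 E2) (sB _ _).
rewrite (NB _ _ ij) -big_split/=.
have leqq (r1 r2 : R) : r1 = r2 -> r1 <= r2 by move=> ->.
apply: le_trans (leqq _ _ (f_equal (fun u : V => `|u|) E)) _.
apply: le_trans (ler_norm_sum _ _ _) _.
rewrite big_seq [leRHS]big_seq; apply: ler_sum => l; rewrite mem_index_iota => /andP[il lj].
have ln : (l < n)%N by exact: leq_trans jn.
rewrite opprD addrACA.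
apply: le_trans (ler_normD _ _) _; apply: lerD; last exact: ler_normB.
rewrite mulrC.
apply: (vint_diff_le (rd_borel D) (rd_g0 D) (rd_g D) (rd_bg D) cy cy' (rd_bh D)) => //; rewrite ?ttle ?ttT//.
move=> r lr rl; apply: osgood_le => //; [exact: enorm_ge0|exact: osc].
Qed.

End SolutionEstimates.

(** * Continuous-time stability in both directions *)

Section Stability.
Variables (R : realType) (d m : nat).
Notation V := 'rV[R]_d.
Notation W := 'rV[R]_m.

(** The discrete Bihari estimate is applied to the distances along the grid, and to the same
    distances in reversed order. For the constant: [k] windows cover [Phi + 1], where the 1 is room
    for one-step errors; the factor [1 + d] converts norms; the 2 comes from [discrete_bihari]. *)
Lemma solution_stability (p L Phi : R) : 2 <= p -> p < 3 -> 1 <= L ->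
  exists2 C : R, 1 <= C & forall T (Z : R -> W) ZZ (xi : 'I_m -> V -> V) b g h phi,
  rde_data p L T Z ZZ xi b g h phi -> phi T - phi 0 <= Phi ->
  forall x x' y y', rde_solution p T b xi Z ZZ x y -> rde_solution p T b xi Z ZZ x' y' ->
  forall t, 0 <= t -> t <= T ->
  enorm (y t - y' t) <= Mh h (C * enorm (y 0 - y' 0)) (C * gint g T) /\
  enorm (y 0 - y' 0) <= Mh h (C * enorm (y t - y' t)) (C * gint g T).
Proof.
move=> p2 p3 L1.
have [e e0 stab] := euler_seq_stability d m p2 p3 L1.
pose k := (Num.truncn ((Phi + 1) / e)).+1.
have kP : Phi + 1 <= k%:R * e.
  by rewrite -ler_pdivrMr// ltW// truncnS_gt.
pose C0 : R := (1 + d%:R) * 4 ^+ k.+1.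
have k1 : 1 <= (4 : R) ^+ k.+1 by rewrite exprn_ege1// ler1n.
have d0 : 0 <= d%:R :> R by [].
have C01 : 1 <= C0.
  by rewrite -[leLHS]mulr1 /C0 ler_pM// lerDl.
have dC0 : d%:R * 4 ^+ k.+1 <= C0.
  by rewrite /C0 ler_wpM2r ?(le_trans ler01)// lerDr.
exists (2 * C0); first by lra.
move=> T Z ZZ xi b g h phi D phiT x x' y y' sy sy' t t0 tT.
have oh := rd_h D; have T0 := ltW (rd_T D).
have gT0 : 0 <= gint g T.
  by have := gint_le (rd_g0 D) (rd_g D) (lexx 0) T0 (lexx T); rewrite gint0.
have C00 : 0 <= 2 * C0 by lra.
have CgT0 : 0 <= 2 * C0 * gint g T by rewrite mulr_ge0.
have base (v : R) eta : 0 <= v -> 0 < eta -> 0 < v ->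
    Gh h v <= Gh h (2 * C0 * v + eta) + 2 * C0 * gint g T.
  move=> _ eta0 v0; apply: (@le_trans _ _ (Gh h (2 * C0 * v + eta))); last by rewrite lerDl.
  apply: Gh_le => //; apply: (@le_trans _ _ (2 * C0 * v)); last by rewrite lerDl ltW.
  by rewrite ler_peMl ?ltW//; lra.
(* The sampling grid requires [t > 0]; at [t = 0] the claim is monotonicity of [Gh]. *)
have [t_0|tn0] := eqVneq t 0.
  rewrite t_0; split; (apply: le_Mh => //; [exact: enorm_ge0|by rewrite mulr_ge0 ?enorm_ge0|]);
    by move=> eta eta0 v0; apply: base => //; exact: enorm_ge0.
have tp : 0 < t by rewrite lt_neqAle eq_sym tn0.
have C0p : 0 < C0 + 1 by lra.
have main eta : 0 < eta -> exists n (v gam : nat -> R) (eta0 : R),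
  [/\ v 0%N = enorm (y 0 - y' 0), v n = enorm (y t - y' t), forall l, 0 <= v l &
  [/\ 0 < eta0 /\ (C0 + 1) * eta0 <= eta,
      forall l, (l < n)%N -> 0 <= gam l,
      forall l, (l < n)%N -> C0 * (gam l * h (Num.max (v l) (v l.+1) + eta0)) <= eta0,
      \sum_(0 <= l < n) gam l = gint g t &
      forall i j, (i <= j <= n)%N ->
        v j <= C0 * (v i + eta0 + \sum_(i <= l < j) gam l * h (Num.max (v l) (v l.+1) + eta0)) /\
        v i <= C0 * (v j + eta0 + \sum_(i <= l < j) gam l * h (Num.max (v l) (v l.+1) + eta0))]].
  move=> eta0.
  pose eta1 := Num.min 1 (eta / (C0 + 1)).
  have eta10 : 0 < eta1 by rewrite lt_min ltr01 divr_gt0.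
  have eta11 : eta1 <= 1 by rewrite ge_min lexx.
  have eta1C : (C0 + 1) * eta1 <= eta.
    by rewrite mulrC -ler_pdivlMr// ge_min lexx orbT.
  have C0ge : 0 <= C0 by lra.
  have [n [tt [N [B [B' [[tt0 ttn N0 Nn] gZ es es' [step gam0 small N_nd BD]]]]]]] :=
    solution_grid D sy sy' tp tT e0 eta10 C0ge.
  pose v l := enorm (y (tt l) - y' (tt l)).
  pose gam l := gint g (tt l.+1) - gint g (tt l).
  pose c l := gam l * h (Num.max (v l) (v l.+1) + eta1).
  pose Dt l := \sum_(0 <= i < l) c i + N l.
  have DtB i j : (i <= j)%N -> Dt j - Dt i = \sum_(i <= l < j) c l + (N j - N i).
    move=> ij; rewrite /Dt (big_cat_nat (n := i) (p := j))//=.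
    move: (\sum_(0 <= l < i) c l) (\sum_(i <= l < j) c l) (N j) (N i); clear.
    by move=> *; ring.
  exists n, v, gam, eta1; split => //.
  - by rewrite /v tt0.
  - by rewrite /v ttn.
  - by move=> l; exact: enorm_ge0.
  split => //.
    by rewrite /gam telescope_sumr// tt0 ttn gint0 subr0.
  move=> i j ijn; have /andP[ij jn] := ijn.
  have phin : (phi (tt n) + N n) - (phi (tt 0%N) + N 0%N) <= k%:R * e.
    apply: le_trans kP; rewrite tt0 ttn N0 addr0 addrAC; apply: lerD.
      by apply: le_trans phiT; rewrite lerD2r (ct_le (rd_control D)).
    exact: le_trans Nn eta11.
  have BD' i' j' : (i' <= j' <= n)%N -> `|(B j' - B i') - (B' j' - B' i')| <= Dt j' - Dt i'.
    by move=> ij'; rewrite DtB; [exact: BD|case/andP: ij'].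
  have [s1 s2] := stab _ _ _ _ _ _ _ _ _ _ _ Dt k (rd_field D) gZ es es' BD' step phin i j ijn.
  have c0 l : (l < n)%N -> 0 <= c l.
    move=> ln; rewrite /c mulr_ge0 ?gam0//; apply: osgood_ge0 => //.
    by rewrite addr_ge0 ?(ltW eta10)// le_max enorm_ge0.
  have Nij : N j - N i <= eta1.
    apply: le_trans Nn; apply: (@le_trans _ _ (N j)).
      by rewrite gerBl -N0 N_nd//= (leq_trans ij jn).
    by rewrite N_nd// jn leqnn.
  have Dij : Dt j - Dt i <= eta1 + \sum_(i <= l < j) c l.
    by rewrite (DtB _ _ ij) addrC lerD2r.
  have Dij0 : 0 <= Dt j - Dt i by apply: le_trans (BD' i j ijn).
  have fin (u w : V) : `|u| <= 4 ^+ k.+1 * (`|w| + (Dt j - Dt i)) ->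
      enorm u <= C0 * (enorm w + eta1 + \sum_(i <= l < j) c l).
    move=> uw; apply: le_trans (enorm_le_norm u) _; rewrite mul1n.
    apply: le_trans (ler_wpM2l d0 uw) _; rewrite mulrA.
    apply: ler_pM => //; first by rewrite addr_ge0.
    apply: (@le_trans _ _ (enorm w + (Dt j - Dt i))); first by rewrite lerD2r norm_le_enorm.
    by rewrite -[leRHS]addrA lerD2l.
  by split; apply: fin.
have gt : gint g t <= gint g T by apply: (gint_le (rd_g0 D) (rd_g D)).
have finish (v0 vn eta0 eta : R) : 0 <= v0 -> 0 < eta0 -> (C0 + 1) * eta0 <= eta ->
    Gh h vn <= Gh h (C0 * v0 + (C0 + 1) * eta0) + 2 * C0 * gint g t ->
    Gh h vn <= Gh h (2 * C0 * v0 + eta) + 2 * C0 * gint g T.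
  move=> v00 eta00 eta0e /le_trans; apply; apply: lerD; last by rewrite ler_wpM2l.
  have C0ge : 0 <= C0 by lra.
  have Cv0 : 0 <= C0 * v0 by rewrite mulr_ge0.
  have e1 : 0 < (C0 + 1) * eta0 by rewrite mulr_gt0.
  apply: Gh_le => //; first by rewrite ltr_wpDl.
  by apply: lerD => //; rewrite -mulrA mulr_natl mulr2n lerDl.
split; apply: (le_Mh oh (enorm_ge0 _) (mulr_ge0 C00 (enorm_ge0 _))) => eta etap vp.
  have [n [v [gam [eta0 [v0E vnE v0 [[eta00 eta0C] gam0 small sg H]]]]]] := main eta etap.
  rewrite -v0E -vnE; apply: (finish _ _ eta0) => //; rewrite -sg.
  apply: discrete_bihari => //; last by rewrite vnE.
  by move=> j jn; have [] := H 0%N j ltac:(nat_lia).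
have [n [v [gam [eta0 [v0E vnE v0 [[eta00 eta0C] gam0 small sg H]]]]]] := main eta etap.
(* Time reversal: cell [l] of the reversed grid is cell [n - l.+1] of the original one, with its end
   values exchanged. *)
pose w l := v (n - l)%N; pose gw l := gam (n - l.+1)%N.
have w0 : w 0%N = v n by rewrite /w subn0.
have wn : w n = v 0%N by rewrite /w subnn.
rewrite -v0E -vnE -w0 -wn; apply: (finish _ _ eta0) => //; first exact: v0.
have revsum (F : nat -> R) j : (j <= n)%N ->
    \sum_(0 <= l < j) F (n - l.+1)%N = \sum_(n - j <= l < n) F l.
  move=> jn; rewrite [RHS]big_nat_rev/= [RHS](big_addn 0 n (n - j)) subKn//.
  rewrite big_seq [RHS]big_seq; apply: eq_bigr => l; rewrite mem_index_iota => /andP[_ lj].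
  by congr (F _); nat_lia.
have -> : gint g t = \sum_(0 <= l < n) gw l.
  by rewrite -sg (revsum gam)// subnn.
have wl l : (l < n)%N -> Num.max (w l) (w l.+1) = Num.max (v (n - l.+1)%N) (v (n - l.+1).+1).
  by move=> ln; rewrite /w maxC subnSK.
apply: discrete_bihari => //.
- by move=> l; exact: v0.
- by move=> l ln; apply: gam0; nat_lia.
- by move=> l ln; rewrite wl//; apply: small; nat_lia.
- move=> j jn; have [_] := H (n - j)%N n ltac:(nat_lia).
  rewrite w0; congr (_ <= C0 * (_ + _)).
  rewrite -(revsum (fun l => gam l * h (Num.max (v l) (v l.+1) + eta0)))//.
  rewrite big_seq [RHS]big_seq; apply: eq_bigr => l; rewrite mem_index_iota => /andP[_ lj].
  by rewrite wl//; exact: leq_trans jn.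
- by rewrite wn v0E.
Qed.

End Stability.

(** * Existence of solutions *)

(** Equips row vectors with completeness, which the contraction principle below requires. *)
HB.instance Definition _ (R : realType) (d : nat) := Complete.on 'rV[R]_d.

Section EulerScheme.
Variables (R : realType) (d m : nat).
Notation V := 'rV[R]_d.
Notation W := 'rV[R]_m.

Lemma lipschitz_perturbation_surj (F : V -> V) (w : V) :
  (forall x y, `|F x - F y| <= 2^-1 * `|x - y|) -> exists x, x + F x = w.
Proof.
move=> lip; pose f x := w - F x.
pose Ff : {fun [set: V] >-> [set: V]} :=
  HB.pack_for {fun [set: V] >-> [set: V]} f (isFun.Build _ _ [set: V] [set: V] f (fun x _ => I)).
have half0 : 0 <= 2^-1 :> R by [].
have ctr : is_contraction Ff.
  exists (NngNum half0); split => /=; first by rewrite invf_lt1// ltr1n.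
  move=> [x y] _ /=; rewrite /f.
  have -> : w - F x - (w - F y) = - (F x - F y) by rv_ring.
  by rewrite normrN; exact: lip.
have [x _ fx] := banach_fixed_point ctr closedT (ex_intro _ w I).
by exists x; rewrite {1}fx /= /f subrK.
Qed.

(** From index [l0] on the scheme is explicit. Before it, [Y l] must be recovered from [Y l.+1]: on
    fine grids the rough increment is a contraction in [Y l], whereas the drift need not be
    Lipschitz and is evaluated at the known value [Y l.+1]. The sequence [c] records where the drift
    is frozen. *)
Lemma euler_scheme_exists p L (Z : R -> W) ZZ xi b g h phi (s : R) (l0 : nat) (x : V) :
  (forall T, 0 < T -> rde_data p L T Z ZZ xi b g h phi) ->
  0 < s ->
  (forall l, (l < l0)%N ->
    L * (`|delta Z (l%:R * s) (l.+1%:R * s)| + `|ZZ (l%:R * s) (l.+1%:R * s)|) <= 2^-1) ->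
  exists Y c : nat -> V, Y l0 = x /\
  forall l, (c l = Y l \/ c l = Y l.+1) /\
    Y l.+1 = Y l + vint (fun r => b r (c l)) (l%:R * s) (l.+1%:R * s) +
      field_lin xi (Y l) (delta Z (l%:R * s) (l.+1%:R * s)) +
      Xi xi (Y l) (ZZ (l%:R * s) (l.+1%:R * s)).
Proof.
move=> D s0 small; have D1 := D 1 ltr01; have fX := rd_field D1.
pose t (l : nat) := l%:R * s.
pose incr l (v : V) := field_lin xi v (delta Z (t l) (t l.+1)) + Xi xi v (ZZ (t l) (t l.+1)).
pose dr l (v : V) := vint (fun r => b r v) (t l) (t l.+1).
pose fwd := fix fwd k := if k is k'.+1 then
  fwd k' + dr (l0 + k')%N (fwd k') + incr (l0 + k')%N (fwd k') else x.
have back l (w : V) : exists v, (l < l0)%N -> v + incr l v = w.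
  have [ll|] := ltnP l l0; last by move=> _; exists 0.
  have lip v v' : `|incr l v - incr l v'| <= 2^-1 * `|v - v'|.
    rewrite /incr opprD addrACA; apply: le_trans (ler_normD _ _) _.
    have h1 := rf_Xlip fX v v' (delta Z (t l) (t l.+1)).
    have h2 := rf_Glip fX v v' (ZZ (t l) (t l.+1)).
    apply: le_trans (lerD h1 h2) _.
    rewrite -mulrDr mulrAC ler_wpM2r//; exact: small.
  by have [v vE] := lipschitz_perturbation_surj w lip; exists v.
have [sol solE] := choice (fun lw : nat * V => back lw.1 lw.2).
pose bwd := fix bwd k := if k is k'.+1 then
  sol ((l0 - k'.+1)%N, bwd k' - dr (l0 - k'.+1)%N (bwd k')) else x.
pose Y l := if (l0 <= l)%N then fwd (l - l0)%N else bwd (l0 - l)%N.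
pose c l := if (l0 <= l)%N then Y l else Y l.+1.
exists Y, c; split; first by rewrite /Y leqnn subnn.
move=> l; split; first by rewrite /c; case: ifP; [left|right].
rewrite -/(t l) -/(t l.+1) /c; have [ll|ll] := leqP l0 l.
  have YlE : Y l = fwd (l - l0)%N by rewrite /Y ll.
  rewrite {1}/Y (leq_trans ll (leqnSn l)) subSn//= -YlE subnKC//.
  by rewrite /incr /dr addrA.
have lE : (l0 - (l0 - l.+1).+1)%N = l by nat_lia.
have YlE : Y l = sol (l, Y l.+1 - dr l (Y l.+1)).
  rewrite {1}/Y leqNgt ll/=; have -> : (l0 - l)%N = (l0 - l.+1).+1 by nat_lia.
  rewrite /= lE.
  have -> : bwd (l0 - l.+1)%N = Y l.+1.
    rewrite /Y; have [l0l|l0l] := leqP l0 l.+1; last by [].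
    by have -> : l.+1 = l0 by [nat_lia]; rewrite subnn.
  by [].
have := solE (l, Y l.+1 - dr l (Y l.+1)) ll; rewrite /= -YlE /incr.
move=> /eqP; rewrite eq_sym subr_eq => /eqP YE.
by rewrite {1}YE /dr; rv_ring.
Qed.

End EulerScheme.

(** * Mesh-independent bounds for the schemes *)

Section SchemeBounds.
Variables (R : realType) (d m : nat).
Notation V := 'rV[R]_d.
Notation W := 'rV[R]_m.

Definition euler_scheme (Z : R -> W) ZZ (xi : 'I_m -> V -> V) (b : R -> V -> V)
    (s : R) (Y c : nat -> V) : Prop :=
  forall l, (c l = Y l \/ c l = Y l.+1) /\
    Y l.+1 = Y l + vint (fun r => b r (c l)) (l%:R * s) (l.+1%:R * s) +
      field_lin xi (Y l) (delta Z (l%:R * s) (l.+1%:R * s)) +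
      Xi xi (Y l) (ZZ (l%:R * s) (l.+1%:R * s)).

Definition scheme_drift (b : R -> V -> V) (s : R) (c : nat -> V) (l : nat) : V :=
  \sum_(0 <= j < l) vint (fun r => b r (c j)) (j%:R * s) (j.+1%:R * s).

Lemma cst_within_continuous (T : R) (v : V) : {within `[0, T]%classic, continuous (fun=> v)}.
Proof. by move=> x; exact: cvg_cst. Qed.

Lemma scheme_grid p L T Z ZZ xi b g h phi s Y c n :
  rde_data p L T Z ZZ xi b g h phi -> 0 < s -> n%:R * s <= T ->
  euler_scheme Z ZZ xi b s Y c ->
  rough_grid p (fun l => phi (l%:R * s)) n
    (fun i j => delta Z (i%:R * s) (j%:R * s)) (fun i j => ZZ (i%:R * s) (j%:R * s)) /\
  euler_seq (field_lin xi) (Xi xi)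
    (fun i j => delta Z (i%:R * s) (j%:R * s)) (fun i j => ZZ (i%:R * s) (j%:R * s))
    Y (scheme_drift b s c) (fun l => phi (l%:R * s)) n.
Proof.
move=> D s0 nT sch.
have tt_nd i j : (i <= j <= n)%N -> 0 <= i%:R * s /\ i%:R * s <= j%:R * s /\ j%:R * s <= T.
  move=> /andP[ij jn]; split; first by rewrite mulr_ge0// ltW.
  split; first by rewrite ler_wpM2r ?ler_nat// ltW.
  by apply: le_trans nT; rewrite ler_wpM2r ?ler_nat// ltW.
have phi0 : (fun l : nat => phi (l%:R * s) + (fun=> 0 : R) l) = (fun l : nat => phi (l%:R * s)).
  by apply/funext => l; rewrite addr0.
split.
  rewrite -phi0; apply: (grid_rough (rd_p2 D) (rd_path D) (rd_control D)) => //.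
split.
  move=> l ln; have [_ YS] := sch l.
  rewrite /rem2 /rem1 YS /scheme_drift big_nat_recr//=.
  move: (\sum_(0 <= j < l) _) => S; rv_ring.
move=> i j /andP[ij jn].
have -> : scheme_drift b s c j - scheme_drift b s c i =
    \sum_(i <= l < j) vint (fun r => b r (c l)) (l%:R * s) (l.+1%:R * s).
  by rewrite /scheme_drift (big_cat_nat (n := i) (p := j))//= addrAC subrr add0r.
have [ti [tij tj]] := tt_nd i j (introT andP (conj ij jn)).
apply: le_trans (ct_g (rd_control D) ti tij tj).
apply: le_trans (ler_norm_sum _ _ _) _.
rewrite -(telescope_sumr (fun l => gint g (l%:R * s)) ij) big_seq [leRHS]big_seq.
apply: ler_sum => l; rewrite mem_index_iota => /andP[il lj].
have [tl [tll tl1]] := tt_nd l l.+1 ltac:(nat_lia).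
exact: (vint_le (rd_borel D) (rd_g0 D) (rd_g D) (rd_bg D) (@cst_within_continuous T (c l)) tl tll tl1).
Qed.

(* [eps], [c0], [K] are the constants of [euler_seq_apriori]. *)
Definition window_bounds (p eps c0 K : R) (Z : R -> W) ZZ (xi : 'I_m -> V -> V) b phi : Prop :=
  forall T s Y c, 0 < T -> 0 < s -> euler_scheme Z ZZ xi b s Y c ->
  forall i j, (i <= j)%N -> j%:R * s <= T ->
  (phi (j%:R * s) - phi (i%:R * s)) `^ p^-1 <= eps ->
  `|rem2 (field_lin xi) (Xi xi) (fun i j => delta Z (i%:R * s) (j%:R * s))
     (fun i j => ZZ (i%:R * s) (j%:R * s)) Y (scheme_drift b s c) i j| <=
    K * ((phi (j%:R * s) - phi (i%:R * s)) `^ p^-1) ^+ 3 /\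
  `|Y j - Y i| <= c0 * (phi (j%:R * s) - phi (i%:R * s)) `^ p^-1.

Lemma scheme_window (p L : R) : 2 <= p -> p < 3 -> 1 <= L ->
  exists eps c0 K : R, [/\ 0 < eps <= 1, 0 <= c0, 0 <= K &
  forall (Z : R -> W) ZZ (xi : 'I_m -> V -> V) b g h phi,
  (forall T, 0 < T -> rde_data p L T Z ZZ xi b g h phi) ->
  window_bounds p eps c0 K Z ZZ xi b phi].
Proof.
move=> p2 p3 L1.
have [eps [c0 [K [he hc hK ap]]]] := euler_seq_apriori d m p2 p3 L1.
exists eps, c0, K; split => // Z ZZ xi b g h phi D T s Y c T0 s0 sch i j ij jT hold1.
have [gZ es] := scheme_grid (D T T0) s0 jT sch.
have ijj : (i <= j <= j)%N by rewrite ij leqnn.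
have iij : (i <= i <= j)%N by rewrite leqnn.
by have [a1 _ a2] := ap _ _ _ _ _ _ _ _ _ (rd_field (D T T0)) gZ es i j ijj hold1 i j iij (leqnn j).
Qed.

(** Each window moves the scheme by at most [c0]. Adding [c0] to the distance from [Y l0] turns this
    additive growth into doubling, so that [grid_chain] applies with zero [D]; the bound depends
    neither on the mesh nor on the starting index. *)
Lemma scheme_bounded (p eps c0 K : R) Z ZZ xi b phi (e T : R) :
  2 <= p -> 0 < eps <= 1 -> 0 <= c0 -> 0 < T ->
  window_bounds p eps c0 K Z ZZ xi b phi ->
  (forall r t, 0 <= r -> r <= t -> phi r <= phi t) ->
  exists Bd : R, forall s Y c l0, 0 < s -> euler_scheme Z ZZ xi b s Y c -> l0%:R * s <= T ->
  (forall l, l.+1%:R * s <= T -> phi (l.+1%:R * s) - phi (l%:R * s) <= eps `^ p / 2) ->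
  forall l, l%:R * s <= T -> `|Y l - Y l0| <= Bd.
Proof.
move=> p2 /andP[e0 e1] hc T0 wb phi_nd.
have p0 : 0 < p by lra.
have ep0 : 0 < eps `^ p / 2 by rewrite divr_gt0// powR_gt0.
pose k := (Num.truncn ((phi T - phi 0) / (eps `^ p / 2))).+1.
have kP : phi T - phi 0 <= k%:R * (eps `^ p / 2).
  by rewrite -ler_pdivrMr// ltW// truncnS_gt.
exists (4 ^+ k.+1 * c0) => s Y c l0 s0 sch l0T step l lT.
pose n := maxn l l0.
have nT : n%:R * s <= T by rewrite /n; case: (leqP l l0).
have t0 (i : nat) : 0 <= i%:R * s by rewrite mulr_ge0// ltW.
have tle (i j : nat) : (i <= j)%N -> i%:R * s <= j%:R * s by move=> ij; rewrite ler_wpM2r ?ler_nat// ltW.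
pose f i := `|Y i - Y l0| + c0.
have f0 i : 0 <= f i by rewrite addr_ge0.
have ff : f l0 = c0 by rewrite /f subrr normr0 add0r.
have win i j : (i <= j <= n)%N -> phi (j%:R * s) - phi (i%:R * s) <= 2 * (eps `^ p / 2) ->
    f j <= 2 * f i + 4 * ((fun=> 0 : R) j - (fun=> 0 : R) i) /\
    f i <= 2 * f j + 4 * ((fun=> 0 : R) j - (fun=> 0 : R) i).
  move=> /andP[ij jn].
  have -> : 2 * (eps `^ p / 2) = eps `^ p by rewrite mulrC divfK.
  move=> phiij.
  have jT : j%:R * s <= T by apply: le_trans nT; exact: tle.
  have phi0 : 0 <= phi (j%:R * s) - phi (i%:R * s) by rewrite subr_ge0 phi_nd// tle.
  have hold1 : (phi (j%:R * s) - phi (i%:R * s)) `^ p^-1 <= eps.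
    by apply: powR_inv_le => //; exact: ltW.
  have [_ Yij] := wb T s Y c T0 s0 sch i j ij jT hold1.
  have {}Yij : `|Y j - Y i| <= c0.
    apply: le_trans Yij _; rewrite -[leRHS]mulr1 ler_wpM2l//.
    exact: le_trans hold1 e1.
  have h1 : `|Y j - Y l0| <= `|Y i - Y l0| + c0.
    by apply: le_trans (ler_distD (Y i) _ _) _; rewrite addrC lerD2l.
  have h2 : `|Y i - Y l0| <= `|Y j - Y l0| + c0.
    by apply: le_trans (ler_distD (Y j) _ _) _; rewrite addrC lerD2l distrC.
  have n1 := normr_ge0 (Y i - Y l0); have n2 := normr_ge0 (Y j - Y l0).
  rewrite /f; move: `|Y j - Y l0| `|Y i - Y l0| h1 h2 n1 n2 hc; clear; move=> *; split; lra.
have nd i j : (i <= j <= n)%N -> phi (i%:R * s) <= phi (j%:R * s).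
  by move=> /andP[ij _]; apply: phi_nd; rewrite ?t0 ?tle.
have step' i : (i < n)%N -> phi (i.+1%:R * s) - phi (i%:R * s) <= eps `^ p / 2.
  by move=> iN; apply: step; apply: le_trans nT; exact: tle.
have ijn : (minn l l0 <= maxn l l0 <= n)%N by rewrite leqnn andbT; nat_lia.
have phin : phi ((maxn l l0)%:R * s) - phi ((minn l l0)%:R * s) <= k%:R * (eps `^ p / 2).
  by apply: le_trans kP; apply: lerB; apply: phi_nd.
have := @grid_chain R (fun l => phi (l%:R * s)) f (fun=> 0) n (eps `^ p / 2) k f0 nd
  (fun _ _ _ => lexx _) step' win (ltW ep0) _ _ ijn phin.
rewrite subrr !addr0.
have [ll|ll] := leqP l l0 => -[h1 h2].
  by rewrite ff in h2; apply: le_trans h2; rewrite /f lerDl.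
by rewrite ff in h1; apply: le_trans h1; rewrite /f lerDl.
Qed.

End SchemeBounds.

(** * Limits of schemes along an ultrafilter *)

Section SchemeLimit.
Variables (R : realType) (d m : nat).
Notation V := 'rV[R]_d.
Notation W := 'rV[R]_m.

Definition cell (s t : R) : nat := Num.truncn (t / s).

Lemma cell_itv (s t : R) : 0 < s -> 0 <= t ->
  (cell s t)%:R * s <= t /\ t < (cell s t).+1%:R * s.
Proof.
move=> s0 t0; have /andP[h1 h2] := truncn_itv (divr_ge0 t0 (ltW s0)).
by rewrite -ler_pdivlMr// -ltr_pdivrMr.
Qed.

Lemma cell_le (s t t' : R) : 0 < s -> t <= t' -> (cell s t <= cell s t')%N.
Proof. by move=> s0 tt'; apply: le_truncn; rewrite ler_wpM2r// invr_ge0 ltW. Qed.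

Lemma cell_grid (s : R) l : 0 < s -> cell s (l%:R * s) = l.
Proof. by move=> s0; rewrite /cell mulfK ?gt_eqF// natrK. Qed.

(** The image of [U] is an ultrafilter on a compact ball. A single [U] gives limits at all real
    times at once, without diagonal extraction. *)
Lemma ultra_bounded_limit (U : set_system nat) (u : nat -> V) (B : R) :
  UltraFilter U -> U [set n | `|u n| <= B] ->
  exists v, forall e, 0 < e -> U [set n | `|u n - v| <= e].
Proof.
move=> ultraU uB.
have UF : ProperFilter U := ultra_proper.
pose K := [set v : V | `|v| <= B].
have cK : compact K.
  apply: bounded_closed_compact.
    by exists B; split; [exact: num_real|move=> x Bx v /= /le_trans; apply; exact: ltW].
  have -> : K = (fun v : V => `|v|) @^-1` [set x | x <= B] by [].
  by apply: closed_comp => [v _|]; [exact: norm_continuous|exact: closed_le].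
have := cK; rewrite compact_ultra => /(_ (u @ U)).
have uU : UltraFilter (u @ U).
  split; [exact: fmap_proper_filter|move=> G GF FG; apply/seteqP; split => // A GA].
  have [//|nA] := in_ultra_setVsetC (u @^-1` A) ultraU.
  have GnA : G (~` A) by exact: FG.
  by have [w [/= ? /(_ _)]] := filter_ex (filterI GA GnA).
move=> /(_ uU uB)[v [_ uv]]; exists v => e e0.
have /cvgrPdist_le /(_ e e0) : u @ U --> v by [].
by apply: filterS => n /=; rewrite distrC.
Qed.

(** Read as step functions of time, the schemes are equicontinuous up to the mesh, so their
    pointwise limit is continuous. Uniform closeness on [[0, T]] is stated for arbitrarily late [n]
    only, which suffices since remainders are estimated one pair of times at a time. *)
Lemma scheme_limit p L (Z : R -> W) ZZ xi b g h phi (x : V) (tau : R) :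
  (forall T, 0 < T -> rde_data p L T Z ZZ xi b g h phi) ->
  (forall r t, 0 <= r -> r <= t -> phi r <= phi t) ->
  0 <= tau ->
  exists (sig : nat -> R) (YY CC : nat -> nat -> V) (y : R -> V) (N0 : nat),
  [/\ forall n, 0 < sig n,
      forall del, 0 < del -> exists N, forall n, (N <= n)%N -> sig n < del,
      forall n, (N0 <= n)%N -> euler_scheme Z ZZ xi b (sig n) (YY n) (CC n),
      y tau = x &
      (forall T e, 0 < T -> 0 < e -> exists2 del, 0 < del & forall s t,
        0 <= s -> s <= t -> t <= T -> t - s < del -> `|y t - y s| <= e) /\
      (forall T e N, 0 < T -> 0 < e -> exists2 n, (N <= n)%N & forall t, 0 <= t -> t <= T ->
        `|YY n (cell (sig n) t) - y t| <= e)].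
Proof.
move=> D phi_nd tau0.
have D1 := D 1 ltr01; have p2 := rd_p2 D1; have p3 := rd_p3 D1.
have L1 := rf_ge1 (rd_field D1); have p0 : 0 < p by lra.
have [eps [c0 [K [epsP c00 _ win]]]] := scheme_window d m p2 p3 L1.
have wb := win Z ZZ xi b g h phi D.
have /andP[eps0 eps1] := epsP.
(* With mesh [tau / n.+1] the time [tau] lies on every grid, at index [n.+1]; for [tau = 0] the mesh
   [1 / n.+1] is used, with index 0. *)
pose tau' : R := if tau == 0 then 1 else tau.
have tau'0 : 0 < tau'.
  by rewrite /tau'; case: eqVneq => // tn0; rewrite lt_neqAle eq_sym tn0.
pose sig (n : nat) : R := tau' / n.+1%:R.
pose l0 (n : nat) := if tau == 0 then 0%N else n.+1.
have sig0 n : 0 < sig n by rewrite divr_gt0.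
have l0tau n : (l0 n)%:R * sig n = tau.
  rewrite /l0 /sig /tau'; case: eqVneq => [->|_]; first by rewrite mul0r.
  by rewrite mulrC divfK.
have sigs del : 0 < del -> exists N, forall n, (N <= n)%N -> sig n < del.
  move=> del0; exists (Num.truncn (tau' / del)) => n Nn.
  rewrite /sig ltr_pdivrMr// mulrC -ltr_pdivrMr//.
  by apply: lt_le_trans (truncnS_gt _) _; rewrite ler_nat ltnS.
have mesh T kap : 0 < T -> 0 < kap -> exists2 del, 0 < del & forall r t,
    0 <= r -> r <= t -> t <= T -> t - r < del -> phi t - phi r < kap.
  move=> T0 kap0.
  have [del del0 hd] := itv_uniform_continuous (ct_cont (rd_control (D T T0))) kap0.
  exists del => // r t r0 rt tT tr; apply: le_lt_trans (ler_norm _) _; apply: hd.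
  - by rewrite tT (le_trans r0).
  - by rewrite r0 (le_trans rt).
  - by rewrite ger0_norm ?subr_ge0.
have alpha_small kap : 0 < kap -> forall r t, 0 <= r -> r <= t ->
    phi t - phi r < kap `^ p -> (phi t - phi r) `^ p^-1 <= kap.
  move=> kap0 r t r0 rt /ltW h1; apply: powR_inv_le => //; last exact: ltW.
  by rewrite subr_ge0 phi_nd.
(* Increments and areas at most [1 / (4 L)] give the implicit step the Lipschitz constant one
   half. *)
pose kap1 := Num.min 1 (4 * L)^-1.
have L40 : 0 < 4 * L by lra.
have kap10 : 0 < kap1 by rewrite lt_min ltr01 invr_gt0.
have [d1 d10 hd1] := mesh (tau + 1) (kap1 `^ p) ltac:(lra) (powR_gt0 _ kap10).
have [N0 hN0] := sigs d1 d10.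
have sch n : exists YC : (nat -> V) * (nat -> V), (N0 <= n)%N ->
    YC.1 (l0 n) = x /\ euler_scheme Z ZZ xi b (sig n) YC.1 YC.2.
  have [Nn|_] := leqP N0 n; last by exists (fun=> 0, fun=> 0).
  have small l : (l < l0 n)%N ->
      L * (`|delta Z (l%:R * sig n) (l.+1%:R * sig n)| + `|ZZ (l%:R * sig n) (l.+1%:R * sig n)|) <= 2^-1.
    move=> ll; have T1 : 0 < tau + 1 by lra.
    have r0 : 0 <= l%:R * sig n by rewrite mulr_ge0// ltW.
    have rt : l%:R * sig n <= l.+1%:R * sig n by rewrite ler_wpM2r ?ler_nat// ltW.
    have tT : l.+1%:R * sig n <= tau + 1.
      apply: (@le_trans _ _ tau); last by rewrite lerDl.
      by rewrite -(l0tau n) ler_wpM2r ?ler_nat// ltW.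
    have dt : l.+1%:R * sig n - l%:R * sig n < d1.
      by rewrite -mulrBl -natrB ?leqnSn// subSnn mul1r hN0.
    have al := alpha_small _ kap10 _ _ r0 rt (hd1 _ _ r0 rt tT dt).
    have hZ := ct_Z (rd_control (D _ T1)) r0 rt tT.
    have hZZ := ct_ZZ (rd_control (D _ T1)) r0 rt tT.
    have al0 : 0 <= (phi (l.+1%:R * sig n) - phi (l%:R * sig n)) `^ p^-1 by exact: powR_ge0.
    move: hZ hZZ al al0; set al := _ `^ _ => hZ hZZ alk al0.
    have al1 : al <= 1 by apply: le_trans alk _; rewrite ge_min lexx.
    have al4 : al <= (4 * L)^-1 by apply: le_trans alk _; rewrite ge_min lexx orbT.
    have alal : al ^+ 2 <= al by rewrite expr2 ler_piMl.
    apply: (@le_trans _ _ (L * (2 * (4 * L)^-1))).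
      rewrite ler_wpM2l//; first by lra.
      rewrite [leRHS]mulr_natl mulr2n; apply: lerD; first exact: le_trans hZ al4.
      exact: le_trans hZZ (le_trans alal al4).
    rewrite le_eqVlt; apply/orP; left; apply/eqP; field.
    by rewrite gt_eqF//; lra.
  have [Y [c [Yx hs]]] := euler_scheme_exists x D (sig0 n) small.
  by exists (Y, c).
have [YC YCP] := choice sch.
pose YY n := (YC n).1; pose CC n := (YC n).2.
have schn n : (N0 <= n)%N -> euler_scheme Z ZZ xi b (sig n) (YY n) (CC n).
  by move=> /YCP[].
have inc0 n t : 0 <= t -> 0 <= (cell (sig n) t)%:R * sig n by move=> _; rewrite mulr_ge0// ltW.
(* Times closer than [d2 / 2], rounded to a mesh finer than [d2 / 2], stay within [d2] of each
   other. *)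
have equi T e : 0 < T -> 0 < e -> exists2 del, 0 < del & exists N, forall n, (N <= n)%N ->
    forall s t, 0 <= s -> s <= t -> t <= T -> t - s < del ->
    `|YY n (cell (sig n) t) - YY n (cell (sig n) s)| <= e.
  move=> T0 e0; pose kap := Num.min eps (e / (c0 + 1)).
  have c10 : 0 < c0 + 1 by lra.
  have kap0 : 0 < kap by rewrite lt_min eps0 divr_gt0.
  have [d2 d20 hd2] := mesh T (kap `^ p) T0 (powR_gt0 _ kap0).
  have d220 : 0 < d2 / 2 by rewrite divr_gt0.
  have [N hN] := sigs _ d220.
  exists (d2 / 2) => //; exists (maxn N N0) => n; rewrite geq_max => /andP[Nn N0n].
  move=> s t s0 st tT ts.
  have t0 : 0 <= t := le_trans s0 st.
  have [s1 s2] := cell_itv (sig0 n) s0; have [t1 t2] := cell_itv (sig0 n) t0.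
  have cst := cell_le (sig0 n) st.
  have rt : (cell (sig n) s)%:R * sig n <= (cell (sig n) t)%:R * sig n.
    by rewrite ler_wpM2r ?ler_nat// ltW.
  have tT' : (cell (sig n) t)%:R * sig n <= T := le_trans t1 tT.
  have hsig := hN n Nn.
  have dt : (cell (sig n) t)%:R * sig n - (cell (sig n) s)%:R * sig n < d2.
    rewrite -natr1 mulrDl mul1r in s2.
    move: t1 ts s2 hsig; clear; lra.
  have al := alpha_small _ kap0 _ _ (inc0 n s s0) rt (hd2 _ _ (inc0 n s s0) rt tT' dt).
  have aleps : (phi ((cell (sig n) t)%:R * sig n) - phi ((cell (sig n) s)%:R * sig n)) `^ p^-1 <= eps.
    by apply: le_trans al _; rewrite ge_min lexx.
  have [_ Yts] := wb T (sig n) (YY n) (CC n) T0 (sig0 n) (schn n N0n) _ _ cst tT' aleps.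
  apply: le_trans Yts _; apply: (@le_trans _ _ ((c0 + 1) * (e / (c0 + 1)))).
    apply: ler_pM => //; rewrite ?powR_ge0//; first by rewrite lerDl.
    by apply: le_trans al _; rewrite ge_min lexx orbT.
  by rewrite mulrC divfK// gt_eqF.
have [U [ultraU Uoo]] := ultraFilterLemma (F := \oo) _.
have UF : ProperFilter U := ultra_proper.
have Uge N : U [set n | (N <= n)%N] by apply: Uoo; exists N.
have limt t : exists v, 0 <= t -> forall e, 0 < e ->
    U [set n | `|YY n (cell (sig n) t) - v| <= e].
  have [t0|_] := leP 0 t; last by exists 0.
  have Tp : 0 < tau + t + 1 by lra.
  have ep0 : 0 < eps `^ p / 2 by rewrite divr_gt0// powR_gt0.
  have [d3 d30 hd3] := mesh (tau + t + 1) _ Tp ep0.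
  have [N hN] := sigs _ d30.
  have [Bd hB] := scheme_bounded (eps `^ p / 2) p2 epsP c00 Tp wb phi_nd.
  have ub : U [set n | `|YY n (cell (sig n) t)| <= Bd + `|x|].
    apply: filterS (Uge (maxn N N0)) => n /=; rewrite geq_max => /andP[Nn N0n].
    have [Yx hs] := YCP n N0n.
    have step l : l.+1%:R * sig n <= tau + t + 1 ->
        phi (l.+1%:R * sig n) - phi (l%:R * sig n) <= eps `^ p / 2.
      move=> lT; apply: ltW; apply: hd3 => //; first by rewrite mulr_ge0// ltW.
        by rewrite ler_wpM2r ?ler_nat// ltW.
      by rewrite -mulrBl -natrB ?leqnSn// subSnn mul1r hN.
    have l0T : (l0 n)%:R * sig n <= tau + t + 1 by rewrite l0tau; lra.
    have cT : (cell (sig n) t)%:R * sig n <= tau + t + 1.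
      by have [h1 _] := cell_itv (sig0 n) t0; lra.
    have := hB (sig n) (YY n) (CC n) (l0 n) (sig0 n) hs l0T step _ cT.
    rewrite [YY n (l0 n)]Yx => hx.
    rewrite -[YY n _](subrK x); apply: le_trans (ler_normD _ _) _.
    by rewrite lerD2r.
  have [v vP] := ultra_bounded_limit ultraU ub.
  by exists v.
have [y yP] := choice limt.
have Uex (A : set nat) : U A -> exists n, A n by exact: filter_ex.
have ycont T e : 0 < T -> 0 < e -> exists2 del, 0 < del & forall s t,
    0 <= s -> s <= t -> t <= T -> t - s < del -> `|y t - y s| <= e.
  move=> T0 e0; have e3 : 0 < e / 3 by rewrite divr_gt0.
  have [del del0 [N hN]] := equi T _ T0 e3.
  exists del => // s t s0 st tT ts.
  have [n [/= [Nn n1] n2]] := Uex _ (filterI (filterI (Uge N) (yP s s0 _ e3)) (yP t (le_trans s0 st) _ e3)).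
  have n3 := hN n Nn s t s0 st tT ts.
  have -> : y t - y s = - (YY n (cell (sig n) t) - y t) +
     (YY n (cell (sig n) t) - YY n (cell (sig n) s)) + (YY n (cell (sig n) s) - y s) by rv_ring.
  apply: le_trans (ler_normD _ _) _; apply: le_trans (lerD (ler_normD _ _) (lexx _)) _.
  rewrite normrN; apply: le_trans (lerD (lerD n2 n3) n1) _.
  by move: (e); clear; move=> z; lra.
exists sig, YY, CC, y, N0; split => //.
- have ct n : cell (sig n) tau = l0 n by rewrite -{1}(l0tau n) cell_grid.
  have small e : 0 < e -> `|x - y tau| <= e.
    move=> e0; have [n [/= N0n n1]] := Uex _ (filterI (Uge N0) (yP tau tau0 _ e0)).
    by have [Yx _] := YCP n N0n; rewrite ct [YY n (l0 n)]Yx in n1.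
  apply/eqP; rewrite eq_sym -subr_eq0 -normr_le0; apply/ler_addgt0Pr => e e0.
  by rewrite add0r small.
split => // T e N T0 e0.
have e3 : 0 < e / 3 by rewrite divr_gt0.
have [d1' d1'0 [N1 hN1]] := equi T _ T0 e3.
have [d2' d2'0 hy] := ycont T _ T0 e3.
pose del := Num.min d1' d2'.
have del0 : 0 < del by rewrite lt_min d1'0.
have dd1 : del <= d1' by rewrite ge_min lexx.
have dd2 : del <= d2' by rewrite ge_min lexx orbT.
(* Finitely many sample times [sj j] are settled by one member of the ultrafilter; equicontinuity of
   scheme and limit covers the times between them. *)
pose q := (Num.truncn (T / del)).+1.
have q0 : 0 < q%:R :> R by rewrite ltr0n.
have Tq : T / q%:R < del by rewrite ltr_pdivrMr// mulrC -ltr_pdivrMr//; exact: truncnS_gt.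
have Tq0 : 0 < T / q%:R by rewrite divr_gt0.
pose sj (j : nat) := j%:R * (T / q%:R).
have sj0 j : 0 <= sj j by rewrite mulr_ge0// ltW.
have Uall : U [set n | forall j : 'I_q.+1, `|YY n (cell (sig n) (sj j)) - y (sj j)| <= e / 3].
  by apply: filter_forall => j; exact: yP.
have [n [/= [Nn N1n] hall]] := Uex _ (filterI (filterI (Uge N) (Uge N1)) Uall).
exists n => // t t0 tT.
have [c1 c2] := cell_itv Tq0 t0; set j := cell (T / q%:R) t in c1 c2.
have jq : (j < q.+1)%N.
  rewrite ltnS -[leqRHS](cell_grid q Tq0); apply: cell_le => //.
  by rewrite mulrC divfK// gt_eqF.
have hj := hall (Ordinal jq).
have sjt : t - sj j < del.
  rewrite -natr1 mulrDl mul1r -/(sj j) in c2.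
  by move: c2 Tq; clear; lra.
have a1 := hN1 n N1n (sj j) t (sj0 j) c1 tT (lt_le_trans sjt dd1).
have a2 := hy (sj j) t (sj0 j) c1 tT (lt_le_trans sjt dd2).
have -> : YY n (cell (sig n) t) - y t = (YY n (cell (sig n) t) - YY n (cell (sig n) (sj j))) +
  (YY n (cell (sig n) (sj j)) - y (sj j)) - (y t - y (sj j)) by rv_ring.
apply: le_trans (ler_normB _ _) _; apply: le_trans (lerD (ler_normD _ _) (lexx _)) _.
apply: le_trans (lerD (lerD a1 hj) a2) _.
by move: (e); clear; move=> z; lra.
Qed.

End SchemeLimit.

(** * Passing to the limit in the remainder *)

Section SchemeRemainder.
Variables (R : realType) (d m : nat).
Notation V := 'rV[R]_d.
Notation W := 'rV[R]_m.

Lemma simplex_continuousP k l (F : R -> R -> 'M[R]_(k, l)) (T s t : R) :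
  {within simplex T, continuous (fun st => F st.1 st.2)} ->
  0 <= s -> s <= t -> t <= T -> forall e, 0 < e -> exists2 del, 0 < del &
  forall s' t', 0 <= s' -> s' <= t' -> t' <= T -> `|s - s'| < del -> `|t - t'| < del ->
  `|F s t - F s' t'| < e.
Proof.
move=> cF s0 st tT e e0.
have Ast : simplex T (s, t) by split => //=; rewrite s0.
have /cvgrPdist_lt /(_ e e0) := (subspace_continuousP _ _).1 cF (s, t) Ast.
rewrite near_withinE => /nbhs_ballP[del /= del0 hd]; exists del => //.
move=> s' t' s'0 s't' t'T ss' tt'; apply: (hd (s', t')); last by split => //=; rewrite s'0.
by rewrite -ball_normE /= prod_normE/= gt_max ss'.
Qed.

Lemma scheme_drift_close p L T (Z : R -> W) ZZ (xi : 'I_m -> V -> V) b g h phi s (c : nat -> V) (y : R -> V) ka i j :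
  rde_data p L T Z ZZ xi b g h phi -> {within `[0, T]%classic, continuous y} ->
  0 < s -> j%:R * s <= T ->
  (forall l r, (l < j)%N -> l%:R * s <= r -> r <= l.+1%:R * s -> h (enorm (y r - c l)) <= ka) ->
  (i <= j)%N ->
  `|vint (fun r => b r (y r)) (i%:R * s) (j%:R * s) -
    (scheme_drift b s c j - scheme_drift b s c i)| <= ka * (gint g (j%:R * s) - gint g (i%:R * s)).
Proof.
move=> D cy s0 jT hc ij.
have t0 (l : nat) : 0 <= l%:R * s by rewrite mulr_ge0// ltW.
have tle (k l : nat) : (k <= l)%N -> k%:R * s <= l%:R * s by move=> kl; rewrite ler_wpM2r ?ler_nat// ltW.
have IH k : (i <= k)%N -> (k <= j)%N ->
    `|vint (fun r => b r (y r)) (i%:R * s) (k%:R * s) -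
    (scheme_drift b s c k - scheme_drift b s c i)| <= ka * (gint g (k%:R * s) - gint g (i%:R * s)).
  elim: k => [|k IH].
    rewrite leqn0 => /eqP-> _; rewrite !subrr subr0 mulr0.
    have T0 := le_trans (t0 j) jT.
    apply: le_trans (vint_le (rd_borel D) (rd_g0 D) (rd_g D) (rd_bg D) cy (t0 0%N) (lexx _) _) _.
      by rewrite mul0r.
    by rewrite subrr.
  rewrite leq_eqVlt => /predU1P[<- ij'|ik kj].
    have iT := le_trans (tle _ _ ij') jT.
    rewrite !subrr subr0 mulr0.
    apply: le_trans (vint_le (rd_borel D) (rd_g0 D) (rd_g D) (rd_bg D) cy (t0 i) (lexx _) iT) _.
    by rewrite subrr.
  have {}IH := IH ik (ltnW kj).
  have kT := le_trans (tle k.+1 j kj) jT.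
  have sp := vint_split (rd_borel D) (rd_g0 D) (rd_g D) (rd_bg D) cy (t0 i) (tle i k ik) (tle _ _ (leqnSn k)) kT.
  have st := vint_diff_le (rd_borel D) (rd_g0 D) (rd_g D) (rd_bg D) cy (@cst_within_continuous _ _ T (c k))
    (rd_bh D) (t0 k) (tle _ _ (leqnSn k)) kT (fun r => hc k r kj).
  have SE : scheme_drift b s c k.+1 = scheme_drift b s c k + vint (fun r => b r (c k)) (k%:R * s) (k.+1%:R * s).
    by rewrite /scheme_drift big_nat_recr.
  rewrite sp SE; move: st IH; clear.
  move: (vint _ (i%:R * s) (k%:R * s)) (vint (fun r => b r (y r)) (k%:R * s) _)
    (vint (fun r => b r (c k)) _ _) (scheme_drift b s c k) (scheme_drift b s c i).
  move: (gint g _) (gint g _) (gint g _) => g1 g2 g3 v1 v2 v3 S1 S2 h1 h2.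
  have -> : v1 + v2 - (S1 + v3 - S2) = (v1 - (S1 - S2)) + (v2 - v3) by rv_ring.
  apply: le_trans (ler_normD _ _) _; apply: le_trans (lerD h2 h1) _.
  by rewrite le_eqVlt; apply/orP; left; apply/eqP; ring.
exact: IH.
Qed.

(** Both times are rounded down to the grid. The error collects [e] for each end value of [y], [e]
    for each of the two pieces of drift cut off, [ka * gint g T] for freezing the drift on cells,
    and the errors of the field and area terms in the last summand. *)
Lemma scheme_remainder_close p L T (Z : R -> W) ZZ (xi : 'I_m -> V -> V) b g h phi sig Y c (y : R -> V) (s t e ka : R) :
  rde_data p L T Z ZZ xi b g h phi -> {within `[0, T]%classic, continuous y} ->
  0 < sig -> (forall l, c l = Y l \/ c l = Y l.+1) ->
  0 <= s -> s <= t -> t <= T -> 0 <= ka ->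
  let i := cell sig s in let j := cell sig t in
  let a := i%:R * sig in let a' := j%:R * sig in
  (forall r : R, 0 <= r -> r <= T -> `|Y (cell sig r) - y r| <= e) ->
  (forall r r' : R, 0 <= r -> r <= r' -> r' <= T -> r' - r <= sig -> `|y r' - y r| <= e) ->
  (forall r r' : R, 0 <= r -> r <= r' -> r' <= T -> r' - r <= sig -> gint g r' - gint g r <= e) ->
  `|delta Z s t - delta Z a a'| <= e -> `|ZZ s t - ZZ a a'| <= e ->
  (forall x : R, 0 <= x -> x <= d%:R * (2 * e) -> h x <= ka) ->
  `|rde_remainder b xi Z ZZ y s t -
    rem2 (field_lin xi) (Xi xi) (fun i j => delta Z (i%:R * sig) (j%:R * sig))
     (fun i j => ZZ (i%:R * sig) (j%:R * sig)) Y (scheme_drift b sig c) i j| <=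
  4 * e + ka * gint g T +
    L * e * (2 + (phi T - phi 0) `^ p^-1 + ((phi T - phi 0) `^ p^-1) ^+ 2).
Proof.
move=> D cy sig0 cY s0 st tT ka0 i j a a' hY hy hg hZ hZZ hh.
have L1 := rf_ge1 (rd_field D); have L0 : 0 <= L by apply: le_trans L1.
have t0 := le_trans s0 st; have sT := le_trans st tT.
have T0 := le_trans t0 tT.
have [as1 as2] := cell_itv sig0 s0; have [at1 at2] := cell_itv sig0 t0.
rewrite -/i -/a in as1 as2; rewrite -/j -/a' in at1 at2.
have ij : (i <= j)%N by exact: cell_le.
have a0 : 0 <= a by rewrite mulr_ge0// ltW.
have aa' : a <= a' by rewrite ler_wpM2r ?ler_nat// ltW.
have a'T := le_trans at1 tT; have aT := le_trans as1 sT; have a'0 := le_trans a0 aa'.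
have sa : s - a <= sig.
  by move: as2; rewrite -natr1 mulrDl mul1r -/a; clear; lra.
have ta : t - a' <= sig.
  by move: at2; rewrite -natr1 mulrDl mul1r -/a'; clear; lra.
have e0 : 0 <= e := le_trans (normr_ge0 _) hZ.
have hc l r : (l < j)%N -> l%:R * sig <= r -> r <= l.+1%:R * sig -> h (enorm (y r - c l)) <= ka.
  move=> lj lr rl; apply: hh; first exact: enorm_ge0.
  apply: le_trans (enorm_le_norm _) _; rewrite mul1n ler_wpM2l//.
  have l0 (k : nat) : 0 <= k%:R * sig by rewrite mulr_ge0// ltW.
  have lT : l.+1%:R * sig <= T by apply: le_trans a'T; rewrite ler_wpM2r ?ler_nat// ltW.
  have lsig : l.+1%:R * sig - l%:R * sig = sig by rewrite -mulrBl -natrB ?leqnSn// subSnn mul1r.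
  have rT := le_trans rl lT.
  case: (cY l) => ->.
    have h1 := hY (l%:R * sig) (l0 l) (le_trans lr rT); rewrite cell_grid// in h1.
    have h2 := hy _ r (l0 l) lr rT.
    have {h2}h2 : `|y r - y (l%:R * sig)| <= e by apply: h2; rewrite -{2}lsig lerB.
    apply: le_trans (ler_distD (y (l%:R * sig)) _ _) _.
    by rewrite [leRHS]mulr_natl mulr2n lerD// distrC.
  have h1 := hY (l.+1%:R * sig) (l0 _) lT; rewrite cell_grid// in h1.
  have h2 := hy r _ (le_trans (l0 _) lr) rl lT.
  have {h2}h2 : `|y (l.+1%:R * sig) - y r| <= e by apply: h2; rewrite -{2}lsig lerB.
  apply: le_trans (ler_distD (y (l.+1%:R * sig)) _ _) _.
  by rewrite [leRHS]mulr_natl mulr2n lerD// distrC.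
have dr := scheme_drift_close D cy sig0 a'T hc ij.
have gg : gint g a' - gint g a <= gint g T.
  have h1 := gint_le (rd_g0 D) (rd_g D) a'0 a'T (lexx T).
  have h2 := gint_le (rd_g0 D) (rd_g D) (lexx 0) a0 (le_trans as1 sT).
  rewrite gint0 in h2; move: h1 h2; clear; lra.
have {}dr := le_trans dr (ler_wpM2l ka0 gg).
have sp1 := vint_split (rd_borel D) (rd_g0 D) (rd_g D) (rd_bg D) cy a0 as1 st tT.
have sp2 := vint_split (rd_borel D) (rd_g0 D) (rd_g D) (rd_bg D) cy a0 aa' at1 tT.
have v1 := le_trans (vint_le (rd_borel D) (rd_g0 D) (rd_g D) (rd_bg D) cy a0 as1 sT) (hg _ _ a0 as1 sT sa).
have v2 := le_trans (vint_le (rd_borel D) (rd_g0 D) (rd_g D) (rd_bg D) cy a'0 at1 tT) (hg _ _ a'0 at1 tT ta).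
pose P := (phi T - phi 0) `^ p^-1.
have P0 : 0 <= P by exact: powR_ge0.
have alP : (phi a' - phi a) `^ p^-1 <= P.
  have ctl := ct_le (rd_control D).
  have p2 := rd_p2 D; have pV0 : 0 <= p^-1 by rewrite invr_ge0; lra.
  have c1 : 0 <= phi a' - phi a by rewrite subr_ge0 ctl.
  have c2 : phi a' - phi a <= phi T - phi 0 by apply: lerB; apply: ctl.
  by apply: ge0_ler_powR; rewrite ?nnegrE// (le_trans c1).
have hZP := le_trans (ct_Z (rd_control D) a0 aa' a'T) alP.
have hZZP : `|ZZ a a'| <= P ^+ 2.
  apply: le_trans (ct_ZZ (rd_control D) a0 aa' a'T) _.
  by rewrite ler_sqr ?nnegrE ?powR_ge0.
have Ys := hY s s0 sT; have Yt := hY t t0 tT; rewrite -/i in Ys; rewrite -/j in Yt.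
have XE : `|field_lin xi (y s) (delta Z s t) - field_lin xi (Y i) (delta Z a a')| <= L * e * (1 + P).
  have -> : delta Z s t = delta Z a a' + (delta Z s t - delta Z a a') by rewrite addrC subrK.
  rewrite (rf_XD (rd_field D)) addrAC mulrDr mulr1 addrC.
  apply: le_trans (ler_normD _ _) _; apply: lerD.
    by apply: le_trans (rf_Xb (rd_field D) _ _) _; rewrite ler_wpM2l.
  apply: le_trans (rf_Xlip (rd_field D) _ _ _) _.
  by apply: ler_pM => //; rewrite ?mulr_ge0// ler_wpM2l// distrC.
have GE : `|Xi xi (y s) (ZZ s t) - Xi xi (Y i) (ZZ a a')| <= L * e * (1 + P ^+ 2).
  have -> : ZZ s t = ZZ a a' + (ZZ s t - ZZ a a') by rewrite addrC subrK.
  rewrite (rf_GD (rd_field D)) addrAC mulrDr mulr1 addrC.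
  apply: le_trans (ler_normD _ _) _; apply: lerD.
    by apply: le_trans (rf_Gb (rd_field D) _ _) _; rewrite ler_wpM2l.
  apply: le_trans (rf_Glip (rd_field D) _ _ _) _.
  by apply: ler_pM => //; rewrite ?mulr_ge0// ler_wpM2l// distrC.
rewrite /rde_remainder /rem2 /rem1 -/a -/a' -/P.
have XS : \sum_(k < m) (delta Z s t) 0 k *: xi k (y s) = field_lin xi (y s) (delta Z s t) by [].
rewrite XS /(delta y s t).
have vE : vint (fun r => b r (y r)) s t = vint (fun r => b r (y r)) a a' +
    vint (fun r => b r (y r)) a' t - vint (fun r => b r (y r)) a s.
  by rewrite -sp2 sp1 addrC addKr.
rewrite vE; move: XE GE dr v1 v2 Ys Yt; rewrite -/a -/a'.
move: (field_lin xi (y s) _) (field_lin xi (Y i) _) (Xi xi (y s) _) (Xi xi (Y i) _)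
  (vint _ a a') (vint _ a' t) (vint _ a s) => X1 X2 G1 G2 u1 u2 u3.
move: (y s) (y t) (Y i) (Y j) (scheme_drift b sig c i) (scheme_drift b sig c j) =>
  y1 y2 Y1 Y2 S1 S2.
clear => h1 h2 h3 h4 h5 h6 h7.
have -> : y2 - y1 - (u1 + u2 - u3) - X1 - G1 - (Y2 - Y1 - X2 - (S2 - S1) - G2) =
  - (Y2 - y2) + (Y1 - y1) - u2 + u3 - (u1 - (S2 - S1)) - (X1 - X2) - (G1 - G2) by rv_ring.
have N7 (n1 n2 n3 n4 n5 n6 n7 : V) :
    `|- n1 + n2 - n3 + n4 - n5 - n6 - n7| <= `|n1| + `|n2| + `|n3| + `|n4| + `|n5| + `|n6| + `|n7|.
  do ![apply: le_trans (ler_normB _ _) _; rewrite lerD2r].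
  apply: le_trans (ler_normD _ _) _; rewrite lerD2r.
  apply: le_trans (ler_normB _ _) _; rewrite lerD2r.
  by apply: le_trans (ler_normD _ _) _; rewrite lerD2r normrN.
apply: le_trans (N7 _ _ _ _ _ _ _) _.
move: `|Y2 - y2| `|Y1 - y1| `|u2| `|u3| `|u1 - _| `|X1 - X2| `|G1 - G2| h1 h2 h3 h4 h5 h6 h7.
move=> n1 n2 n3 n4 n5 n6 n7 k1 k2 k3 k4 k5 k6 k7.
have -> : L * e * (2 + P + P ^+ 2) = L * e * (1 + P) + L * e * (1 + P ^+ 2) by ring.
move: (L * e * (1 + P)) (L * e * (1 + P ^+ 2)) k1 k2 k3 k4 k5 k6 k7; clear=> *; lra.
Qed.

End SchemeRemainder.

Section Existence.
Variables (R : realType) (d m : nat).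
Notation V := 'rV[R]_d.
Notation W := 'rV[R]_m.

Lemma osgood_small (h : R -> R) e : osgood h -> 0 < e ->
  exists2 del, 0 < del & forall x, 0 <= x -> x <= del -> h x <= e.
Proof.
move=> [/subspace_continuousP ch _ _ h0 _] e0.
have A0 : (`[0, +oo[%classic : set R) 0 by rewrite /= in_itv/= lexx.
have /cvgrPdist_le /(_ e e0) := ch 0 A0.
rewrite near_withinE => /nbhs_ballP[del /= del0 hd].
exists (del / 2); first by rewrite divr_gt0.
move=> x x0 xdel; have : `|h 0 - h x| <= e.
  apply: hd; last by rewrite /= in_itv/= x0.
  rewrite /ball/= sub0r normrN ger0_norm//; apply: le_lt_trans xdel _.
  by rewrite ltr_pdivrMr// ltr_pMr// ltr1n.
by rewrite h0 sub0r normrN; exact: le_trans (ler_norm _).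
Qed.

Lemma finite_qvar_of_control k (F : R -> R -> 'rV[R]_k) (phi : R -> R) (T q C : R) :
  (forall s t, 0 <= s -> s < t -> t <= T -> (enorm (F s t)) `^ q <= C * (phi t - phi s)) ->
  finite_qvar (@enorm R 1 k) q F 0 T.
Proof.
move=> FC; exists (C * (phi T - phi 0)) => ts.
suff gen s : 0 <= s -> is_partition s T ts ->
    qvar_sum (@enorm R 1 k) q F s ts <= C * (phi T - phi s) by exact: gen.
elim: ts s => [|u ts IH] s s0 pts.
  by case: pts => _ /= ->; rewrite /qvar_sum big_nil subrr mulr0.
have [/= /andP[su uts] lts] := pts.
have uT := is_partition_le (conj uts lts).
rewrite /qvar_sum big_cons; apply: le_trans (lerD (FC s u s0 su uT) (IH u _ (conj uts lts))) _.
  exact: le_trans (ltW su).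
by rewrite -mulrDr addrC addrA subrK.
Qed.

(** The bound on the scheme holds at the rounded times, where the increment of [phi] may be larger
    than from [s] to [t]. On a fine mesh the excess is at most [phi t - phi s], if that is positive;
    hence the factor 2 and the strict inequality in the premise. *)
Lemma limit_remainder (p L K eps T : R) (Z : R -> W) ZZ (xi : 'I_m -> V -> V) b g h phi
    (sig : nat -> R) (YY CC : nat -> nat -> V) (y : R -> V) (N0 : nat) s t :
  rde_data p L T Z ZZ xi b g h phi -> {within `[0, T]%classic, continuous y} -> 0 <= K ->
  (forall n, 0 < sig n) ->
  (forall del, 0 < del -> exists N, forall n, (N <= n)%N -> sig n < del) ->
  (forall n, (N0 <= n)%N -> euler_scheme Z ZZ xi b (sig n) (YY n) (CC n)) ->
  (forall n, (N0 <= n)%N -> forall i j, (i <= j)%N -> j%:R * sig n <= T ->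
    (phi (j%:R * sig n) - phi (i%:R * sig n)) `^ p^-1 <= eps ->
    `|rem2 (field_lin xi) (Xi xi) (fun i j => delta Z (i%:R * sig n) (j%:R * sig n))
     (fun i j => ZZ (i%:R * sig n) (j%:R * sig n)) (YY n) (scheme_drift b (sig n) (CC n)) i j| <=
    K * ((phi (j%:R * sig n) - phi (i%:R * sig n)) `^ p^-1) ^+ 3) ->
  (forall e N, 0 < e -> exists2 n, (N <= n)%N & forall t, 0 <= t -> t <= T ->
        `|YY n (cell (sig n) t) - y t| <= e) ->
  0 <= s -> s < t -> t <= T -> phi s < phi t -> (2 * (phi t - phi s)) `^ p^-1 <= eps ->
  `|rde_remainder b xi Z ZZ y s t| <= K * ((2 * (phi t - phi s)) `^ p^-1) ^+ 3.
Proof.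
move=> D cy K0 sig0 sigs sch wb conv s0 st tT phist hold_eps.
have t0 : 0 <= t := le_trans s0 (ltW st).
have T0 : 0 <= T := le_trans t0 tT; have sT := le_trans (ltW st) tT.
have p2 := rd_p2 D; have pV0 : 0 <= p^-1 by rewrite invr_ge0; move: p2; clear; lra.
have L0 : 0 <= L by apply: le_trans (rf_ge1 (rd_field D)).
have ctl := ct_le (rd_control D).
have [cZ _ cZZ _ _] := rd_path D.
apply/ler_addgt0Pr => kap kap0.
have G0 : 0 <= gint g T.
  by have := gint_le (rd_g0 D) (rd_g D) (lexx 0) T0 (lexx T); rewrite gint0.
pose P := (phi T - phi 0) `^ p^-1.
have P0 : 0 <= P by exact: powR_ge0.
have k3 : 0 < kap / 3 by rewrite divr_gt0.
pose ka := kap / 3 / (gint g T + 1).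
have G1 : 0 < gint g T + 1 by move: G0; clear; lra.
have ka0 : 0 < ka by rewrite divr_gt0.
have [dh dh0 hdh] := osgood_small (rd_h D) ka0.
pose D1 := L * (2 + P + P ^+ 2) + 1.
have D10 : 0 < D1.
  by rewrite ltr_wpDl// mulr_ge0// addr_ge0 ?exprn_ge0// addr_ge0.
pose D2 := 2 * d%:R + 1 : R.
have D20 : 0 < D2 by rewrite ltr_wpDl// mulr_ge0.
pose e := Num.min (kap / 12) (Num.min (kap / 3 / D1) (dh / D2)).
have e0 : 0 < e by rewrite !lt_min !divr_gt0.
have e1 : 4 * e <= kap / 3.
  have -> : kap / 3 = 4 * (kap / 12) by field.
  by rewrite ler_wpM2l// ge_min lexx.
have e2 : L * e * (2 + P + P ^+ 2) <= kap / 3.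
  rewrite mulrAC; apply: (@le_trans _ _ (D1 * (kap / 3 / D1))).
    apply: ler_pM; rewrite ?(ltW e0)//.
    - by rewrite mulr_ge0// addr_ge0 ?exprn_ge0// addr_ge0.
    - by rewrite /D1 lerDl.
    - by rewrite /e !ge_min lexx !orbT.
  by rewrite mulrC divfK// gt_eqF.
have e3 : d%:R * (2 * e) <= dh.
  apply: (@le_trans _ _ (D2 * (dh / D2))).
    rewrite mulrA; apply: ler_pM; rewrite ?(ltW e0)//.
    - by rewrite /D2 mulrC lerDl.
    - by rewrite /e !ge_min lexx !orbT.
  by rewrite mulrC divfK// gt_eqF.
have [d1 d10 hd1] := itv_uniform_continuous cy e0.
have [d2 d20 hd2] := itv_uniform_continuous (gint_continuous T0 (rd_g D)) e0.
have [d3 d30 hd3] := simplex_continuousP (delta_within_continuous cZ) s0 (ltW st) tT e0.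
have [d4 d40 hd4] := simplex_continuousP cZZ s0 (ltW st) tT e0.
have pst : 0 < phi t - phi s by rewrite subr_gt0.
have [d5 d50 hd5] := itv_uniform_continuous (ct_cont (rd_control D)) pst.
pose del := Num.min d1 (Num.min d2 (Num.min d3 (Num.min d4 d5))).
have del0 : 0 < del by rewrite !lt_min d10 d20 d30 d40.
have [N1 hN1] := sigs _ del0.
have [n Nn cl] := conv e (maxn N0 N1) e0.
move: Nn; rewrite geq_max => /andP[N0n /hN1].
rewrite !lt_min => /andP[sd1 /andP[sd2 /andP[sd3 /andP[sd4 sd5]]]].
have es := sch n N0n.
have cY l : CC n l = YY n l \/ CC n l = YY n l.+1 by have [] := es l.
have [as1 as2] := cell_itv (sig0 n) s0; have [at1 at2] := cell_itv (sig0 n) t0.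
have ij := cell_le (sig0 n) (ltW st).
have sg := sig0 n.
set i := cell (sig n) s in as1 as2 ij; set j := cell (sig n) t in at1 at2 ij.
have sa : s - i%:R * sig n <= sig n.
  by move: as2; rewrite -natr1 mulrDl mul1r; clear; lra.
have ta : t - j%:R * sig n <= sig n.
  by move: at2; rewrite -natr1 mulrDl mul1r; clear; lra.
have a0 : 0 <= i%:R * sig n by rewrite mulr_ge0// ltW.
have aa : i%:R * sig n <= j%:R * sig n by rewrite ler_wpM2r ?ler_nat// ltW.
have aT := le_trans at1 tT.
have dist u v : 0 <= v - u -> `|u - v| = v - u by move=> uv; rewrite distrC ger0_norm.
have sa0 : 0 <= s - i%:R * sig n by rewrite subr_ge0.
have ta0 : 0 <= t - j%:R * sig n by rewrite subr_ge0.
have dist' u v : 0 <= u - v -> `|u - v| = u - v by move=> uv; rewrite ger0_norm.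
have hZ : `|delta Z s t - delta Z (i%:R * sig n) (j%:R * sig n)| <= e.
  by apply: ltW; apply: hd3 => //; rewrite dist'//; [apply: le_lt_trans sa _|apply: le_lt_trans ta _].
have hZZ : `|ZZ s t - ZZ (i%:R * sig n) (j%:R * sig n)| <= e.
  by apply: ltW; apply: hd4 => //; rewrite dist'//; [apply: le_lt_trans sa _|apply: le_lt_trans ta _].
have osc f (dl : R) r r' : (forall x y : R, 0 <= x <= T -> 0 <= y <= T -> `|x - y| < dl -> f x y) ->
    sig n < dl -> 0 <= r -> r <= r' -> r' <= T -> r' - r <= sig n -> f r' r.
  move=> hf sdl r0 rr r'T rsig; apply: hf.
  - by rewrite r'T (le_trans r0).
  - by rewrite r0 (le_trans rr).
  - by rewrite ger0_norm ?subr_ge0//; apply: le_lt_trans sdl.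
have hy r r' : 0 <= r -> r <= r' -> r' <= T -> r' - r <= sig n -> `|y r' - y r| <= e.
  by move=> *; apply: ltW; apply: (osc (fun x x' => `|y x - y x'| < e) d1).
have hg r r' : 0 <= r -> r <= r' -> r' <= T -> r' - r <= sig n -> gint g r' - gint g r <= e.
  move=> *; apply: le_trans (ler_norm _) _; apply: ltW.
  by apply: (osc (fun x x' => `|gint g x - gint g x'| < e) d2).
have hphi : phi s - phi (i%:R * sig n) <= phi t - phi s.
  apply: le_trans (ler_norm _) _; apply: ltW.
  by apply: (osc (fun x x' => `|phi x - phi x'| < phi t - phi s) d5).
have hh x : 0 <= x -> x <= d%:R * (2 * e) -> h x <= ka.
  by move=> x0 xd; apply: hdh => //; exact: le_trans e3.
have close := scheme_remainder_close D cy sg cY s0 (ltW st) tT (ltW ka0) cl hy hg hZ hZZ hh.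
rewrite -/i -/j in close.
have al : (phi (j%:R * sig n) - phi (i%:R * sig n)) `^ p^-1 <= (2 * (phi t - phi s)) `^ p^-1.
  have h1 : 0 <= phi (j%:R * sig n) - phi (i%:R * sig n) by rewrite subr_ge0 ctl.
  have h2 := ctl _ _ (le_trans a0 aa) at1 tT.
  have h3 : phi (j%:R * sig n) - phi (i%:R * sig n) <= 2 * (phi t - phi s).
    by move: h2 hphi; clear; lra.
  by apply: ge0_ler_powR; rewrite ?nnegrE// (le_trans h1).
have r2 := wb n N0n i j ij aT (le_trans al hold_eps).
have r2' : K * ((phi (j%:R * sig n) - phi (i%:R * sig n)) `^ p^-1) ^+ 3 <=
    K * ((2 * (phi t - phi s)) `^ p^-1) ^+ 3.
  by rewrite ler_wpM2l// ler_pXn2r ?nnegrE ?powR_ge0.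
have kaG : ka * gint g T <= kap / 3.
  rewrite /ka mulrAC ler_pdivrMr//.
  by rewrite ler_wpM2l ?(ltW k3)// lerDl.
move: close {r2 r2'}(le_trans r2 r2') e1 e2 kaG; rewrite -/P.
move: (rem2 _ _ _ _ _ _ _ _) (rde_remainder _ _ _ _ _ _ _) => r1 r2.
move: (K * _) (L * e * _) (ka * _) => k1 k2 k4 h1 h2 h3 h4 h5.
have -> : r2 = r1 + (r2 - r1) by rewrite addrC subrK.
apply: le_trans (ler_normD _ _) _; apply: (lerD h2); apply: le_trans h1 _.
by move: h3 h4 h5; clear; lra.
Qed.

End Existence.

Section ExistenceRde.
Variables (R : realType) (d m : nat).
Notation V := 'rV[R]_d.
Notation W := 'rV[R]_m.

(** Covers pairs of times too far apart for the window estimate, where a constant suffices. *)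
Lemma remainder_bounded p L T (Z : R -> W) ZZ (xi : 'I_m -> V -> V) b g h phi (y : R -> V) :
  rde_data p L T Z ZZ xi b g h phi -> {within `[0, T]%classic, continuous y} ->
  exists B, forall s t, 0 <= s -> s <= t -> t <= T -> `|rde_remainder b xi Z ZZ y s t| <= B.
Proof.
move=> D cy; have L0 : 0 <= L by apply: le_trans (rf_ge1 (rd_field D)).
have T0 := ltW (rd_T D); have p2 := rd_p2 D.
have ctl := ct_le (rd_control D).
have cpt : compact (y @` `[0, T]%classic).
  by apply: continuous_compact; [exact: cy|exact: segment_compact].
have /pinfty_ex_gt0 [B B0 hB] := compact_bounded cpt.
have yB r : 0 <= r -> r <= T -> `|y r| <= B.
  by move=> r0 rT; apply: hB; exists r => //=; rewrite in_itv/= r0.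
pose P := (phi T - phi 0) `^ p^-1.
exists (B + B + gint g T + L * P + L * P ^+ 2) => s t s0 st tT.
have sT := le_trans st tT; have t0 := le_trans s0 st.
have al : (phi t - phi s) `^ p^-1 <= P.
  have pV0 : 0 <= p^-1 by rewrite invr_ge0; move: p2; clear; lra.
  have h1 : 0 <= phi t - phi s by rewrite subr_ge0 ctl.
  have h2 : phi t - phi s <= phi T - phi 0 by apply: lerB; apply: ctl.
  by apply: ge0_ler_powR; rewrite ?nnegrE// (le_trans h1).
have h1 : `|delta y s t| <= B + B.
  by apply: le_trans (ler_normB _ _) _; apply: lerD; apply: yB.
have h2 : `|vint (fun r => b r (y r)) s t| <= gint g T.
  apply: le_trans (vint_le (rd_borel D) (rd_g0 D) (rd_g D) (rd_bg D) cy s0 st tT) _.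
  have k1 := gint_le (rd_g0 D) (rd_g D) t0 tT (lexx T).
  have k2 := gint_le (rd_g0 D) (rd_g D) (lexx 0) s0 sT.
  by rewrite gint0 in k2; move: k1 k2; clear; lra.
have h3 : `|\sum_(k < m) delta Z s t 0 k *: xi k (y s)| <= L * P.
  apply: le_trans (rf_Xb (rd_field D) (y s) (delta Z s t)) _; rewrite ler_wpM2l//.
  exact: le_trans (ct_Z (rd_control D) s0 st tT) al.
have h4 : `|Xi xi (y s) (ZZ s t)| <= L * P ^+ 2.
  apply: le_trans (rf_Gb (rd_field D) (y s) (ZZ s t)) _; rewrite ler_wpM2l//.
  apply: le_trans (ct_ZZ (rd_control D) s0 st tT) _.
  by rewrite ler_sqr ?nnegrE ?powR_ge0.
rewrite /rde_remainder.
apply: le_trans (ler_normB _ _) _; apply: lerD => //.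
apply: le_trans (ler_normB _ _) _; apply: lerD => //.
by apply: le_trans (ler_normB _ _) _; apply: lerD.
Qed.

(** The value is prescribed at [tau], so the initial value [y 0] is an output. For short increments
    the cubic bound raised to the power [p / 3] is linear in the control, so its sums over
    partitions telescope. *)
Lemma rde_exists p L (Z : R -> W) ZZ (xi : 'I_m -> V -> V) b g h phi (x : V) (tau : R) :
  (forall T, 0 < T -> rde_data p L T Z ZZ xi b g h phi) ->
  (forall r t, 0 <= r -> r < t -> phi r < phi t) ->
  0 <= tau ->
  exists y, y tau = x /\ rde_global_solution p b xi Z ZZ (y 0) y.
Proof.
move=> D phi_lt tau0.
have D1 := D 1 ltr01; have p2 := rd_p2 D1; have p3 := rd_p3 D1.
have L1 := rf_ge1 (rd_field D1); have p0 : 0 < p by lra.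
have phi_nd r t : 0 <= r -> r <= t -> phi r <= phi t.
  by move=> r0; rewrite le_eqVlt => /predU1P[->//|rt]; exact/ltW/phi_lt.
have [eps [c0 [K [epsP c00 K0 win]]]] := scheme_window d m p2 p3 L1.
have wb := win Z ZZ xi b g h phi D.
have /andP[eps0 _] := epsP.
have [sig [YY [CC [y [N0 [sig0 sigs sch yx [ycont conv]]]]]]] := scheme_limit x D phi_nd tau0.
exists y; split => // T T0.
have DT := D T T0.
have cy : {within `[0, T]%classic, continuous y}.
  apply: within_continuousP => r e /andP[r0 rT] e0.
  have [del del0 hd] := ycont T e T0 e0; exists del => // t /andP[t0 tT].
  have [rt|tr] := leP r t.
    rewrite distrC ger0_norm ?subr_ge0// distrC => rtd; exact: hd.
  by rewrite ger0_norm ?subr_ge0 ?(ltW tr)// => rtd; apply: hd => //; exact: ltW.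
have small s t : 0 <= s -> s < t -> t <= T -> (2 * (phi t - phi s)) `^ p^-1 <= eps ->
    `|rde_remainder b xi Z ZZ y s t| <= K * ((2 * (phi t - phi s)) `^ p^-1) ^+ 3.
  move=> s0 st tT; apply: (limit_remainder DT cy K0 sig0 sigs sch) => //.
  - by move=> n Nn i j ij jT he; have [] := wb T (sig n) (YY n) (CC n) T0 (sig0 n) (sch n Nn) i j ij jT he.
  - by move=> e N e0; exact: conv.
  - exact: phi_lt.
have [B hB] := remainder_bounded DT cy.
have B0 : 0 <= B by apply: le_trans (hB 0 0 (lexx _) (lexx _) (ltW T0)).
split => //; first exact: (drift_enorm_integral (rd_borel DT) (rd_g0 DT) (rd_g DT) (rd_bg DT) cy).
have q0 : 0 < p / 3 by rewrite divr_gt0.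
have ep0 : 0 < eps `^ p by rewrite powR_gt0.
pose C1 := (d%:R * K) `^ (p / 3) * 2.
pose C2 := (d%:R * B) `^ (p / 3) * (2 / eps `^ p).
apply: (@finite_qvar_of_control _ _ _ phi _ _ (C1 + C2)) => s t s0 st tT.
have D0 : 0 < phi t - phi s by rewrite subr_gt0 phi_lt.
have D20 : 0 <= 2 * (phi t - phi s) by rewrite mulr_ge0// ltW.
have C10 : 0 <= C1 by rewrite mulr_ge0// powR_ge0.
have C20 : 0 <= C2 by rewrite mulr_ge0 ?powR_ge0// divr_ge0// ltW.
have en v (N : R) : `|v| <= N -> (@enorm R 1 d v) `^ (p / 3) <= (d%:R * N) `^ (p / 3).
  move=> vN; apply: ge0_ler_powR; rewrite ?nnegrE ?(ltW q0) ?enorm_ge0//.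
    by rewrite mulr_ge0// (le_trans _ vN).
  by apply: le_trans (enorm_le_norm _) _; rewrite mul1n ler_wpM2l.
have [sm|lg] := leP ((2 * (phi t - phi s)) `^ p^-1) eps.
  apply: le_trans (en _ _ (small s t s0 st tT sm)) _.
  rewrite mulrA powRM ?mulr_ge0 ?exprn_ge0 ?powR_ge0//.
  have -> : (((2 * (phi t - phi s)) `^ p^-1) ^+ 3) `^ (p / 3) = 2 * (phi t - phi s).
    rewrite -powR_mulrn ?powR_ge0// -!powRrM.
    have -> : p^-1 * (3%:R * (p / 3)) = 1 by field; rewrite gt_eqF.
    by rewrite powRr1.
  by rewrite mulrA -/C1 ler_wpM2r ?(ltW D0)// lerDl.
(* The increment of the control is now bounded below, so the constant bound is linear in it as
   well. *)
apply: le_trans (en _ _ (hB s t s0 (ltW st) tT)) _.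
have lg' : 1 <= 2 / eps `^ p * (phi t - phi s).
  rewrite mulrAC ler_pdivlMr// mul1r.
  rewrite leNgt; apply/negP => h1.
  by move: lg; rewrite ltNge => /negP; apply; apply: powR_inv_le; rewrite ?(ltW eps0)// ltW.
apply: (@le_trans _ _ (C2 * (phi t - phi s))); last by rewrite ler_wpM2r ?(ltW D0)// lerDr.
by rewrite /C2 -mulrA ler_peMr ?powR_ge0.
Qed.

End ExistenceRde.

(** * The flow *)

Section Flow.
Variables (R : realType) (d m : nat).
Notation V := 'rV[R]_d.
Notation W := 'rV[R]_m.

(** Adding time makes the control strictly increasing, as the passage to the limit requires.
    Existence carries no quantitative claim, so only it uses this control, and the stability
    constant keeps the original clock. *)
Lemma control_add_id p T (Z : R -> W) ZZ g phi : 2 <= p -> control p T Z ZZ g phi ->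
  control p T Z ZZ g (fun t => phi t + t).
Proof.
move=> p2 [cle cZ cZZ cg cc]; have pV0 : 0 <= p^-1 by rewrite invr_ge0; move: p2; clear; lra.
have mono s t : 0 <= s -> s <= t -> t <= T -> phi t - phi s <= phi t + t - (phi s + s).
  by move=> _ st _; rewrite opprD addrACA lerDl subr_ge0.
have powle s t : 0 <= s -> s <= t -> t <= T ->
    (phi t - phi s) `^ p^-1 <= (phi t + t - (phi s + s)) `^ p^-1.
  move=> s0 st tT; have h1 : 0 <= phi t - phi s by rewrite subr_ge0 cle.
  have h2 := mono s t s0 st tT.
  by apply: ge0_ler_powR; rewrite ?nnegrE// (le_trans h1).
split.
- by move=> s t s0 st tT; apply: lerD => //; exact: cle.
- by move=> s t s0 st tT; apply: le_trans (cZ s t s0 st tT) (powle s t s0 st tT).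
- move=> s t s0 st tT; apply: le_trans (cZZ s t s0 st tT) _.
  by rewrite ler_sqr ?nnegrE ?powR_ge0// powle.
- by move=> s t s0 st tT; apply: le_trans (cg s t s0 st tT) (mono s t s0 st tT).
- by move=> x; apply: cvgD; [exact: cc|apply: continuous_subspaceT => z; exact: cvg_id].
Qed.

Lemma enorm_sub_le0 (u v : V) : enorm (u - v) <= 0 -> u = v.
Proof.
move=> uv; apply/eqP; rewrite -subr_eq0 -normr_le0.
exact: le_trans (norm_le_enorm _) uv.
Qed.

Lemma Mh0 (h : R -> R) C (u : V) b : Mh h (C * enorm (u - u)) b = 0.
Proof. by rewrite subrr enorm_eq0 mulr0 /Mh lexx. Qed.

Lemma continuous_of_Mh (F : V -> V) h C b : osgood h -> 1 <= C ->
  (forall x x', enorm (F x - F x') <= Mh h (C * enorm (x - x')) b) -> continuous F.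
Proof.
move=> oh C1 FM x; apply/(@cvgrPdist_le _ _ _ (nbhs x)) => e e0.
have [del del0 hd] := Mh_small b oh e0.
have C0 : 0 < C by apply: lt_le_trans C1.
have D0 : 0 < C * (d%:R + 1) by rewrite mulr_gt0// ltr_wpDl.
apply/nbhs_ballP; exists (del / (C * (d%:R + 1))); first by rewrite /= divr_gt0.
move=> x'; rewrite -ball_normE/= ltr_pdivlMr// => /ltW xx'.
apply: le_trans (norm_le_enorm _) _; apply: le_trans (FM x x') _; apply: hd.
apply: le_trans xx'; rewrite [leRHS]mulrCA ler_wpM2l ?(ltW C0)//.
apply: le_trans (enorm_le_norm _) _; rewrite mul1n mulrC ler_wpM2l//.
by rewrite lerDl.
Qed.

End Flow.

Definition rde_hypotheses (R : realType) (d m : nat) (p : R) (Z : R -> 'rV[R]_m)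
    (ZZ : R -> R -> 'M[R]_(m, m)) (xi : 'I_m -> 'rV[R]_d -> 'rV[R]_d)
    (b : R -> 'rV[R]_d -> 'rV[R]_d) (g h : R -> R) : Prop :=
  [/\ rough_path_global p Z ZZ, C3b_family xi, borel_meas_nonneg_time b,
      locally_integrable_nonneg g &
   [/\ osgood h, forall t x, 0 <= t -> enorm (b t x) <= g t &
      forall t x x', 0 <= t -> enorm (b t x - b t x') <= g t * h (enorm (x - x'))]].

Section FlowConstants.
Variables (R : realType) (d m : nat) (p : R).
Hypotheses (p2 : 2 <= p) (p3 : p < 3).
Notation V := 'rV[R]_d.
Notation W := 'rV[R]_m.

Lemma rde_dataP (N : R) : exists2 L, 1 <= L & forall (Z : R -> W) ZZ
    (xi : 'I_m -> V -> V) b g h phi T,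
  rde_hypotheses p Z ZZ xi b g h -> C3b_family_norm xi <= N -> 0 < T ->
  control p T Z ZZ g phi -> rde_data p L T Z ZZ xi b g h phi.
Proof.
have N0 : 0 <= Num.max 0 N by rewrite le_max lexx.
have [L L1 hL] := C3b_rough_field d m N0; exists L => //.
move=> Z ZZ xi b g h phi T [rp C3 mb [g0 gi] [oh bg bh]] xiN T0 ctl.
split => //; [exact: rp| |exact: gi].
by apply: hL => //; apply: le_trans xiN _; rewrite le_max lexx orbT.
Qed.

(** The three numbers fix the constant before the horizon and the data, which is the form from which
    a constant function can be chosen. *)
Lemma flow_constant (N nZ G : R) : exists C, 1 <= C /\ forall T (Z : R -> W) ZZ
    (xi : 'I_m -> V -> V) b g h,
  rde_hypotheses p Z ZZ xi b g h -> 0 < T ->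
  C3b_family_norm xi = N -> rp_norm p T Z ZZ = nZ -> gint g T = G ->
  forall x x' y y', rde_solution p T b xi Z ZZ x y -> rde_solution p T b xi Z ZZ x' y' ->
  forall t, 0 <= t -> t <= T ->
  enorm (y t - y' t) <= Mh h (C * enorm (y 0 - y' 0)) (C * gint g T) /\
  enorm (y 0 - y' 0) <= Mh h (C * enorm (y t - y' t)) (C * gint g T).
Proof.
have [L L1 hL] := rde_dataP N.
have [C C1 hC] := solution_stability d m (nZ `^ p + nZ `^ (p / 2) + G) p2 p3 L1.
exists C; split=> // T Z ZZ xi b g h H T0 xiN ZN gG.
have [rp _ _ [g0 gi] _] := H.
have [ctl [cT c0]] := clock_control p2 T0 (rp T T0) g0 (gi T T0).
apply: (hC T Z ZZ xi b g h (clock p Z ZZ g)).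
  by apply: hL => //; rewrite xiN.
by rewrite c0 subr0 -ZN -gG.
Qed.

Lemma global_solution_exists (Z : R -> W) ZZ (xi : 'I_m -> V -> V) b g h x tau :
  rde_hypotheses p Z ZZ xi b g h -> 0 <= tau ->
  exists y, y tau = x /\ rde_global_solution p b xi Z ZZ (y 0) y.
Proof.
move=> H tau0; have [L _ hL] := rde_dataP (C3b_family_norm xi).
have [rp _ _ [g0 gi] _] := H.
have ctl T : 0 < T -> control p T Z ZZ g (clock p Z ZZ g).
  by move=> T0; have [] := clock_control p2 T0 (rp T T0) g0 (gi T T0).
apply: (@rde_exists _ _ _ p L Z ZZ xi b g h (fun t => clock p Z ZZ g t + t)) => //.
  by move=> T T0; apply: hL => //; apply: control_add_id => //; exact: ctl.
move=> r t r0 rt; have t0 : 0 < t by apply: le_lt_trans rt.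
by apply: ler_ltD => //; apply: (ct_le (ctl t t0)) => //; exact: ltW.
Qed.

End FlowConstants.

Unset Implicit Arguments.
Set Strict Implicit.

Theorem theorem3p9 (R : realType) (p : R) (d m : nat) :
  2 <= p -> p < 3 ->
  exists Cfun : R -> R -> R -> R -> R,
  forall (Z : R -> 'rV[R]_m) (ZZ : R -> R -> 'M[R]_(m, m))
         (xi : 'I_m -> 'rV[R]_d -> 'rV[R]_d)
         (b : R -> 'rV[R]_d -> 'rV[R]_d) (g h : R -> R),
  rough_path_global p Z ZZ ->
  C3b_family xi ->
  borel_meas_nonneg_time b ->
  locally_integrable_nonneg g ->
  osgood h ->
  (forall t x, 0 <= t -> enorm (b t x) <= g t) ->
  (forall t x x', 0 <= t -> enorm (b t x - b t x') <= g t * h (enorm (x - x'))) ->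
  (* existence and uniqueness of global solutions *)
  (forall x : 'rV[R]_d,
     (exists y, rde_global_solution p b xi Z ZZ x y) /\
     (forall y1 y2, rde_global_solution p b xi Z ZZ x y1 ->
                    rde_global_solution p b xi Z ZZ x y2 ->
                    forall t, 0 <= t -> y1 t = y2 t)) /\
  (* the flow, its inverse, homeomorphism property and the estimates *)
  exists (Phi Psi : R -> 'rV[R]_d -> 'rV[R]_d),
    (forall x, rde_global_solution p b xi Z ZZ x (fun t => Phi t x)) /\
    (forall t, 0 <= t ->
       [/\ continuous (Phi t), continuous (Psi t),
           cancel (Phi t) (Psi t) & cancel (Psi t) (Phi t)]) /\
    (forall T, 0 < T ->
       let C := Cfun T (C3b_family_norm xi) (rp_norm p T Z ZZ)
                     (Rintegral lebesgue_measure `[0, T]%classic g) in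
       forall x x' : 'rV[R]_d, forall t, 0 <= t -> t <= T ->
         enorm (Phi t x - Phi t x')
           <= Mh h (C * enorm (x - x')) (C * Rintegral lebesgue_measure `[0, T]%classic g) /\
         enorm (Psi t x - Psi t x')
           <= Mh h (C * enorm (x - x')) (C * Rintegral lebesgue_measure `[0, T]%classic g)).

Proof.
move=> p2 p3.
have [Cf CfP] := choice (fun N : R * R * R =>  flow_constant d m p2 p3 N.1.1 N.1.2 N.2).
(* The time argument is ignored: the horizon acts only through the norm of the rough path and the
   integral of [g]. *)
exists (fun _ N nZ G => Cf (N, nZ, G)) => Z ZZ xi b g h rp C3 mb gli oh bg bh.
have H : rde_hypotheses p Z ZZ xi b g h by split.
pose C T := Cf (C3b_family_norm xi, rp_norm p T Z ZZ, gint g T).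
have C1 T : 1 <= C T by have [] := CfP (C3b_family_norm xi, rp_norm p T Z ZZ, gint g T).
have stab T x x' y y' : 0 < T -> rde_global_solution p b xi Z ZZ x y ->
    rde_global_solution p b xi Z ZZ x' y' -> forall t, 0 <= t -> t <= T ->
    enorm (y t - y' t) <= Mh h (C T * enorm (y 0 - y' 0)) (C T * gint g T) /\
    enorm (y 0 - y' 0) <= Mh h (C T * enorm (y t - y' t)) (C T * gint g T).
  move=> T0 hy hy'; have [_ h1] := CfP (C3b_family_norm xi, rp_norm p T Z ZZ, gint g T).
  exact: (h1 T Z ZZ xi b g h H T0 erefl erefl erefl x x' y y' (hy T T0) (hy' T T0)).
have y0 x y : rde_global_solution p b xi Z ZZ x y -> y 0 = x.
  by move=> /(_ 1 ltr01)[].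
have t1 (t : R) : 0 <= t -> 0 < t + 1 /\ t <= t + 1 by move=> t0; split; lra.
have fwd x : exists y, rde_global_solution p b xi Z ZZ x y.
  by have [y [<- hy]] := global_solution_exists p2 p3 x H (lexx 0); exists y.
(* The solution through a given point at a given time; its initial value is the inverse flow.
   Negative times receive a dummy function. *)
have bwd (tx : R * 'rV[R]_d) : exists y, 0 <= tx.1 ->
    y tx.1 = tx.2 /\ rde_global_solution p b xi Z ZZ (y 0) y.
  have [t0|t0] := leP 0 tx.1; last by exists (fun=> 0).
  by have [y hy] := global_solution_exists p2 p3 tx.2 H t0; exists y.
split.
  move=> x; split; first exact: fwd.
  move=> y1 y2 h1 h2 t t0; have [T0 tT] := t1 t t0.
  have [+ _] := stab _ _ _ _ _ T0 h1 h2 t t0 tT.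
  by rewrite (y0 _ _ h1) (y0 _ _ h2) Mh0 => /enorm_sub_le0.
have [sol solP] := choice fwd; have [bsol bsolP] := choice bwd.
exists (fun t x => sol x t), (fun t x => bsol (t, x) 0).
have est T : 0 < T -> forall x x' t, 0 <= t -> t <= T ->
    enorm (sol x t - sol x' t) <= Mh h (C T * enorm (x - x')) (C T * gint g T) /\
    enorm (bsol (t, x) 0 - bsol (t, x') 0) <= Mh h (C T * enorm (x - x')) (C T * gint g T).
  move=> T0 x x' t t0 tT; split.
    have [+ _] := stab _ _ _ _ _ T0 (solP x) (solP x') t t0 tT.
    by rewrite (y0 _ _ (solP x)) (y0 _ _ (solP x')).
  have [e1 h1] := bsolP (t, x) t0; have [e2 h2] := bsolP (t, x') t0.
  have [_] := stab _ _ _ _ _ T0 h1 h2 t t0 tT.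
  by move: e1 e2 => /= -> ->.
split; first exact: solP.
split; last by move=> T T0 CT x x' t t0 tT; exact: est.
move=> t t0; have [T0 tT] := t1 t t0; split.
- by apply: (continuous_of_Mh oh (C1 (t + 1))) => x x'; exact: (est _ T0 x x' t t0 tT).1.
- by apply: (continuous_of_Mh oh (C1 (t + 1))) => x x'; exact: (est _ T0 x x' t t0 tT).2.
(* The solution through [sol x t] agrees with [sol x] at time [t]; the backward estimate makes the
   initial values equal. *)
- move=> x; have [e1 h1] := bsolP (t, sol x t) t0.
  have [_] := stab _ _ _ _ _ T0 h1 (solP x) t t0 tT.
  by move: e1 => /= ->; rewrite Mh0 (y0 _ _ (solP x)) => /enorm_sub_le0.
(* Here the initial values agree, and the forward estimate carries the equality to time [t]. *)
- move=> x; have [e1 h1] := bsolP (t, x) t0.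
  have [+ _] := stab _ _ _ _ _ T0 (solP (bsol (t, x) 0)) h1 t t0 tT.
  by rewrite (y0 _ _ (solP _)) Mh0 => /enorm_sub_le0; rewrite e1.
Qed.
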